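(* Let $\mathcal C\subset\mathbb V^{d+1}$ be a proper open convex cone and let $K\subset\mathbb A^{d+1}$ be a $C^2_+$ $\mathcal C$-convex domain. Then, in the local Steiner formula for $K$, $$V_\varepsilon(K)=\frac1{d+1}\sum_{i=0}^d\varepsilon^{d+1-i}\binom{d+1}{i}S_i(K)\qquad(\varepsilon>0),$$ the Radon measures $S_0(K),\dots,S_d(K)$ on $\mathbb P(\mathcal C^* )$ satisfy $$S_i(K)=\sigma_i(K)\,\mathrm{vol}_{\Sigma_{\mathcal C}},$$ where $\sigma_i(K):\mathbb P(\mathcal C^* )\to\mathbb R_{>0}$ is the $i$-th normalised elementary symmetric function of the principal radii of $\mathcal C$-curvature $r_1,\dots,r_d$ of $\partial_{sp}K$, i.e. $$\sigma_i(K)=\binom di^{-1}\sum_{1\le j_1<\cdots<j_i\le d}r_{j_1}\cdots r_{j_i}.$$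
   Context: Setting: $d\ge2$; $\mathbb V^{d+1}$ is an oriented $(d+1)$-dimensional real vector space with a linear volume form; $\mathbb A^{d+1}$ is the real affine space with translation space $\mathbb V^{d+1}$, with the induced volume measure $\mathrm{vol}$. A convex cone is proper if it is non-empty and its closure contains no entire line. $\mathcal C^*=\mathrm{int}\{\varphi\in(\mathbb V^{d+1})^*:\varphi(v)\le0\ \forall v\in\mathcal C\}$; a point $[\varphi]\in\mathbb P(\mathcal C^* )$ is identified with $\ker\varphi$, regarded as a direction of affine hyperplanes. A convex domain is a non-empty open convex set; a supporting hyperplane of it is an affine hyperplane $H$ with $H\cap K=\emptyset$, $H\cap\partial K\ne\emptyset$. A $\mathcal C$-convex domain is a convex domain $K$ with $K+\mathcal C=K$ whose set of directions of supporting hyperplanes contains $\mathbb P(\mathcal C^* )$ and is contained in $\overline{\mathbb P(\mathcal C^* )}$; $\partial_{sp}K$ is the set of boundary points having a supporting hyperplane with direction in $\mathbb P(\mathcal C^* )$. It is $C^2_+$ if $\partial K$ is $C^2$ and locally the graph of a convex function with non-degenerate Hessian; then the Gauss map $\mathcal G_K:\partial_{sp}K\to\mathbb P(\mathcal C^* )$ (direction of the tangent hyperplane) is a $C^1$ diffeomorphism. Affine sphere: choose coordinates (origin and positively oriented unit-volume basis) in which $\mathcal C=\{t(x,1):x\in\Omega,t>0\}$ with $\Omega\subset\mathbb R^d$ bounded open convex containing $0$; then $\mathcal C^*=\{t(y,-1):y\in\Omega^*,t>0\}$ with $\Omega^*=\{y:x\cdot y<1\ \forall x\in\overline\Omega\}$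 and $\mathbb P(\mathcal C^* )\simeq\Omega^*$. Let $\omega_{\mathcal C}:\Omega^*\to(-\infty,0)$ be the unique smooth convex function with $\det\mathrm{Hess}\,\omega=(-\omega)^{-d-2}$ in $\Omega^*$, $\omega|_{\partial\Omega^*}=0$. The map $N_{\Sigma_{\mathcal C}}(y)=(\nabla\omega_{\mathcal C}(y),\nabla\omega_{\mathcal C}(y)\cdot y-\omega_{\mathcal C}(y))$ parametrises the Cheng--Yau affine sphere $\Sigma_{\mathcal C}\subset\mathbb V^{d+1}$. Its canonical volume, seen on $\mathbb P(\mathcal C^* )\simeq\Omega^*$, is $\mathrm{vol}_{\Sigma_{\mathcal C}}=(-\omega_{\mathcal C})^{-d-1}\mathcal L$ with $\mathcal L$ the Lebesgue measure. Steiner formula: for Borel $b\subseteq\mathbb P(\mathcal C^* )$, $\mathcal N_\varepsilon(K)(b)$ is the set of points $P+tN_{\Sigma_{\mathcal C}}[\varphi]$ with $[\varphi]\in b$, $t\in(0,\varepsilon)$, and $P\in\partial K$ a point at which $K$ has a supporting hyperplane of direction $[\varphi]$; $V_\varepsilon(K)(b)=\mathrm{vol}(\mathcal N_\varepsilon(K)(b))$. The $S_i(K)$ are the unique Radon measures for which the displayed formula holds for all $\varepsilon>0$. $\mathcal C$-shape operator: for $C^2_+$ $K$, $S_K$ is the field of endomorphisms of $T\mathbb P(\mathcal C^* )$ defined by $\mathrm dN_{\Sigma_{\mathcal C}}(X)=\mathrm d(\mathcal G_K^{-1})(S_K X)$; in coordinates $S_K=(\mathrm{Hess}\,s)^{-1}\mathrm{Hess}\,\omega_{\mathcal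 C}$ with $s(y)=\sup_{X\in K}X\cdot(y,-1)$ the support function of $K$. Its eigenvalues $k_1,\dots,k_d$ are the principal $\mathcal C$-curvatures, and $r_j=1/k_j$ are the principal radii of $\mathcal C$-curvature. *)

(* Defs.v *)
From HB Require Import structures.
From mathcomp Require Import all_boot all_order all_algebra.
From mathcomp Require Import all_classical all_reals all_analysis.
From mathcomp Require Import measurable_realfun.
Set Implicit Arguments.
Unset Strict Implicit.
Unset Printing Implicit Defensive.
Import Order.TTheory GRing.Theory Num.Theory.
Import numFieldTopology.Exports numFieldNormedType.Exports.
Local Open Scope classical_set_scope.
Local Open Scope ring_scope.

Section lebesgue_tuple.
Context {R : realType}.
Local Notation RT := (measurableTypeR R).

Definition tcons n (p : RT * n.-tuple RT) : n.+1.-tuple RT :=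
  [the n.+1.-tuple RT of p.1 :: p.2].
Definition tuncons n (t : n.+1.-tuple RT) : RT * n.-tuple RT :=
  (tnth t ord0, [tuple of behead t]).

Lemma measurable_tcons n : measurable_fun [set: RT * n.-tuple RT] (@tcons n).
Proof. exact: measurable_cons measurable_fst measurable_snd. Qed.

Lemma measurable_tuncons n : measurable_fun [set: n.+1.-tuple RT] (@tuncons n).
Proof.
apply/measurable_fun_pairP.
by split; [exact: measurable_tnth|exact: measurable_behead].
Qed.

Lemma tconsK n : cancel (@tcons n) (@tuncons n).
Proof. by move=> [x t]; congr pair; exact: val_inj. Qed.

Section step.
Local Open Scope ereal_scope.
Variables (n : nat) (mu : {sigma_finite_measure set (n.-tuple RT) -> \bar R}).

Definition lebesgue_step : set (n.+1.-tuple RT) -> \bar R :=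
  pushforward ((@lebesgue_measure R) \x mu) (@tcons n).

(* The measure structure of a pushforward takes the measurability of the map as
   an argument, so it is not found by inference. *)
Let nu : {measure set (n.+1.-tuple RT) -> \bar R} :=
  measure_function_pushforward__canonical__measure_function_Measure
    ((@lebesgue_measure R) \x mu) (@measurable_tcons n).

Let step0 : lebesgue_step set0 = 0. Proof. exact: (measure0 nu). Qed.
Let step_ge0 A : 0 <= lebesgue_step A. Proof. exact: (measure_ge0 nu). Qed.
Let step_sigma_additive : semi_sigma_additive lebesgue_step.
Proof. exact: (@measure_semi_sigma_additive _ _ _ nu). Qed.

HB.instance Definition _ := isMeasure.Build _ _ _ lebesgue_step
  step0 step_ge0 step_sigma_additive.

Let step_sigma_finite : sigma_finite setT lebesgue_step.
Proof.
have /sigma_finiteP[F [TF ndF Foo]] := sigma_finiteT (@lebesgue_measure R).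
have /sigma_finiteP[G [TG ndG Goo]] := sigma_finiteT mu.
exists (fun k => @tuncons n @^-1` (F k `*` G k)).
  apply/seteqP; split => // t _.
  have [k1 _ Fk1] : (\bigcup_k F k) (tuncons t).1 by rewrite -TF.
  have [k2 _ Gk2] : (\bigcup_k G k) (tuncons t).2 by rewrite -TG.
  exists (maxn k1 k2) => //; split.
  - by move: Fk1; exact/subsetPset/ndF/leq_maxl.
  - by move: Gk2; exact/subsetPset/ndG/leq_maxr.
move=> k; have [mF ?] := Foo k; have [mG ?] := Goo k; split.
  rewrite -[X in measurable X]setTI.
  by apply: measurable_tuncons => //; exact: measurableX.
rewrite /lebesgue_step /pushforward -comp_preimage.
rewrite (_ : _ \o _ = id) ?preimage_id; last exact/funext/tconsK.
by rewrite product_measure1E// lte_mul_pinfty// ge0_fin_numE.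
Qed.

HB.instance Definition _ := Measure_isSigmaFinite.Build _ _ _ lebesgue_step
  step_sigma_finite.
End step.

Fixpoint lebesgue_tuple n : {sigma_finite_measure set (n.-tuple RT) -> \bar R} :=
  if n is m.+1 then lebesgue_step (lebesgue_tuple m)
  else \d_([tuple] : 0.-tuple RT).

End lebesgue_tuple.

Definition borel (R : realType) n := g_sigma_algebraType (@open 'rV[R]_n).

Section lebesgue_row.
Context {R : realType}.
Local Notation RT := (measurableTypeR R).

Definition row_of_tuple n (t : n.-tuple RT) : borel R n := \row_i tnth t i.

Lemma measurable_row_of_tuple n :
  measurable_fun [set: n.-tuple RT] (@row_of_tuple n).
Proof.
apply: (@measurability _ _ _ _ setT (@row_of_tuple n) (@open 'rV[R]_n)) => // _ [U oU <-].
rewrite setTI.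
pose box (q : 'rV[rat]_n * nat) : set 'rV[R]_n :=
  ball (map_mx ratr q.1 : 'rV[R]_n) q.2.+1%:R^-1.
pose F q := if `[< box q `<=` U >] then box q else set0.
have -> : U = \bigcup_q F q.
  apply/seteqP; split => [x Ux|x [q _]]; last first.
    by rewrite /F; case: asboolP => // qU /qU.
  have /nbhs_ballP[e /= e0 xeU] : nbhs x U by exact: open_nbhs_nbhs.
  have [k] := ltr_add_invr (divr_gt0 e0 (ltr0n _ 2)); rewrite add0r => ke.
  have k0 : (0 : R) < k.+1%:R^-1 by rewrite invr_gt0.
  have /choice[g gx] (i : 'I_n) :
      exists q : rat, ratr q \in `]x ord0 i, x ord0 i + k.+1%:R^-1[.
    by apply: rat_in_itvoo; rewrite ltrDl.
  have bx : box (\row_i g i, k) x.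
    split => //= i j; rewrite (ord1 i) !mxE /ball/=.
    by have := gx j; rewrite in_itv/= => /andP[? ?]; rewrite gtr0_norm ?subr_gt0// ltrBlDl.
  exists (\row_i g i, k) => //; rewrite /F asboolT// => y.
  move=> bxy; apply: xeU; rewrite (splitr e).
  by apply: (@ball_triangle _ _ (map_mx ratr (\row_i g i) : 'rV[R]_n));
    [apply: ball_sym; apply: le_ball bx|apply: le_ball bxy]; exact: ltW.
rewrite preimage_bigcup; apply: countable_bigcupT_measurable => // -[q k].
rewrite /F; case: asboolP => _; last by rewrite preimage_set0.
rewrite (_ : _ @^-1` _ = \bigcap_(i : 'I_n)
    (@tnth n RT ^~ i @^-1` ball (ratr (q ord0 i) : R) k.+1%:R^-1)).
  apply: fin_bigcap_measurable => // i _; rewrite -[X in measurable X]setTI.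
  by apply: measurable_tnth => //; exact: measurable_ball.
apply/seteqP; split => t /=.
  by move=> [_ qt] i _; have := qt ord0 i; rewrite !mxE.
by move=> qt; split=> [|i j]; rewrite ?invr_gt0// (ord1 i) !mxE; exact: qt.
Qed.

(* The Lebesgue measure of R^n, characterised by lebesgue_row_box. *)
Definition lebesgue_row n : {measure set (borel R n) -> \bar R} :=
  measure_function_pushforward__canonical__measure_function_Measure
    (@lebesgue_tuple R n) (@measurable_row_of_tuple n).

Let lebesgue_tuple_box n (a b : 'I_n -> R) : (forall i, a i <= b i) ->
  measurable [set t : n.-tuple RT | forall i, a i <= tnth t i <= b i] /\
  lebesgue_tuple n [set t | forall i, a i <= tnth t i <= b i] =
  (\prod_(i < n) (b i - a i))%:E.
Proof.
elim: n a b => [|n IH] a b ab.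
  rewrite (_ : [set _ | _] = setT); last by apply/seteqP; split => // t _ [].
  by split => //; rewrite big_ord0 /= diracT.
have [mD DE] := IH (a \o lift ord0) (b \o lift ord0) (fun i => ab _).
split.
  rewrite (_ : [set _ | _] = \bigcap_(i : 'I_n.+1)
    (@tnth _ RT ^~ i @^-1` `[a i, b i])).
    apply: fin_bigcap_measurable => // i _; rewrite -[X in measurable X]setTI.
    exact: measurable_tnth.
  apply/seteqP; split => t /= tab i; first by move=> _; rewrite /= in_itv /=.
  by have := tab i Logic.I; rewrite /= in_itv.
rewrite /= /lebesgue_step /pushforward.
rewrite (_ : _ @^-1` _ = `[a ord0, b ord0] `*` [set t : n.-tuple RT |
    forall i, (a \o lift ord0) i <= tnth t i <= (b \o lift ord0) i]).
  rewrite product_measure1E// big_ord_recl EFinM DE; congr (_ * _)%E.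
  apply: etrans (lebesgue_measure_itv `[a ord0, b ord0]) _.
  rewrite /= lte_fin; have := ab ord0.
  by rewrite le_eqVlt => /predU1P[->|->//]; rewrite ltxx subrr.
apply/seteqP; split => -[x t] /=.
  move=> tab; split; first by have := tab ord0; rewrite in_itv.
  by move=> i; have := tab (lift ord0 i); rewrite tnthS.
rewrite in_itv/= => -[xab tab] i; case: (unliftP ord0 i) => [j ->|->//].
by rewrite tnthS.
Qed.

Lemma lebesgue_row_box n (a b : 'rV[R]_n) : (forall i, a 0 i <= b 0 i) ->
  lebesgue_row n [set x : 'rV[R]_n | forall i, a 0 i <= x 0 i <= b 0 i] =
  (\prod_(i < n) (b 0 i - a 0 i))%:E.
Proof.
move=> /lebesgue_tuple_box[_ <-]; congr (lebesgue_tuple n _).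
by apply/seteqP; split => t /= tab i; have := tab i; rewrite mxE.
Qed.
End lebesgue_row.

Section calculus.
Context {R : realType} {n : nat}.
Implicit Types (U : set 'rV[R]_n) (f : 'rV[R]_n -> R).

Definition dotv (x y : 'rV[R]_n) : R := (x *m y^T) 0 0.

Definition partial (i : 'I_n) f : 'rV[R]_n -> R :=
  fun x => 'D_(delta_mx 0 i) f x.

(* Meaningful for an open U, where continuity relative to U and continuity at
   the points of U agree. *)
Fixpoint Ck_on (k : nat) U f : Prop :=
  (forall x, U x -> {for x, continuous f}) /\
  (if k is k'.+1 then
     forall i, (forall x, U x -> derivable f x (delta_mx 0 i)) /\
               Ck_on k' U (partial i f)
   else True).

Definition smooth_on U f := forall k, Ck_on k U f.

Definition gradient f (x : 'rV[R]_n) : 'rV[R]_n := \row_i partial i f x.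

Definition hessian f (x : 'rV[R]_n) : 'M[R]_n :=
  \matrix_(i, j) partial i (partial j f) x.

Definition frontier (A : set 'rV[R]_n) := closure A `\` A°.

(* Radon measures on the open set U. A Borel measure on U is represented by a
   measure on the Borel sets of R^n of which only the values on the Borel
   subsets of U are relevant. *)
Definition radon_on U (mu : {measure set (borel R n) -> \bar R}) : Prop :=
  (forall A : set 'rV[R]_n, compact A -> A `<=` U -> (mu A < +oo)%E) /\
  (forall b : set (borel R n), measurable b -> b `<=` U ->
    mu b = ereal_sup [set mu A | A in
                        [set A : set 'rV[R]_n | compact A /\ A `<=` b]]).

End calculus.

(* Both V^(d+1) and A^(d+1) are R^(d+1) (row vectors, volume form det); the
   dual of V^(d+1) consists of the column vectors. *)
Section convex_domains.
Context {R : realType} {d : nat}.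
Local Notation V := 'rV[R]_(d + 1).
Local Notation V' := 'cV[R]_(d + 1).
Implicit Types (C K : set V) (phi : V').

Definition pairing phi (v : V) : R := (v *m phi) 0 0.

Definition proper_open_convex_cone C :=
  [/\ open C, convex_set C, (forall t v, 0 < t -> C v -> C (t *: v)), C !=set0 &
      ~ exists p v : V, v != 0 /\ forall t : R, closure C (p + t *: v)].

Definition dual_cone C : set V' :=
  [set phi | forall v, C v -> pairing phi v <= 0]°.

(* A set of points of the projective space of V' is represented by the set of
   the nonzero vectors spanning these lines. As the projection V' \ 0 -> P(V')
   is open, closures in P(V') correspond to closures in V' \ 0. *)
Definition P_dual C : set V' :=
  [set phi | phi != 0 /\ exists2 t : R, t != 0 & dual_cone C (t *: phi)].

(* The hyperplane [set P | pairing phi P = c] has direction [phi]. *)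
Definition supporting_hyperplane K phi (c : R) :=
  [/\ phi != 0, [set P | pairing phi P = c] `&` K = set0 &
      [set P | pairing phi P = c] `&` frontier K !=set0].

Definition supporting_at K phi (P : V) :=
  frontier K P /\ supporting_hyperplane K phi (pairing phi P).

Definition convex_domain K := [/\ K !=set0, open K & convex_set K].

Definition C_convex_domain C K :=
  [/\ convex_domain K, [set P + v | P in K & v in C] = K,
      (forall phi, P_dual C phi -> exists c, supporting_hyperplane K phi c) &
      (forall phi c, supporting_hyperplane K phi c -> closure (P_dual C) phi)].

Definition spacelike_boundary C K : set V :=
  [set P | exists2 phi, P_dual C phi & supporting_at K phi P].

(* The frontier is locally the graph, in suitable linear coordinates, of a C^2
   convex function with non-degenerate Hessian. *)
Definition C2plus K := forall P, frontier K P ->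
  exists (A : 'M[R]_(d + 1)) (W : set 'rV[R]_d) (f : 'rV[R]_d -> R) (U : set V),
    [/\ A \in unitmx, open_nbhs P U, open W /\ convex_set W,
        [/\ Ck_on 2 W f, convex_function W f &
            forall x, W x -> hessian f x \in unitmx] &
        frontier K `&` U = [set row_mx x (f x)%:M *m A | x in W] `&` U].

Definition tangent_vectors K (P : V) : set V :=
  [set v | exists g : R -> V,
    [/\ g 0 = P, is_derive (0 : R) (1 : R) g v &
        \forall t \near (0 : R), frontier K (g t)]].

(* gauss_map K P phi: the tangent hyperplane of K at P has direction [phi]. *)
Definition gauss_map C K (P : V) phi :=
  [/\ spacelike_boundary C K P, P_dual C phi &
      tangent_vectors K P = [set v | pairing phi v = 0]].

End convex_domains.

(* Coordinates given by a positively oriented basis of unit volume, the rows of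
   B. No notion below depends on the choice of the origin. *)
Section coordinates.
Context {R : realType} {d : nat}.
Local Notation V := 'rV[R]_(d + 1).
Implicit Types (C K : set V) (B : 'M[R]_(d + 1)) (Omega : set 'rV[R]_d)
  (omega : 'rV[R]_d -> R).

Definition adapted_basis C B Omega :=
  [/\ \det B = 1,
      [/\ bounded_set Omega, open Omega, convex_set Omega & Omega 0] &
      C = [set v | exists t x, [/\ 0 < t, Omega x &
                                   v = t *: (row_mx x 1%:M *m B)]]].

Definition dual_domain Omega : set 'rV[R]_d :=
  [set y | forall x, closure Omega x -> dotv x y < 1].

(* The linear form with coordinates (y, -1) in the basis dual to B. Through
   y |-> [covector B y], dual_domain Omega is identified with P(C* ). *)
Definition covector B (y : 'rV[R]_d) : 'cV[R]_(d + 1) :=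
  invmx B *m (row_mx y (-1)%:M)^T.

Definition cheng_yau Omega omega :=
  let O' := dual_domain Omega in
  [/\ smooth_on O' omega, convex_function O' omega,
      (forall y, O' y -> omega y < 0),
      (forall y, O' y -> \det (hessian omega y) = (- omega y) ^- d.+2) &
      (forall p, frontier O' p -> omega y @[y --> within O' (nbhs p)] --> 0)].

Definition affine_sphere B omega (y : 'rV[R]_d) : V :=
  row_mx (gradient omega y) (dotv (gradient omega y) y - omega y)%:M *m B.

Definition one_sided_nbhd K B omega (eps : R) (b : set 'rV[R]_d) : set V :=
  [set X | exists y P t, [/\ b y, supporting_at K (covector B y) P,
                             0 < t < eps & X = P + t *: affine_sphere B omega y]].

Definition inverse_gauss_map C K B (y : 'rV[R]_d) : V :=
  xget 0 [set P | gauss_map C K P (covector B y)].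

(* Endomorphisms of R^d act on row vectors by right multiplication. *)
Definition shape_operator C K B omega (y : 'rV[R]_d) : 'M[R]_d :=
  xget 0 [set S : 'M[R]_d | forall X : 'rV[R]_d,
    'd (affine_sphere B omega) y X =
    'd (inverse_gauss_map C K B) y (X *m S)].

(* The eigenvalues with multiplicity, in some order. *)
Definition principal_curvatures C K B omega (y : 'rV[R]_d) : {ffun 'I_d -> R} :=
  xget 0 [set k : {ffun 'I_d -> R} |
    char_poly (shape_operator C K B omega y) =
    \prod_(j < d) ('X - (k j)%:P)].

Definition principal_radius C K B omega y (j : 'I_d) : R :=
  (principal_curvatures C K B omega y j)^-1.

Definition sigma C K B omega (i : nat) (y : 'rV[R]_d) : R :=
  'C(d, i)%:R^-1 *
  \sum_(J : {set 'I_d} | #|J| == i)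
    \prod_(j in J) principal_radius C K B omega y j.

Definition steiner_measures Omega K B omega
    (S : 'I_d.+1 -> {measure set (borel R d) -> \bar R}) :=
  (forall i, radon_on (dual_domain Omega) (S i)) /\
  forall (eps : R) (b : set (borel R d)),
    0 < eps -> measurable b -> b `<=` dual_domain Omega ->
    (lebesgue_row (d + 1) (one_sided_nbhd K B omega eps b) =
     (d.+1%:R^-1)%:E *
     \sum_(i < d.+1) (eps ^+ (d.+1 - i) * 'C(d.+1, i)%:R)%:E * S i b)%E.

(* The density, on dual_domain Omega, with respect to the Lebesgue measure of the canonical volume of
   the affine sphere. *)
Definition affine_sphere_density omega (y : 'rV[R]_d) : R :=
  (- omega y) ^- d.+1.

End coordinates.

(* Main.v *)
(** For y in the dual domain, let P(y) be the support point of K in the direction y,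
    i.e. the inverse Gauss map, and N(y) the point of the affine sphere. The one-sided
    neighbourhoods are images of b x (0, eps) under Phi(y, t) = P(y) + t N(y). By
    convexity P is well defined and continuous; in a chart of the boundary it is
    obtained by inverting the gradient of a function with definite hessian, so it is
    differentiable. In the basis B its derivative is X |-> (X J, (X J).y) with J the
    hessian of the support function, and that of N is X |-> (X H, (X H).y) with H the
    hessian of omega. Hence the jacobian of Phi is
      det(J + t H) (- omega) = (- omega)^(-d-1) prod_j (r_j + t),
    as det H = (- omega)^(-d-2) and the r_j are the eigenvalues of J H^-1.
    Phi is injective because the form y takes the value s(y) + t omega(y) at Phi(y, t),
    and at most s(y) + t omega(y) at Phi(z, t). The change of variables formula and
    Fubini give the Steiner polynomial, the coefficients of which are determined by
    its values at eps = 1, ..., d + 1 as long as they are finite, which suffices by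
    exhausting the dual domain by compact sets. *)
From HB Require Import structures.
Require Import Defs.
From mathcomp Require Import all_boot all_order all_fingroup all_algebra.
From mathcomp Require Import all_classical all_reals all_analysis.
From mathcomp Require Import measurable_realfun.
From mathcomp Require Import ring lra zify.
From mathcomp Require complex.
Set Implicit Arguments.
Unset Strict Implicit.
Unset Printing Implicit Defensive.
Import Order.TTheory GRing.Theory Num.Theory.
Import numFieldTopology.Exports numFieldNormedType.Exports.
Local Open Scope classical_set_scope.
Local Open Scope ring_scope.

(** * Borel measures on R^n *)

(** The regularity at hand shapes the proof. The inverse Gauss map is defined by choice and its
    derivative is found one point at a time, so everything rests on strict differentiability at
    single points: it is stable under composition and implicit inversion, it makes the derivative
    continuous on an open set where it holds, and it keeps a map close enough to its derivative to
    bound volumes from both sides. J is obtained as the derivative of P; it is symmetric and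
    positive because the first d coordinates of P are subgradients of the support function. The
    principal radii are roots listed in an arbitrary order at each y, so nothing is claimed about
    their own regularity: the densities get measurability and local bounds from the continuous
    jacobian, by its values at t = 1, ..., d + 1. The change of variables formula compares measures
    on dyadic cubes. Norms are sup norms, so that an expansion constant c bounds volumes by exactly
    c^n, and the errors vanish as c tends to 1. *)

Lemma ler_entry_norm (R : realType) m n (A : 'M[R]_(m, n)) i j : `|A i j| <= `|A|.
Proof.
rewrite [leRHS]/Num.norm /= mx_normrE.
by apply: (le_bigmax_cond _ (j := (i, j)) (fun ij : 'I_m * 'I_n => `|A ij.1 ij.2|)).
Qed.

Section row_norm.
Context {R : realType} {n : nat}.
Implicit Types x y : 'rV[R]_n.

Lemma ler_coord_norm x i : `|x 0 i| <= `|x|.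
Proof. exact: ler_entry_norm. Qed.

Lemma row_norm_le x (c : R) : 0 <= c -> (forall i, `|x 0 i| <= c) -> `|x| <= c.
Proof.
move=> c0 xc; rewrite [leLHS]/Num.norm /= mx_normrE.
by apply/bigmax_leP; split => // -[i j] _ /=; rewrite ord1.
Qed.

Lemma row_norm_lt x (c : R) : 0 < c -> (forall i, `|x 0 i| < c) -> `|x| < c.
Proof.
move=> c0 xc; rewrite [ltLHS]/Num.norm /= mx_normrE.
by apply/bigmax_ltP; split => // -[i j] _ /=; rewrite ord1.
Qed.

Lemma row_nbhsP x (U : set 'rV[R]_n) : nbhs x U <->
  exists2 e : R, 0 < e & forall u, `|u - x| < e -> U u.
Proof.
rewrite -nbhs_ballE; split=> [[e /= e0 eU]|[e e0 eU]]; exists e => //.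
  by move=> u ux; apply: eU; rewrite -ball_normE /ball_ /= distrC.
by move=> u; rewrite -ball_normE /ball_ /= distrC; exact: eU.
Qed.

Lemma row_continuousP (W : normedModType R) (f : 'rV[R]_n -> W) x :
  {for x, continuous f} <-> forall e : R, 0 < e -> exists2 d : R, 0 < d &
    forall u, `|u - x| < d -> `|f u - f x| < e.
Proof.
split=> [cf e e0|h].
  have /row_nbhsP[d d0 hd] : nbhs x (f @^-1` ball (f x) e).
    by apply: cf; exact: nbhsx_ballx.
  exists d => // u /hd; rewrite -ball_normE /ball_ /= distrC.
  by [].
move=> A /nbhs_ballP[e /= e0 eA]; have [d d0 hd] := h _ e0.
apply/row_nbhsP; exists d => // u /hd ue; apply: eA.
by rewrite -ball_normE /ball_ /= distrC.
Qed.

End row_norm.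

Section borel_sets.
Context {R : realType}.

Lemma borel_open n (U : set 'rV[R]_n) : open U -> measurable (U : set (borel R n)).
Proof. by move=> oU; exact: sub_sigma_algebra. Qed.

Lemma borel_closed n (F : set 'rV[R]_n) : closed F -> measurable (F : set (borel R n)).
Proof.
move=> cF; rewrite -[F]setCK; apply: (@measurableC _ (borel R n)).
by apply: borel_open; exact: closed_openC.
Qed.

Lemma borel_compact n (F : set 'rV[R]_n) : compact F -> measurable (F : set (borel R n)).
Proof. by move=> /compact_closed cF; apply: borel_closed; exact/cF/norm_hausdorff. Qed.

Lemma borel_measurable_fun d (T : measurableType d) n (f : T -> borel R n) D :
  measurable D -> (forall U : set 'rV[R]_n, open U -> measurable (D `&` f @^-1` U)) ->
  measurable_fun D f.
Proof.
move=> mD h; apply: (@measurability _ _ _ _ D f (@open 'rV[R]_n)) => //.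
by move=> _ [U oU <-]; exact: h.
Qed.

Lemma continuous_borel n m (f : 'rV[R]_n -> 'rV[R]_m) :
  continuous f -> measurable_fun [set: borel R n] (f : borel R n -> borel R m).
Proof.
move=> cf; apply: borel_measurable_fun => // U oU; rewrite setTI.
by apply: borel_open; exact: open_comp.
Qed.

Lemma borel_smallest n (G : set (set 'rV[R]_n)) :
  sigma_algebra setT G -> (forall U : set 'rV[R]_n, open U -> G U) ->
  forall A : set (borel R n), measurable A -> G A.
Proof. by move=> sG oG A mA; apply: (smallest_sub _ oG) mA. Qed.

(** Inner and outer approximation are bundled into one gap between [F] and [G]: passing to
    complements only exchanges the two sets, so regular sets are closed under complement. *)
Definition regular_set n (mu : set (borel R n) -> \bar R) (A : set 'rV[R]_n) :=
  forall e : R, 0 < e -> exists F G : set 'rV[R]_n,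
    [/\ closed F, open G, F `<=` A, A `<=` G & (mu (G `\` F) < e%:E)%E].

Lemma bigcap_closedC_nbhs n (U : set 'rV[R]_n) (r : R) :
  closed [set x | forall y, ~ U y -> r <= `|x - y|].
Proof.
rewrite (_ : [set _ | _] = \bigcap_(y in ~` U) [set x | r <= `|x - y|]); last first.
  by apply/seteqP; split => x /= h y; exact: h.
apply: closed_bigI => y _.
apply: (@preimage_closed _ _ (fun x : 'rV[R]_n => `|x - y|) [set z | r <= z]).
  move=> x _; apply/row_continuousP => e e0; exists e => // u ux.
  by apply: le_lt_trans (ler_dist_dist _ _) _; rewrite opprB addrA subrK.
exact: closed_ge.
Qed.

Lemma open_bigcup_closed n (U : set 'rV[R]_n) : open U ->
  exists F : (set 'rV[R]_n)^nat, [/\ forall k, closed (F k),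
    nondecreasing_seq F & \bigcup_k F k = U].
Proof.
move=> oU; exists (fun k => [set x | forall y, ~ U y -> k.+1%:R^-1 <= `|x - y|]).
split=> [k|k l kl|]; first exact: bigcap_closedC_nbhs.
  apply/subsetPset => x /= xk y /xk; apply: le_trans.
  by rewrite lef_pV2 ?posrE// ler_nat.
apply/seteqP; split => [x [k _ /= xk]|x Ux].
  apply: contrapT => nUx; have := xk _ nUx; rewrite subrr normr0.
  by rewrite leNgt invr_gt0 ltr0n.
have /row_nbhsP[e e0 eU] : nbhs x U by exact: open_nbhs_nbhs.
have [k] := ltr_add_invr e0; rewrite add0r => ke.
exists k => //= y nUy; apply: contrapT => /negP; rewrite -ltNge => xy.
by apply/nUy/eU; rewrite distrC; exact: lt_trans ke.
Qed.

(** Regular sets form a sigma-algebra containing the open sets. An open set is an increasing union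
    of closed sets, and finiteness of [mu] makes the measure of the gaps tend to 0. *)
Lemma finite_measure_regular n (mu : {measure set (borel R n) -> \bar R}) :
  (mu setT < +oo)%E -> forall A : set (borel R n), measurable A -> regular_set mu A.
Proof.
move=> muoo.
have mufin A : measurable A -> (mu A < +oo)%E.
  by move=> mA; apply: le_lt_trans muoo; apply: le_measure; rewrite ?inE.
have mD (F G : set 'rV[R]_n) : closed F -> open G -> measurable (G `\` F : set (borel R n)).
  by move=> cF oG; apply: measurableD; [exact: borel_open|exact: borel_closed].
apply: borel_smallest => [|U oU]; last first.
  move=> e e0; have [F [cF ndF FU]] := open_bigcup_closed oU.
  have mF k : measurable (F k : set (borel R n)) by exact: borel_closed.
  have mU : measurable (U : set (borel R n)) by exact: borel_open.
  have : mu (U `\` F k) @[k --> \oo] --> mu (\bigcap_k (U `\` F k)).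
    apply: nonincreasing_cvg_mu => //.
    - exact/mufin/measurableD.
    - by move=> k; exact: measurableD.
    - by apply: bigcap_measurable => // k _; exact: measurableD.
    - by move=> k l kl; apply/subsetPset; apply: setDS; apply/subsetPset/ndF.
  rewrite (_ : \bigcap_k _ = set0) ?measure0; last first.
    apply/seteqP; split => // x h; have [Ux _] := h 0%N Logic.I.
    by move: Ux; rewrite -FU => -[k _ Fx]; have [_ /(_ Fx)] := h k Logic.I.
  move/fine_cvgP => [fin /cvgrPdist_lt/(_ _ e0) lt].
  case: (filterI fin lt) => k _ /(_ k (leqnn k))[fink].
  rewrite sub0r normrN /= ger0_norm ?fine_ge0// => ltk.
  exists (F k), U; split => //; first by rewrite -FU; exact: bigcup_sup.
  by rewrite -(fineK fink) lte_fin.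
split.
- move=> e e0; exists set0, set0; split => //; [exact: closed0|].
  by rewrite setD0 measure0 lte_fin.
- move=> A hA e e0; have [F [G [cF oG FA AG h]]] := hA _ e0.
  exists (~` G), (~` F); split.
  + exact: open_closedC.
  + exact: closed_openC.
  + by rewrite setTD; exact: subsetC.
  + by rewrite setTD; exact: subsetC.
  + by rewrite setDE setCK setIC -setDE.
- move=> A hA e e0.
  (* The gaps of the [A k] sum to at most e / 2; the other half is kept for the truncation of the
     union of the [F k]. *)
  have e2 k : 0 < e / 2 / (2 ^ k.+1)%:R by rewrite !divr_gt0// ltr0n expn_gt0.
  have /choice[F] : forall k, exists F, exists G : set 'rV[R]_n,
    [/\ closed F, open G, F `<=` A k, A k `<=` G & (mu (G `\` F) < (e / 2 / (2 ^ k.+1)%:R)%:E)%E].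
    by move=> k; exact: hA k _ (e2 k).
  move=> /choice[G FG].
  have cF k : closed (F k) by have [] := FG k.
  have oG k : open (G k) by have [] := FG k.
  have mF k : measurable (F k : set (borel R n)) by exact: borel_closed.
  have mG k : measurable (G k : set (borel R n)) by exact: borel_open.
  have mUF : measurable (\bigcup_k F k : set (borel R n)) by exact: bigcupT_measurable.
  have mUG : measurable (\bigcup_k G k : set (borel R n)) by exact: bigcupT_measurable.
  (* The union of all [F k] need not be closed, so a finite part of it serves as the inner set. *)
  pose H N := \bigcup_(k < N) F k.
  have cH N : closed (H N).
    by apply: closed_bigcup => [|k _]; [exact: finite_II|exact: cF].
  have : mu (\bigcup_k F k `\` H N) @[N --> \oo] -->
      mu (\bigcap_N (\bigcup_k F k `\` H N)).
    apply: nonincreasing_cvg_mu => //.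
    - by apply/mufin/measurableD => //; exact: borel_closed.
    - by move=> N; apply: measurableD => //; exact: borel_closed.
    - apply: bigcap_measurable => // N _.
      by apply: measurableD => //; exact: borel_closed.
    - move=> k l kl; apply/subsetPset; apply: setDS => x [j /= jk Fx].
      by exists j => //=; exact: leq_trans kl.
  rewrite (_ : \bigcap_N _ = set0) ?measure0; last first.
    apply/seteqP; split => // x h; have [[k _ Fx] _] := h 0%N Logic.I.
    by have [_] := h k.+1 Logic.I; apply; exists k => /=.
  have e20 : 0 < e / 2 by rewrite divr_gt0.
  move/fine_cvgP => [fin /cvgrPdist_lt/(_ _ e20) lt].
  case: (filterI fin lt) => N _ /(_ N (leqnn N))[finN].
  rewrite sub0r normrN /= ger0_norm ?fine_ge0// => ltN.
  exists (H N), (\bigcup_k G k); split => //.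
  - by apply: bigcup_open => k _; exact: oG.
  - by move=> x [k _ Fx]; exists k => //; have [_ _ h _ _] := FG k; exact: h.
  - by move=> x [k _ Ax]; exists k => //; have [_ _ _ h _] := FG k; exact: h.
  have mHN : measurable (H N : set (borel R n)) by exact: borel_closed.
  have sub : \bigcup_k G k `\` H N `<=`
      (\bigcup_k (G k `\` F k)) `|` (\bigcup_k F k `\` H N).
    move=> x [[k _ Gx] nH]; have [Fx|nFx] := pselect ((\bigcup_k F k) x).
      by right.
    by left; exists k => //; split => // Fx; apply: nFx; exists k.
  have mUD : measurable (\bigcup_k (G k `\` F k) : set (borel R n)).
    by apply: bigcupT_measurable => k; exact: measurableD.
  apply: (@le_lt_trans _ _ (mu ((\bigcup_k (G k `\` F k)) `|` (\bigcup_k F k `\` H N)))).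
    apply: le_measure; rewrite ?inE//; first exact: measurableD.
    by apply: measurableU => //; exact: measurableD.
  apply: (@le_lt_trans _ _ (mu (\bigcup_k (G k `\` F k)) + mu (\bigcup_k F k `\` H N))%E).
    by apply: measureU2 => //; exact: measurableD.
  rewrite [e]splitr EFinD; apply: lee_ltD.
  - by rewrite ge0_fin_numE//; apply: mufin.
  - have mGF k : measurable (G k `\` F k : set (borel R n)) by exact: measurableD.
    apply: (le_trans (measure_sigma_subadditive _ mGF mUD (fun x h => h))).
    apply: le_trans (epsilon_trick0 xpredT (ltW e20)).
    by apply: lee_nneseries => // k _; have [_ _ _ _ /ltW] := FG k.
  - by rewrite -(fineK finN) lte_fin.
Qed.

End borel_sets.

(** * Dyadic cubes and the comparison of Borel measures *)

Section dyadic_cubes.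
Context {R : realType} {n : nat}.
Local Notation V := 'rV[R]_n.
Local Notation bV := (borel R n).

Lemma measurable_coord (i : 'I_n) :
  measurable_fun [set: bV] ((fun x : V => x 0 i) : bV -> measurableTypeR R).
Proof.
apply: (@measurability _ _ _ _ setT _ (@RGenOpens.G R)).
  exact: RGenOpens.measurableE.
move=> _ [_ [a [b ->] <-]]; rewrite setTI; apply: borel_open.
by apply: open_comp => // x _; exact: coord_continuous.
Qed.

(** Half-open, so that the cubes of one level partition the space, the index of the cube of a point
    being given by floors. *)
Definition cube (k : nat) (z : 'rV[int]_n) : set V :=
  [set x | forall i, (z 0 i)%:~R <= x 0 i * 2 ^+ k < (z 0 i + 1)%:~R].

Lemma measurable_cube k z : measurable (cube k z : set bV).
Proof.
rewrite (_ : cube k z = \bigcap_(i in [set: 'I_n]) ((fun x : V => x 0 i) @^-1`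
    ((fun t : R => t * 2 ^+ k) @^-1` `[(z 0 i)%:~R, (z 0 i + 1)%:~R[))).
  apply: fin_bigcap_measurable => // i _.
  rewrite -[X in measurable X]setTI; apply: measurable_coord => //.
  rewrite -[X in measurable X]setTI; apply: (measurable_funM) => //.
by apply/seteqP; split => x /= h i; [move=> _|]; have := h i; rewrite /= in_itv; [|exact].
Qed.

Definition cube_index (k : nat) (x : V) : 'rV[int]_n :=
  \row_i Num.floor (x 0 i * 2 ^+ k).

Lemma in_cube_index k x : cube k (cube_index k x) x.
Proof. by move=> i; rewrite mxE; exact: floor_itv. Qed.

Lemma cube_index_eq k z x : cube k z x -> cube_index k x = z.
Proof. by move=> h; apply/rowP => i; rewrite mxE; apply: floor_def; exact: h. Qed.

Lemma cube_nested k x : cube k.+1 (cube_index k.+1 x) `<=` cube k (cube_index k x).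
Proof.
move=> y yx i; move: (yx i) (in_cube_index k x i) (in_cube_index k.+1 x i).
set z := cube_index _ _ _ _; set w := cube_index _ _ _ _.
rewrite exprS; set p := 2 ^+ k.
move=> /andP[h1 h2] /andP[h3 h4] /andP[h5 h6].
have w2 : (2 * w)%:~R = 2 * w%:~R :> R by rewrite intrM.
have w22 : (2 * w + 2)%:~R = 2 * w%:~R + 2 :> R by rewrite intrD w2.
move: h2 h4 h6; rewrite !intrD => h2 h4 h6.
(* Here [z] is the index at level k + 1 and [w] that at level k. Both are integers, so the strict
   inequalities improve to 2 w <= z and z + 1 <= 2 w + 2. *)
have h7 : (2 * w < z + 1)%R by rewrite -(ltr_int R) w2 intrD; lra.
have h8 : (z < 2 * w + 2)%R by rewrite -(ltr_int R) w22; lra.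
have h9 : 2 * w <= z by rewrite -ltzD1.
have h10 : z + 1 <= 2 * w + 2 by rewrite -ltzD1 ltrD2r.
move: h9 h10; rewrite -(ler_int R) -(ler_int R (z + 1)) w2 w22 !intrD => h9 h10.
by apply/andP; split; lra.
Qed.

Lemma cube_diam k z x y i : cube k z x -> cube k z y ->
  `|x 0 i - y 0 i| <= 2 ^- k.
Proof.
move=> /(_ i)/andP[a b] /(_ i)/andP[c e]; move: b e; rewrite !intrD => b e.
have k0 : (0 : R) < 2 ^+ k by rewrite exprn_gt0.
rewrite -(ler_pM2r k0) mulVf ?gt_eqF// -[X in _ * X]gtr0_norm// -normrM mulrBl.
by rewrite ler_norml; apply/andP; split; lra.
Qed.

Section dyadic_part.
Variable U : set V.

Definition dyadic_part k : set V :=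
  [set x | cube k (cube_index k x) `<=` U].

Lemma dyadic_part_nondecreasing : nondecreasing_seq dyadic_part.
Proof.
apply/nondecreasing_seqP => k; apply/subsetPset => x /= h.
exact: subset_trans (@cube_nested k x) h.
Qed.

Lemma bigcup_dyadic_part : open U -> \bigcup_k dyadic_part k = U.
Proof.
move=> oU; apply/seteqP; split => [x [k _]|x Ux].
  by apply; exact: in_cube_index.
have /row_nbhsP[e e0 eU] : nbhs x U by exact: open_nbhs_nbhs.
have [k ke] : exists k, 2 ^- k < e.
  have [k] := ltr_add_invr e0; rewrite add0r => ke.
  exists k; apply: le_lt_trans ke; rewrite lef_pV2 ?posrE ?exprn_gt0//.
  by rewrite -natrX ler_nat ltn_expl.
exists k => // y yx; apply: eU; apply: le_lt_trans ke.
apply: row_norm_le => [|i]; first by rewrite invr_ge0 exprn_ge0.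
by rewrite !mxE; apply: cube_diam yx _; exact: in_cube_index.
Qed.

(** The cubes are listed by their codes to form a sequence for countable additivity; the remaining
    codes give the empty set, which keeps the sequence disjoint. *)
Definition dyadic_piece k (j : nat) : set V :=
  if pickle_inv j is Some z then
    if `[< cube k z `<=` U >] then cube k z else set0
  else set0.

Lemma dyadic_partE k : dyadic_part k = \bigcup_j dyadic_piece k j.
Proof.
apply/seteqP; split => [x xU|x [j _]].
  exists (pickle (cube_index k x)) => //.
  by rewrite /dyadic_piece pickleK_inv asboolT//; exact: in_cube_index.
rewrite /dyadic_piece; case: pickle_inv => // z; case: asboolP => // zU xz.
by rewrite /dyadic_part /= (cube_index_eq xz).
Qed.

Lemma measurable_dyadic_piece k j : measurable (dyadic_piece k j : set bV).
Proof.
rewrite /dyadic_piece; case: pickle_inv => // z; case: asboolP => // _.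
exact: measurable_cube.
Qed.

Lemma trivIset_dyadic_piece k : trivIset setT (dyadic_piece k).
Proof.
apply/trivIsetP => i j _ _ ij; apply/seteqP; split => // x [].
rewrite /dyadic_piece; case Ei : (pickle_inv i) => [z|//].
case Ej : (pickle_inv j) => [w|]; last by [].
case: asboolP => // _ xz; case: asboolP => // _ xw.
have := @pickle_invK 'rV[int]_n i; have := @pickle_invK 'rV[int]_n j.
rewrite Ei Ej /= => ej ei; move: ij.
by rewrite -ei -ej -(cube_index_eq xz) -(cube_index_eq xw) eqxx.
Qed.

End dyadic_part.

(** At each level, the cubes contained in [U] are countably many and disjoint, and their unions
    increase to [U] with the level. *)
Lemma le_measure_open (nu mu : {measure set bV -> \bar R}) :
  (forall k z, (nu (cube k z) <= mu (cube k z))%E) ->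
  forall U : set V, open U -> (nu U <= mu U)%E.
Proof.
move=> numu U oU.
have mP k : measurable (dyadic_part U k : set bV).
  rewrite dyadic_partE; apply: bigcupT_measurable => j.
  exact: measurable_dyadic_piece.
have lim (m : {measure set bV -> \bar R}) : m (dyadic_part U k) @[k --> \oo] --> m U.
  rewrite -[in X in _ --> X](bigcup_dyadic_part oU).
  apply: nondecreasing_cvg_mu => //; first exact: bigcupT_measurable.
  exact: dyadic_part_nondecreasing.
apply: (lee_cvg_to (lim nu) (lim mu)); apply: nearW => k.
rewrite dyadic_partE !measure_bigcup//.
- apply: lee_nneseries => // j _; rewrite /dyadic_piece.
  case: pickle_inv => [z|]; last by rewrite !measure0.
  by case: asboolP => // _; rewrite !measure0.
- by move=> j _; exact: measurable_dyadic_piece.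
- exact: trivIset_dyadic_piece.
- by move=> j _; exact: measurable_dyadic_piece.
- exact: trivIset_dyadic_piece.
Qed.

Lemma open_norm_ball (r : R) : open [set x : V | `|x| < r].
Proof.
apply: (@open_comp _ _ (Num.norm : V -> R) [set z | z < r]) => [x _|].
  exact: norm_continuous.
exact: open_lt.
Qed.

Lemma le_measure_borel (nu mu : {measure set bV -> \bar R}) :
  (forall r : R, (mu [set x : V | (`|x| < r)%R] < +oo)%E) ->
  (forall k z, (nu (cube k z) <= mu (cube k z))%E) ->
  forall A : set bV, measurable A -> (nu A <= mu A)%E.
Proof.
move=> mufin numu A mA.
pose D (j : nat) : set V := [set x | `|x| < j%:R].
have oD j : open (D j) by exact: open_norm_ball.
have mD j : measurable (D j : set bV) by exact: borel_open.
have mAD j : measurable (A `&` D j : set bV) by exact: measurableI.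
have AD : \bigcup_j (A `&` D j) = A.
  rewrite -setI_bigcupr; apply/setIidl => x _.
  have [j xj] : exists j, `|x : V| < j%:R.
    by exists (Num.bound `|x : V|); rewrite archi_boundP.
  by exists j.
have lim (m : {measure set bV -> \bar R}) : m (A `&` D k) @[k --> \oo] --> m A.
  rewrite -[in X in _ --> X]AD.
  apply: nondecreasing_cvg_mu => //; first exact: bigcupT_measurable.
  move=> i j ij; apply/subsetPset; apply: setIS => x /= xi.
  by apply: (lt_le_trans xi); rewrite ler_nat.
apply: (lee_cvg_to (lim nu) (lim mu)); apply: nearW => j.
apply/lee_addgt0Pr => e e0.
(* Regularity is applied to the restriction of [mu] to a ball, a finite measure. *)
have fin : (mrestr mu (mD j) setT < +oo)%E by rewrite /mrestr setTI; exact: mufin.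
have [F [G [cF oG FA AG lt]]] := finite_measure_regular fin (mAD j) e0.
have mGD : measurable (G `&` D j : set bV) by apply: borel_open; exact: openI.
apply: (@le_trans _ _ (nu (G `&` D j))).
  by apply: le_measure; rewrite ?inE// => x [Ax Dx]; split => //; exact: AG.
apply: (@le_trans _ _ (mu (G `&` D j))).
  by apply: le_measure_open => //; exact: openI.
have mGF : measurable ((G `\` F) `&` D j : set bV).
  apply: measurableI => //; apply: measurableD; first exact: borel_open.
  exact: borel_closed.
apply: (@le_trans _ _ (mu ((A `&` D j) `|` ((G `\` F) `&` D j)))).
  apply: le_measure; rewrite ?inE//; first exact: measurableU.
  move=> x [Gx Dx]; have [/FA|nF] := pselect (F x); first by left.
  by right.
apply: (le_trans (measureU2 _ _ _)) => //.
by apply: leeD => //; apply: ltW lt.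
Qed.

End dyadic_cubes.

(** Restriction and image in one, for a map that is measurable on [D] only: it serves for an inverse
    map, known on an image, and with the identity for plain restrictions. *)
Lemma image_measure d1 d2 (T1 : measurableType d1) (T2 : measurableType d2)
    (R : realType) (mu : {measure set T1 -> \bar R}) (D : set T1) (f : T1 -> T2) :
  measurable D -> measurable_fun D f ->
  exists nu : {measure set T2 -> \bar R}, forall B, nu B = mu (D `&` f @^-1` B).
Proof.
move=> mD mf; pose nu (B : set T2) := mu (D `&` f @^-1` B).
have nu0 : nu set0 = 0%E by rewrite /nu preimage_set0 setI0 measure0.
have nu_ge0 B : (0 <= nu B)%E by exact: measure_ge0.
have nuS : semi_sigma_additive nu.
  move=> F mF tF mUF; rewrite /nu preimage_bigcup setI_bigcupr.
  apply: measure_semi_sigma_additive => [i||].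
  - exact: mf.
  - apply/trivIsetP => i j _ _ ij; rewrite setIACA setIid -preimage_setI.
    by move/trivIsetP : tF => /(_ i j Logic.I Logic.I ij) ->; rewrite preimage_set0 setI0.
  - by rewrite -setI_bigcupr -preimage_bigcup; exact: mf.
pose m : {measure set T2 -> \bar R} :=
  HB.pack nu (isMeasure.Build _ _ _ nu nu0 nu_ge0 nuS).
by exists m.
Qed.

Lemma density_measure d (T : measurableType d) (R : realType)
    (mu : {measure set T -> \bar R}) (D : set T) (f : T -> \bar R) :
  measurable D -> measurable_fun D f -> (forall x, D x -> (0 <= f x)%E) ->
  exists nu : {measure set T -> \bar R}, forall A, measurable A ->
    nu A = (\int[mu]_(x in A `&` D) f x)%E.
Proof.
move=> mD mf f0; pose nu (A : set T) := (\int[mu]_(x in A `&` D) f x)%E.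
have nu0 : nu set0 = 0%E by rewrite /nu set0I integral_set0.
have nu_ge0 B : (0 <= nu B)%E by apply: integral_ge0 => x [_ /f0].
have nuS : semi_sigma_additive nu.
  move=> F mF tF mUF; rewrite /nu setI_bigcupl ge0_integral_bigcup.
  - apply: is_cvg_nneseries => n _ _.
    by apply: integral_ge0 => x [_ /f0].
  - by move=> i; exact: measurableI.
  - by apply: measurable_funS mf => // x [i _ []].
  - by move=> x [i _ [_ /f0]].
  - apply/trivIsetP => i j _ _ ij; rewrite setIACA setIid.
    by move/trivIsetP : tF => /(_ i j Logic.I Logic.I ij) ->; rewrite set0I.
pose m : {measure set T -> \bar R} :=
  HB.pack nu (isMeasure.Build _ _ _ nu nu0 nu_ge0 nuS).
by exists m.
Qed.

(** * Upper bounds for Lebesgue measure *)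

Section lebesgue_row_estimates.
Context {R : realType} {n : nat}.
Local Notation V := 'rV[R]_n.
Local Notation bV := (borel R n).
Local Notation lam := (lebesgue_row n : {measure set bV -> \bar R}).

Lemma measurable_box (a b : V) :
  measurable ([set x : V | forall i, a 0 i <= x 0 i <= b 0 i] : set bV).
Proof.
rewrite (_ : [set _ | _] = \bigcap_(i in [set: 'I_n]) ((fun x : V => x 0 i) @^-1`
    `[a 0 i, b 0 i])).
  apply: fin_bigcap_measurable => // i _.
  by rewrite -[X in measurable X]setTI; apply: measurable_coord.
by apply/seteqP; split => x /= h i; [move=> _|]; have := h i; rewrite /= in_itv; [|exact].
Qed.

(** [S] lies in the closed box whose lower corner collects the infima of its coordinates. *)
Lemma lebesgue_row_diam (S : set V) (delta : 'I_n -> R) :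
  measurable (S : set bV) -> (forall i, 0 <= delta i) ->
  (forall x y i, S x -> S y -> x 0 i - y 0 i <= delta i) ->
  (lam S <= (\prod_(i < n) delta i)%:E)%E.
Proof.
move=> mS d0 Sd; have [->|/set0P[x0 Sx0]] := eqVneq S set0.
  by rewrite measure0 lee_fin; apply: prodr_ge0.
pose a : V := \row_i inf [set x 0 i | x in S].
pose b : V := \row_i (a 0 i + delta i).
have lbS i : has_lbound [set x 0 i | x in S].
  exists (x0 0 i - delta i) => _ [x Sx <-].
  by have := Sd x0 x i Sx0 Sx; lra.
have Sab : S `<=` [set x : V | forall i, a 0 i <= x 0 i <= b 0 i].
  move=> x Sx i; rewrite !mxE; apply/andP; split.
    by apply: ge_inf => //; exists x.
  rewrite -lerBlDr; apply: lb_le_inf; first by exists (x0 0 i), x0.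
  by move=> _ [y Sy <-]; have := Sd x y i Sx Sy; lra.
apply: (@le_trans _ _ (lam [set x : V | forall i, a 0 i <= x 0 i <= b 0 i])).
  by apply: le_measure; rewrite ?inE//; exact: measurable_box.
rewrite lebesgue_row_box => [|i]; last by rewrite !mxE lerDl.
by rewrite lee_fin; apply: ler_prod => i _; rewrite !mxE addrAC subrr add0r d0 /=.
Qed.

(** The measure is known on closed boxes. A half-open cube contains closed boxes of side 2^-k - eta
    for every small eta, and the extents of the cube bound its measure from above. *)
Lemma lebesgue_row_cube k (z : 'rV[int]_n) :
  lam (cube k z) = ((2 ^- k) ^+ n)%:E.
Proof.
have k0 : (0 : R) < 2 ^- k by rewrite invr_gt0 exprn_gt0.
have c0 : (2 ^+ k : R) != 0 by rewrite gt_eqF// exprn_gt0.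
have ub : (lam (cube k z) <= ((2 ^- k) ^+ n)%:E)%E.
  rewrite -[X in _ ^+ X]card_ord -prodr_const.
  apply: lebesgue_row_diam => [|i|x y i xz yz]; first exact: measurable_cube.
    exact: ltW.
  exact: le_trans (ler_norm _) (cube_diam _ xz yz).
have h (eta : R) : 0 < eta < 2 ^- k -> (((2 ^- k - eta) ^+ n)%:E <= lam (cube k z))%E.
  move=> /andP[e0 ek].
  pose a : V := \row_i ((z 0 i)%:~R * 2 ^- k).
  pose b : V := \row_i (a 0 i + (2 ^- k - eta)).
  have -> : ((2 ^- k - eta) ^+ n)%:E = lam [set x : V | forall i, a 0 i <= x 0 i <= b 0 i].
    rewrite lebesgue_row_box => [|i]; last by rewrite !mxE; lra.
    rewrite (eq_bigr (fun=> 2 ^- k - eta)) ?prodr_const ?card_ord// => i _.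
    by rewrite !mxE; ring.
  apply: le_measure; rewrite ?inE; [exact: measurable_box|exact: measurable_cube|].
  move=> x xab i; have := xab i; rewrite !mxE => /andP[h1 h2].
  rewrite intrD -ler_pdivrMr ?exprn_gt0// h1 /= -ltr_pdivlMr ?exprn_gt0//.
  by rewrite mulrDl mul1r; lra.
have fin : lam (cube k z) \is a fin_num.
  by rewrite ge0_fin_numE//; apply: le_lt_trans ub (ltry _).
apply/eqP; rewrite eq_le ub -(fineK fin) lee_fin; apply/ler_addgt0Pr => e e0.
have /cvgrPdist_lt/(_ _ e0) := @exprn_continuous R n (2 ^- k).
rewrite /= -nbhs_ballE => -[d /= d0 hd].
pose eta := Num.min (d / 2) (2 ^- k / 2).
have eta0 : 0 < eta by rewrite lt_min !divr_gt0.
have etad : eta <= d / 2 by rewrite ge_min lexx.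
have etak : eta <= 2 ^- k / 2 by rewrite ge_min lexx orbT.
have := hd (2 ^- k - eta); rewrite /ball /= opprB addrC subrK gtr0_norm//.
move=> /(_ _)/ltr_normlP h'; have [|h1 h2] := h'; first lra.
have := h eta; rewrite -(fineK fin) lee_fin => /(_ _) h3; have := h3 _.
move=> /(_ _) h4; have h5 := h4 _; lra.
Qed.

Lemma lebesgue_row_norm_ball (r : R) : (lam [set x : V | (`|x| < r)%R] < +oo)%E.
Proof.
have [r0|r0] := leP r 0.
  rewrite (_ : [set _ | _] = set0) ?measure0//; apply/seteqP; split => // x /= xr.
  by have := lt_le_trans xr r0; rewrite normr_lt0.
apply: le_lt_trans (lebesgue_row_diam (delta := fun=> 2 * r) _ _ _) _.
- by apply: borel_open; exact: open_norm_ball.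
- by move=> i; rewrite mulr_ge0// ltW.
- move=> x y i /= xr yr.
  by move: (le_lt_trans (ler_coord_norm x i) xr) (le_lt_trans (ler_coord_norm y i) yr);
    rewrite !ltr_norml => /andP[? ?] /andP[? ?]; lra.
- exact: ltry.
Qed.

Lemma le_lebesgue_row_cubes (nu : {measure set bV -> \bar R}) (c : R) : 0 <= c ->
  (forall k z, (nu (cube k z) <= (c * (2 ^- k) ^+ n)%:E)%E) ->
  forall A : set bV, measurable A -> (nu A <= c%:E * lam A)%E.
Proof.
move=> c0 nuc A mA.
have [m sE] : exists m : {measure set bV -> \bar R}, forall B, m B = (c%:E * lam B)%E.
  by exists (mscale (NngNum c0) lam).
rewrite -sE.
apply: le_measure_borel => // [r|k z].
  by rewrite sE lte_mul_pinfty// lebesgue_row_norm_ball.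
by rewrite sE lebesgue_row_cube -EFinM.
Qed.

(** The part of [E] mapped into a cube of side 2^-k has coordinate extents at most c 2^-k. In the
    sup norm no dimensional constant is lost, which is essential when [c] tends to 1. *)
Lemma le_lebesgue_row_expansion (T : V -> V) (E : set V) (c : R) : 0 <= c ->
  measurable (E : set bV) -> measurable_fun (E : set bV) (T : bV -> bV) ->
  (forall x y, E x -> E y -> `|x - y| <= c * `|T x - T y|) ->
  forall B : set bV, measurable B ->
  (lam (E `&` T @^-1` B) <= (c ^+ n)%:E * lam B)%E.
Proof.
move=> c0 mE mT ET B mB.
have [nu nuE] := image_measure lam mE mT; rewrite -nuE.
apply: le_lebesgue_row_cubes => // [|k z]; first exact: exprn_ge0.
rewrite nuE -exprMn.
apply: le_trans (lebesgue_row_diam (delta := fun=> c * 2 ^- k) _ _ _) _.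
- by apply: mT => //; exact: measurable_cube.
- by move=> i; rewrite mulr_ge0// invr_ge0 exprn_ge0.
- move=> x y i [Ex Tx] [Ey Ty].
  apply: (@le_trans _ _ `|(x - y) 0 i|); first by rewrite !mxE ler_norm.
  apply: le_trans (ler_coord_norm _ _) _; apply: le_trans (ET _ _ Ex Ey) _.
  apply: ler_wpM2l => //; apply: row_norm_le => [|j].
    by rewrite invr_ge0 exprn_ge0.
  by rewrite !mxE; exact: cube_diam Tx Ty.
- by rewrite prodr_const card_ord.
Qed.

End lebesgue_row_estimates.

Lemma mulmx_norm_le (R : realType) m n (L : 'M[R]_(m, n)) (h : 'rV[R]_m) :
  `|h *m L| <= (\sum_i \sum_j `|L i j|) * `|h|.
Proof.
apply: row_norm_le => [|j].
  by rewrite mulr_ge0// sumr_ge0// => i _; rewrite sumr_ge0.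
rewrite mxE mulr_suml; apply: le_trans (ler_norm_sum _ _ _) _.
apply: ler_sum => i _; rewrite normrM mulrC; apply: ler_pM => //.
  by rewrite (bigD1 j)//= lerDl sumr_ge0.
exact: ler_coord_norm.
Qed.

Lemma mulmx_bounded (R : realType) m n (L : 'M[R]_(m, n)) :
  exists2 c : R, 0 < c & forall h : 'rV[R]_m, `|h *m L| <= c * `|h|.
Proof.
exists (1 + \sum_i \sum_j `|L i j|).
  by rewrite ltr_pwDl// sumr_ge0// => i _; rewrite sumr_ge0.
move=> h; apply: le_trans (mulmx_norm_le L h) _.
by apply: ler_wpM2r => //; rewrite lerDr.
Qed.

Lemma mulmxr_continuous (R : realType) m n (L : 'M[R]_(m, n)) :
  continuous (fun x : 'rV[R]_m => x *m L).
Proof.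
move=> x; apply/row_continuousP => e e0; have [c c0 cL] := mulmx_bounded L.
exists (e / c) => [|u ux]; first by rewrite divr_gt0.
rewrite -mulmxBl; apply: le_lt_trans (cL _) _.
by rewrite mulrC -ltr_pdivlMr.
Qed.

(** Used to remove distortion factors such as (1 + s)^n from inequalities whose two sides may be
    infinite. *)
Lemma le_lim_scale (R : realType) (a b : \bar R) (K : R -> R) (s0 : R) :
  0 < s0 -> {for 0, continuous K} -> K 0 = 1 -> (0 <= b)%E ->
  (forall s, 0 < s < s0 -> (a <= (K s)%:E * b)%E) -> (a <= b)%E.
Proof.
move=> s00 cK K0; case: b => [r| |]// r0 h; last by rewrite leey.
rewrite leNgt; apply/negP => ra.
have cKr : {for 0, continuous (fun s => K s * r)}.
  by apply: continuousM => //; exact: cst_continuous.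
have ha s : 0 < s < s0 -> (a <= (K s * r)%:E)%E by move=> /h; rewrite EFinM.
have [a' aE] : exists a', a = a'%:E.
  have s2 : 0 < s0 / 2 < s0 by apply/andP; split; lra.
  by move: ra (ha _ s2); case: (a) => [a'| |]// _ _; exists a'.
move: ra ha; rewrite aE lte_fin => ra ha.
have e0 : 0 < a' - r by rewrite subr_gt0.
have /cvgrPdist_lt/(_ _ e0) := cKr.
rewrite K0 mul1r -nbhs_ballE => -[d /= d0 hd].
pose s := Num.min (d / 2) (s0 / 2).
have sd : s <= d / 2 by rewrite ge_min lexx.
have ss : s <= s0 / 2 by rewrite ge_min lexx orbT.
have s_gt0 : 0 < s by rewrite lt_min !divr_gt0.
have := hd s; rewrite /ball /= sub0r normrN gtr0_norm// => /(_ _)/ltr_normlP[|h1 h2].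
  by lra.
have := ha s; rewrite lee_fin s_gt0 /= => /(_ _) h3.
have h4 : a' <= K s * r by apply: h3; lra.
lra.
Qed.

(** * Lebesgue measure under linear maps *)

Section lebesgue_row_linear.
Context {R : realType}.
Local Notation lam n := (lebesgue_row n : {measure set (borel R n) -> \bar R}).

Lemma measurable_mulmxr m n (L : 'M[R]_(m, n)) (A : set (borel R n)) :
  measurable A -> measurable ((fun x : 'rV[R]_m => x *m L) @^-1` A : set (borel R m)).
Proof.
move=> mA; rewrite -[X in measurable X]setTI.
by apply: (continuous_borel (@mulmxr_continuous _ _ _ L)).
Qed.

Lemma measurable_fun_mulmxr d (T : measurableType d) m n (L : 'M[R]_(m, n))
    (D : set T) (f : T -> borel R m) : measurable_fun D f ->
  measurable_fun D (fun x => (f x : 'rV[R]_m) *m L : borel R n).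
Proof. by move=> mf mD B mB; exact: mf mD _ (measurable_mulmxr L mB). Qed.

(** Only one inequality, since this is what the comparison on cubes gives. It passes to products,
    and equality follows from it for the inverse matrix. *)
Definition contracts_volume n (L : 'M[R]_n) := forall A : set (borel R n),
  measurable A ->
  (lam n ((fun x : 'rV[R]_n => x *m L) @^-1` A) <= `|\det L|^-1%:E * lam n A)%E.

Lemma contracts_volumeM n (L M : 'M[R]_n) :
  contracts_volume L -> contracts_volume M -> contracts_volume (L *m M).
Proof.
move=> cL cM A mA.
rewrite (_ : _ @^-1` A = (fun x : 'rV[R]_n => x *m L) @^-1`
    ((fun x : 'rV[R]_n => x *m M) @^-1` A)); last first.
  by apply/seteqP; split => x /=; rewrite mulmxA.
apply: le_trans (cL _ (measurable_mulmxr _ mA)) _.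
rewrite det_mulmx normrM invfM EFinM -muleA.
by apply: lee_wpmul2l; [rewrite lee_fin invr_ge0|exact: cM].
Qed.

Lemma contracts_volume_expansion n (L : 'M[R]_n) (c : R) : 0 <= c ->
  (forall x : 'rV[R]_n, `|x| <= c * `|x *m L|) ->
  forall A : set (borel R n), measurable A ->
  (lam n ((fun x : 'rV[R]_n => x *m L) @^-1` A) <= (c ^+ n)%:E * lam n A)%E.
Proof.
move=> c0 cL A mA; rewrite -[X in lam n X]setTI.
apply: le_lebesgue_row_expansion => //.
  exact: (continuous_borel (@mulmxr_continuous _ _ _ L)).
by move=> x y _ _; rewrite -mulmxBl.
Qed.

(** Each coordinate has its own bound on the preimage of a cube; a single expansion constant would
    give the n-th power of the largest factor instead of the product. *)
Lemma contracts_volume_diag n (d : 'rV[R]_n) : (forall i, d 0 i != 0) ->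
  contracts_volume (diag_mx d).
Proof.
move=> d0 A mA.
have mD : measurable_fun [set: borel R n]
    ((fun x : 'rV[R]_n => x *m diag_mx d) : borel R n -> borel R n).
  exact: (continuous_borel (@mulmxr_continuous _ _ _ _)).
have [nu nuE] := image_measure (lam n) measurableT mD.
have := nuE A; rewrite setTI => <-.
apply: le_lebesgue_row_cubes => // k z.
rewrite nuE setTI.
apply: le_trans (lebesgue_row_diam (delta := fun i => `|d 0 i|^-1 * 2 ^- k) _ _ _) _.
- by apply: measurable_mulmxr; exact: measurable_cube.
- by move=> i; rewrite mulr_ge0// invr_ge0// exprn_ge0.
- move=> x y i; rewrite /= !mul_mx_diag => /cube_diam h /h{h} /(_ i).
  rewrite !mxE -mulrBl normrM => h; apply: le_trans (ler_norm _) _.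
  by rewrite mulrC ler_pdivlMr// normr_gt0.
- by rewrite big_split /= prodr_const card_ord det_diag normr_prod prodfV.
Qed.

Lemma contracts_volume_perm n (L : 'M[R]_n) : is_perm_mx L -> contracts_volume L.
Proof.
case/is_perm_mxP => s -> A mA; rewrite det_perm normr_sign invr1.
rewrite -(expr1n R n); apply: contracts_volume_expansion => // x.
have -> : x *m perm_mx s = col_perm s^-1 x by rewrite col_permE invgK.
rewrite mul1r; apply: row_norm_le => // i.
by apply: le_trans (ler_coord_norm _ (s i)); rewrite mxE permK.
Qed.

(* Conjugating by [diag (t ^ w i)] multiplies the off-diagonal entries by
   positive powers of [t], so that the map tends to the identity as [t -> 0]. *)
Lemma contracts_volume_unipotent n (L : 'M[R]_n) (w : 'I_n -> nat) :
  (forall i j, (w i <= w j)%N -> L i j = (i == j)%:R) ->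
  \det L = 1 -> contracts_volume L.
Proof.
move=> Lw detL A mA; rewrite detL normr1 invr1 mul1e.
pose c := 1 + \sum_i \sum_j `|L i j|.
have c0 : 0 < c by rewrite ltr_pwDl// sumr_ge0// => i _; rewrite sumr_ge0.
apply: (@le_lim_scale _ _ _ (fun s => (1 - s)^-1 ^+ n) 1) => //.
- apply: (@continuous_comp _ _ _ (fun s : R => (1 - s)^-1) (fun x : R => x ^+ n));
    last exact: exprn_continuous.
  apply: continuousV; first by rewrite subr0 oner_eq0.
  by apply: continuousB; [exact: cst_continuous|exact: cvg_id].
- by rewrite subr0 invr1 expr1n.
move=> s /andP[s0 s1].
(* As t <= 1, every positive power of t is at most t, so the entries of the conjugate minus the
   identity sum to at most t c <= s; hence the conjugate has expansion constant (1 - s)^-1. *)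
pose t := Num.min (s / c) (1 / 2).
have t0 : 0 < t by rewrite lt_min !divr_gt0.
have tc : t * c <= s by rewrite -ler_pdivlMr// ge_min lexx.
have t1 : t <= 1.
  by apply: (@le_trans _ _ (1 / 2)); [rewrite ge_min lexx orbT|lra].
pose d : 'rV[R]_n := \row_i t ^+ w i.
pose d' : 'rV[R]_n := \row_i t ^- w i.
have tn0 k : t ^+ k != 0 by rewrite gt_eqF// exprn_gt0.
have dd' : diag_mx d *m diag_mx d' = 1%:M.
  rewrite mulmx_diag -diag_const_mx; congr diag_mx.
  by apply/rowP => i; rewrite !mxE divff.
have d'd : diag_mx d' *m diag_mx d = 1%:M.
  rewrite mulmx_diag -diag_const_mx; congr diag_mx.
  by apply/rowP => i; rewrite !mxE mulVf.
pose M := diag_mx d *m L *m diag_mx d'.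
have LE : L = diag_mx d' *m M *m diag_mx d.
  by rewrite /M !mulmxA d'd mul1mx -mulmxA d'd mulmx1.
have ME : forall x : 'rV[R]_n, `|x| <= (1 - s)^-1 * `|x *m M|.
  move=> x; rewrite ler_pdivlMl ?subr_gt0// mulrBl mul1r lerBlDr.
  rewrite -[X in `|X| <= _](subrK (x *m M)); apply: le_trans (ler_normD _ _) _.
  rewrite addrC lerD2l -[X in X - _]mulmx1 -mulmxBr.
  apply: le_trans (mulmx_norm_le _ _) _; apply: ler_wpM2r => //.
  apply: le_trans _ tc; rewrite mulrDr mulr1 ler_wpDl ?(ltW t0)// mulr_sumr.
  apply: ler_sum => i _; rewrite mulr_sumr; apply: ler_sum => j _.
  rewrite /M mul_diag_mx mul_mx_diag !mxE.
  have [wij|wji] := leqP (w i) (w j).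
    rewrite Lw//; have [->|_] := eqVneq i j.
      by rewrite mulr1 divff// subrr normr0 mulr_ge0// ltW.
    by rewrite (_ : false%:R = 0 :> R)// mulr0 mul0r subr0 normr0 mulr0.
  have [ij|ij] := eqVneq i j; first by rewrite ij ltnn in wji.
  rewrite sub0r normrN -mulrA mulrCA mulrC -exprB; first last.
    by rewrite unitfE gt_eqF.
    exact: ltnW.
  rewrite normrM ler_wpM2r// ger0_norm ?exprn_ge0 ?(ltW t0)//.
  by rewrite -[leRHS]expr1 ler_wiXn2l ?(ltW t0)// subn_gt0.
rewrite LE (_ : _ @^-1` A = (fun x : 'rV[R]_n => x *m diag_mx d') @^-1`
    ((fun x : 'rV[R]_n => x *m M) @^-1` ((fun x : 'rV[R]_n =>
      x *m diag_mx d) @^-1` A))); last first.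
  by apply/seteqP; split => x /=; rewrite !mulmxA.
have mdA := measurable_mulmxr (diag_mx d) mA.
apply: le_trans (contracts_volume_diag _ (measurable_mulmxr M mdA)) _.
  by move=> i; rewrite mxE invr_eq0.
have /andP[dd0 dd1] : (0 < `|\det (diag_mx d')|) &&
    (`|\det (diag_mx d)| == `|\det (diag_mx d')|^-1).
  have : `|\det (diag_mx d)| * `|\det (diag_mx d')| = 1.
    by rewrite -normrM -det_mulmx dd' det1 normr1.
  move=> e; have h0 : `|\det (diag_mx d')| != 0.
    by apply/eqP => h0; move: e; rewrite h0 mulr0 => /esym/eqP; rewrite oner_eq0.
  by rewrite lt_neqAle eq_sym h0 normr_ge0 /= -[X in X == _]mulr1 -(divff h0) mulrA e mul1r.
rewrite -lee_pdivlMl ?invr_gt0// invrK.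
apply: le_trans (contracts_volume_expansion _ ME mdA) _.
  by rewrite invr_ge0 subr_ge0 ltW.
rewrite muleCA; apply: lee_wpmul2l; first by rewrite lee_fin exprn_ge0// invr_ge0 subr_ge0 ltW.
apply: le_trans (contracts_volume_diag _ mA) _; first by move=> i; rewrite mxE.
by rewrite (eqP dd1) invrK.
Qed.

(** By LUP decomposition, with the diagonal of the upper factor split off, an invertible matrix is a
    product of a permutation, a diagonal and two unipotent triangular matrices. [cormen_lup]
    concerns positive sizes, hence the case of size 0. *)
Lemma contracts_volume_unit n (L : 'M[R]_n) : L \in unitmx -> contracts_volume L.
Proof.
case: n L => [|n] L uL.
  move=> A mA; rewrite (_ : \det L = 1) ?normr1 ?invr1 ?mul1e.
    rewrite (_ : _ @^-1` A = A)//; apply/seteqP.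
    have e (x y : 'rV[R]_0) : x = y by apply/rowP => -[].
    by split => x /=; rewrite (e (x *m L) x).
  by rewrite [L]thinmx0 det_mx00.
have := cormen_lup_correct L; have := cormen_lup_perm L.
have := @cormen_lup_lower _ n L; have := @cormen_lup_upper _ n L.
have := cormen_lup_detL L.
case: (cormen_lup L) => -[P Lo] Up /= detLo Upu Lol /is_perm_mxP[s ->] E.
have detUp : \det Up != 0.
  have /(congr1 determinant) := E; rewrite -!mulmxE !det_mulmx detLo mul1r => <-.
  by rewrite mulf_neq0// ?det_perm ?signr_eq0// -unitfE.
have -> : L = perm_mx s^-1 *m (Lo *m Up).
  have <- : perm_mx s *m L = Lo *m Up by exact: E.
  by rewrite mulmxA -perm_mxM mulVg perm_mx1 mul1mx.
apply: contracts_volumeM; first exact/contracts_volume_perm/perm_mx_is_perm.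
apply: contracts_volumeM.
  by apply: (contracts_volume_unipotent (w := fun i => i)).
have detUpE : \det Up = \prod_i Up i i.
  rewrite -det_tr det_trig.
    by apply: eq_bigr => i _; rewrite mxE.
  by apply/is_trig_mxP => i j ij; rewrite mxE Upu.
have Uii i : Up i i != 0.
  by apply: contraNneq detUp => Ui0; rewrite detUpE (bigD1 i)//= Ui0 mul0r.
pose d : 'rV[R]_n.+1 := \row_i Up i i.
pose U := \matrix_(i, j) ((Up i i)^-1 * Up i j).
have -> : Up = diag_mx d *m U.
  by apply/matrixP => i j; rewrite mul_diag_mx !mxE mulrA divff// mul1r.
apply: contracts_volumeM.
  by apply: contracts_volume_diag => i; rewrite mxE.
(* The weights decrease with the index since this factor is upper triangular. *)
apply: (contracts_volume_unipotent (w := fun i => n - i)%N) => [i j ij|].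
  rewrite mxE; have [->|ne] := eqVneq i j; first by rewrite mulVf.
  have ne' : (i : nat) != j by rewrite (inj_eq val_inj).
  have ji : (j < i)%N by move: ne' ij (ltn_ord i) (ltn_ord j); lia.
  by rewrite (Upu _ _ ji) mulr0.
rewrite -det_tr det_trig.
  by rewrite big1// => i _; rewrite !mxE mulVf.
by apply/is_trig_mxP => i j ij; rewrite !mxE (Upu _ _ ij) mulr0.
Qed.

Lemma lebesgue_row_linear n (L : 'M[R]_n) (A : set (borel R n)) :
  L \in unitmx -> measurable A ->
  lam n ((fun x : 'rV[R]_n => x *m L) @^-1` A) = (`|\det L|^-1%:E * lam n A)%E.
Proof.
move=> uL mA; apply/eqP; rewrite eq_le contracts_volume_unit//=.
have d0 : 0 < `|\det L| by rewrite normr_gt0 -unitfE.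
rewrite lee_pdivrMl//.
have /contracts_volume_unit : invmx L \in unitmx by rewrite unitmx_inv.
move=> /(_ _ (measurable_mulmxr L mA)); rewrite det_inv normfV invrK.
rewrite (_ : _ @^-1` (_ @^-1` A) = A)//.
by apply/seteqP; split => x /=; rewrite mulmxKV.
Qed.

End lebesgue_row_linear.

(** * Change of variables *)

Section strict_differentiability.
Context {R : realType}.

(* Strict differentiability at a single point: it gives local injectivity and
   two-sided volume estimates without a derivative at the neighbouring points. *)
Definition sdiff m n (F : 'rV[R]_m -> 'rV[R]_n) (x : 'rV[R]_m) (L : 'M[R]_(m, n)) :=
  forall e : R, 0 < e -> exists2 d : R, 0 < d & forall u v,
    `|u - x| < d -> `|v - x| < d -> `|F u - F v - (u - v) *m L| <= e * `|u - v|.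

Lemma sdiff_continuous m n (F : 'rV[R]_m -> 'rV[R]_n) x L :
  sdiff F x L -> {for x, continuous F}.
Proof.
move=> sF; apply/row_continuousP => e e0.
have [d d0 hd] := sF 1 ltr01; have [c c0 cL] := mulmx_bounded L.
have c1 : 0 < 1 + c by rewrite addr_gt0.
exists (Num.min d (e / (1 + c))) => [|u]; first by rewrite lt_min d0 divr_gt0.
rewrite lt_min ltr_pdivlMr// => /andP[ud ue]; apply: le_lt_trans ue.
rewrite -[X in `|X|](subrK ((u - x) *m L)); apply: le_trans (ler_normD _ _) _.
rewrite mulrDr mulr1 lerD//; last by rewrite mulrC.
by have := hd u x ud; rewrite subrr normr0 mul1r; exact.
Qed.

(** Both matrices approximate the same increment of [F] from y to y + v: [DF y] by strictness at y,
    [DF x] by strictness at x, whose ball contains y and y + v. *)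
Lemma sdiff_close m n (F : 'rV[R]_m -> 'rV[R]_n) (DF : 'rV[R]_m -> 'M[R]_(m, n))
    (E : set 'rV[R]_m) x : (forall y, E y -> sdiff F y (DF y)) -> E x ->
  forall e : R, 0 < e -> exists2 d : R, 0 < d & forall y, E y -> `|y - x| < d ->
    forall i j, `|DF y i j - DF x i j| < e.
Proof.
move=> sF Ex e e0; have e3 : 0 < e / 3 by rewrite divr_gt0.
have [d d0 hd] := sF x Ex _ e3; exists d => // y Ey yd i j.
have [d' d'0 hd'] := sF y Ey _ e3.
(* Small enough for y + v to lie in both balls; the step v is along one coordinate, which isolates
   row i of the matrices. *)
pose h := Num.min (d' / 2) ((d - `|y - x|) / 2).
have h0 : 0 < h by rewrite lt_min !divr_gt0// subr_gt0.
have hle1 : h <= d' / 2 by rewrite ge_min lexx.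
have hle2 : h <= (d - `|y - x|) / 2 by rewrite ge_min lexx orbT.
pose v : 'rV[R]_m := h *: delta_mx 0 i.
have v_norm : `|v| <= h.
  apply: row_norm_le => [|k]; first exact: ltW.
  rewrite !mxE eqxx /= normrM gtr0_norm//.
  by case: (k == i); rewrite ?normr1 ?normr0 ?mulr1 ?mulr0// ltW.
have := hd (y + v) y _ yd; have := hd' (y + v) y.
rewrite addrAC subrr add0r normr0 => /(_ _ d'0) h1 h2.
have {}h1 : `|F (y + v) - F y - v *m DF y| <= e / 3 * h.
  apply: le_trans (h1 _) _; last by apply: ler_wpM2l => //; exact: ltW.
  by apply: le_lt_trans v_norm _; lra.
have {}h2 : `|F (y + v) - F y - v *m DF x| <= e / 3 * h.
  apply: le_trans (h2 _) _; last by apply: ler_wpM2l => //; exact: ltW.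
  rewrite addrAC; apply: le_lt_trans (ler_normD _ _) _.
  by apply: (@le_lt_trans _ _ (`|y - x| + h)); [rewrite lerD2l|lra].
have : `|v *m (DF y - DF x)| <= e / 3 * h + e / 3 * h.
  rewrite mulmxBr (_ : _ - _ = (F (y + v) - F y - v *m DF x) - (F (y + v) - F y - v *m DF y)).
    by apply: le_trans (ler_normB _ _) _; exact: lerD.
  by apply/rowP => k; rewrite !mxE; ring.
move=> /(le_trans (ler_coord_norm _ j)).
rewrite -scalemxAl -rowE !mxE normrM gtr0_norm// -mulrDl mulrC ler_pM2r//.
by move/le_lt_trans; apply; lra.
Qed.

End strict_differentiability.

(** * Measurable images and the change of variables formula *)

Section change_of_variables.
Context {R : realType} {n : nat}.
Local Notation V := 'rV[R]_n.
Local Notation bV := (borel R n).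
Local Notation lam := (lebesgue_row n : {measure set bV -> \bar R}).

Lemma measurable_continuous_open (E : set V) (f : V -> R) : open E ->
  (forall x, E x -> {for x, continuous f}) ->
  measurable_fun (E : set bV) (f : bV -> measurableTypeR R).
Proof.
move=> oE cf; apply: (@measurability _ _ _ _ _ _ (@RGenOpens.G R)).
  exact: RGenOpens.measurableE.
move=> _ [_ [a [b ->] <-]]; apply: borel_open.
rewrite openE => x [Ex fx]; apply: filterI; first exact: open_nbhs_nbhs.
by apply: (cf x Ex); apply: open_nbhs_nbhs; split => //; exact: interval_open.
Qed.

Lemma measurable_continuous_open_row m (E : set V) (f : V -> 'rV[R]_m) : open E ->
  (forall x, E x -> {for x, continuous f}) ->
  measurable_fun (E : set bV) (f : bV -> borel R m).
Proof.
move=> oE cf; apply: borel_measurable_fun => [|U oU]; first exact: borel_open.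
apply: borel_open; rewrite openE => x [Ex fx]; apply: filterI.
  exact: open_nbhs_nbhs.
by apply: (cf x Ex); apply: open_nbhs_nbhs.
Qed.

Lemma det_continuous (T : topologicalType) (M : T -> 'M[R]_n) x :
  (forall i j, {for x, continuous (fun y => M y i j)}) ->
  {for x, continuous (fun y => \det (M y))}.
Proof.
move=> cM; rewrite /determinant.
apply: (@cvg_big _ _ (@GRing.add R)) => [|s _]; first exact: add_continuous.
apply: (@continuousM R T (fun=> _)); first exact: cst_continuous.
apply: (@cvg_big _ _ (@GRing.mul R)) => [|i _]; first exact: mul_continuous.
exact: cM.
Qed.

Lemma open_sigma_compact (O : set V) : open O ->
  exists K : (set V)^nat, [/\ forall k, compact (K k),
    nondecreasing_seq K & \bigcup_k K k = O].
Proof.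
move=> /open_bigcup_closed[F [cF ndF FO]].
exists (fun k => F k `&` [set x | `|x| <= k%:R]); split => [k|k l kl|].
- apply: bounded_closed_compact.
    exists k%:R; split => // M kM x [_ /= xk]; exact: le_trans xk (ltW kM).
  apply: closedI => //.
  apply: (@preimage_closed _ _ (Num.norm : V -> R) [set z | z <= k%:R]).
    by move=> x _; exact: norm_continuous.
  exact: closed_le.
- apply/subsetPset => x [Fx /= xk]; split.
    by move: Fx; exact/subsetPset/ndF.
  by apply: le_trans xk _; rewrite ler_nat.
- apply/seteqP; split => [x [k _ [Fx _]]|x]; first by rewrite -FO; exists k.
  rewrite -FO => -[k _ Fx].
  have xb : `|x| < (Num.bound `|x|)%:R by rewrite archi_boundP.
  exists (maxn k (Num.bound `|x|)) => //; split.
    by move: Fx; apply/subsetPset/ndF; exact: leq_maxl.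
  by apply: le_trans (ltW xb) _; rewrite ler_nat leq_maxr.
Qed.

(** Open sets are countable unions of compact sets, and continuous images of compact sets are
    compact. *)
Lemma measurable_image_open (E : set V) (F : V -> V) : open E ->
  (forall x, E x -> {for x, continuous F}) ->
  forall U, open U -> U `<=` E -> measurable (F @` U : set bV).
Proof.
move=> oE cF U oU UE; have [K [cK _ KU]] := open_sigma_compact oU.
rewrite -KU image_bigcup; apply: bigcupT_measurable => k.
apply: borel_compact; apply: continuous_compact => //.
apply: continuous_in_subspaceT => x; rewrite inE => Kx.
by apply/cF/UE; rewrite -KU; exists k.
Qed.

(** Injectivity makes the image commute with relative complements, so the sets with measurable image
    form a sigma-algebra containing the open sets. *)
Lemma measurable_image_inj (E : set V) (F : V -> V) : open E ->
  (forall x, E x -> {for x, continuous F}) -> set_inj E F ->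
  forall A : set bV, measurable A -> measurable (F @` (A `&` E) : set bV).
Proof.
move=> oE cF injF.
have mI := measurable_image_open oE cF.
apply: borel_smallest => [|U oU]; last by apply: mI => //; exact: openI.
split.
- by rewrite set0I image_set0.
- move=> A mA; rewrite (_ : F @` _ = F @` E `\` F @` (A `&` E)).
    by apply: measurableD => //; exact: mI.
  apply/seteqP; split => [_ [x [[_ nAx] Ex] <-]|_ [[x Ex <-] nAx]].
    split; first by exists x.
    by move=> [y [Ay Ey] /injF]; rewrite !inE => /(_ Ey Ex) yx; apply: nAx; rewrite -yx.
  by exists x => //; split => //; split => // Ax; apply: nAx; exists x.
- by move=> A mA; rewrite setI_bigcupl image_bigcup; exact: bigcupT_measurable.
Qed.

(** Every point of [E] lies in a dyadic cube small enough for the local inequality. There are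
    countably many such cubes, so they can be made disjoint and the inequality summed over the
    pieces of [A]. *)
Lemma le_measure_local (m1 m2 : {measure set bV -> \bar R}) (E : set V) :
  (forall x, E x -> exists2 d : R, 0 < d & forall A : set bV, measurable A ->
    A `<=` E -> (forall y, A y -> `|(y : V) - x| < d) -> (m1 A <= m2 A)%E) ->
  forall A : set bV, measurable A -> A `<=` E -> (m1 A <= m2 A)%E.
Proof.
move=> loc A mA AE.
pose good (p : nat * 'rV[int]_n) := forall B : set bV, measurable B ->
  B `<=` E -> B `<=` cube p.1 p.2 -> (m1 B <= m2 B)%E.
pose C j : set V := if pickle_inv j is Some p then
  if `[< good p >] then cube p.1 p.2 else set0 else set0.
have mC j : measurable (C j : set bV).
  rewrite /C; case: pickle_inv => // p; case: asboolP => // _.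
  exact: measurable_cube.
have mD j : measurable (A `&` seqDU C j : set bV).
  apply: measurableI => //; apply: measurableD => //.
  by apply: bigsetU_measurable => i _.
have AC : A = \bigcup_j (A `&` seqDU C j).
  rewrite -setI_bigcupr (_ : \bigcup_j seqDU C j = \bigcup_j C j); last first.
    by rewrite -seqDU_bigcup_eq.
  apply/esym/setIidl => x Ax.
  have [d d0 hd] := loc x (AE _ Ax).
  have [k kd] : exists k, 2 ^- k < d.
    have [k] := ltr_add_invr d0; rewrite add0r => kd.
    exists k; apply: le_lt_trans kd; rewrite lef_pV2 ?posrE ?exprn_gt0//.
    by rewrite -natrX ler_nat ltn_expl.
  exists (pickle (k, cube_index k x)) => //.
  rewrite /C pickleK_inv asboolT; first exact: in_cube_index.
  move=> B mB BE Bc; apply: hd => // y /Bc By; apply: le_lt_trans kd.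
  apply: row_norm_le => [|i]; first by rewrite invr_ge0 exprn_ge0.
  by rewrite !mxE; apply: cube_diam By _; exact: in_cube_index.
have tD : trivIset setT (fun j => A `&` seqDU C j).
  by apply: trivIset_setIl; exact: trivIset_seqDU.
rewrite AC !measure_bigcup//; apply: lee_nneseries => // j _.
have : A `&` seqDU C j `<=` C j by move=> x [_ /(@subset_seqDU _ C)].
move: (mD j); have : A `&` seqDU C j `<=` E by move=> x [/AE].
move: (A `&` seqDU C j) => B BE mB; rewrite /C.
case: pickle_inv => [p|BC]; first case: asboolP => [gp BC|_ BC].
- exact: gp.
- by rewrite (_ : B = set0) ?measure0//; apply/seteqP; split.
- by rewrite (_ : B = set0) ?measure0//; apply/seteqP; split.
Qed.

Section formula.
Variables (E : set V) (F : V -> V) (DF : V -> 'M[R]_n).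
Hypotheses (oE : open E) (sF : forall x, E x -> sdiff F x (DF x)).
Hypotheses (uF : forall x, E x -> DF x \in unitmx) (injF : set_inj E F).

Let cF x : E x -> {for x, continuous F}.
Proof. by move=> /sF; exact: sdiff_continuous. Qed.

Let jac (x : V) : R := `|\det (DF x)|.

Let cjac x : E x -> {for x, continuous jac}.
Proof.
move=> Ex; apply: (@continuous_comp _ _ _ (fun x => \det (DF x)) Num.norm); last first.
  exact: norm_continuous.
apply: det_continuous => i j; apply/row_continuousP => e e0.
have [d d0 hd] := sdiff_close sF Ex e0.
have /row_nbhsP[r r0 rE] : nbhs x E by exact: open_nbhs_nbhs.
exists (Num.min d r) => [|u]; first by rewrite lt_min d0.
by rewrite lt_min => /andP[ud ur]; exact: hd (rE _ ur) ud i j.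
Qed.

Let mE : measurable (E : set bV). Proof. exact: borel_open. Qed.

Let mjac : measurable_fun (E : set bV) (jac : bV -> measurableTypeR R).
Proof. exact: measurable_continuous_open. Qed.

Let jac_gt0 x : E x -> 0 < jac x.
Proof. by move=> /uF; rewrite unitmxE unitfE normr_gt0. Qed.

Lemma inverse_measurable : exists2 g : V -> V, (forall x, E x -> g (F x) = x) &
  measurable_fun (F @` E : set bV) (g : bV -> bV).
Proof.
pose g X := xget 0 [set x | E x /\ F x = X].
have gF x : E x -> g (F x) = x.
  move=> Ex; rewrite /g; case: xgetP => [y _ [Ey Fyx]|/(_ x)/=]; last by case.
  by apply: injF; rewrite ?inE.
exists g => // _ B mB; rewrite (_ : _ `&` _ = F @` (B `&` E)).
  exact: measurable_image_inj.
apply/seteqP; split => [_ [[x Ex <-] /= Bx]|_ [x [Bx Ex] <-]].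
  by exists x => //; split => //; rewrite -(gF x).
by split; [exists x|rewrite /= gF].
Qed.

(** With [c] bounding the inverse of [L], the error s / c in the strict derivative becomes a
    relative error s. The expansion bound is applied to the two maps between the image of [A] under
    [F] and its image under [L], and the linear case supplies the determinant. *)
Lemma jacobian_local x s : E x -> 0 < s < 1 -> exists2 d : R, 0 < d &
  forall A : set bV, measurable A -> A `<=` E ->
    (forall y, A y -> `|(y : V) - x| < d) ->
    (lam (F @` A) <= ((1 + s) ^+ n * `|\det (DF x)|)%:E * lam A)%E /\
    (lam A <= ((1 - s)^-1 ^+ n * `|\det (DF x)|^-1)%:E * lam (F @` A))%E.
Proof.
move=> Ex /andP[s0 s1]; set L := DF x; have uL : L \in unitmx by exact: uF.
have [c c0 cL] := mulmx_bounded (invmx L).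
have e0 : 0 < s / c by rewrite divr_gt0.
have [d d0 hd] := sF Ex e0; exists d => // A mA AE Ad.
have mFA : measurable (F @` A : set bV).
  by rewrite -(setIidl AE); exact: measurable_image_inj.
have [g gF mg] := inverse_measurable.
split.
  (* The image of [A] under [L] is handled as its preimage under the inverse matrix, as the linear
     formula is stated for preimages. *)
  rewrite EFinM -muleA (_ : `|\det L| = `|\det (invmx L)|^-1); last first.
    by rewrite det_inv normfV invrK.
  rewrite -lebesgue_row_linear ?unitmx_inv//.
  set B := (fun y : V => y *m invmx L) @^-1` A.
  have mB : measurable (B : set bV) by exact: measurable_mulmxr.
  have mgA : measurable_fun (F @` A : set bV) ((fun X => g X *m L) : bV -> bV).
    apply: measurable_fun_mulmxr; apply: measurable_funS mg.
      exact: (measurable_image_open oE cF).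
    exact: image_subset.
  apply: le_trans (le_lebesgue_row_expansion (c := 1 + s) _ mFA mgA _ mB).
  - apply: le_measure; rewrite ?inE//; first exact: mgA.
    move=> _ [y Ay <-]; split; first by exists y.
    by rewrite /B /= gF ?mulmxK//; exact: AE.
  - by rewrite addr_ge0// ltW.
  move=> _ _ [y Ay <-] [z Az <-]; rewrite !gF; try exact: AE.
  rewrite -mulmxBl mulrDl mul1r.
  have := hd y z (Ad _ Ay) (Ad _ Az).
  have := cL ((y - z) *m L); rewrite mulmxK// => h1 h2.
  rewrite -[X in `|X| <= _](subrK ((y - z) *m L)); apply: le_trans (ler_normD _ _) _.
  rewrite addrC lerD2l; apply: le_trans h2 _.
  by rewrite -mulrA ler_pM2l// ler_pdivrMl.
rewrite EFinM -muleA -lebesgue_row_linear//.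
set B := (fun y : V => y *m L) @^-1` _.
have mB : measurable (B : set bV) by exact: measurable_mulmxr.
have mFL : measurable_fun (A : set bV) ((fun y => F y *m invmx L) : bV -> bV).
  apply: measurable_fun_mulmxr.
  apply: measurable_funS (measurable_continuous_open_row oE cF) => //.
apply: le_trans (le_lebesgue_row_expansion (c := (1 - s)^-1) _ mA mFL _ mB).
- apply: le_measure; rewrite ?inE//; first exact: mFL.
  move=> y Ay; split => //; rewrite /B /= mulmxKV//; by exists y.
- by rewrite invr_ge0 subr_ge0 ltW.
move=> y z Ay Az; rewrite ler_pdivlMl ?subr_gt0// mulrBl mul1r lerBlDr.
rewrite -mulmxBl.
rewrite -[X in `|X| <= _](mulmxK uL) -[X in X *m invmx L](subrK (F y - F z)).
rewrite mulmxDl; apply: le_trans (ler_normD _ _) _.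
rewrite addrC lerD2l; apply: le_trans (cL _) _.
rewrite distrC -ler_pdivlMl//; apply: le_trans (hd y z (Ad _ Ay) (Ad _ Az)) _.
by rewrite mulrCA mulrA.
Qed.

(** Both sides define measures on [E]. Near each point they agree up to factors depending on s, from
    the distortion of volumes and the variation of the jacobian, and these factors tend to 1 with
    s. *)
Theorem change_of_variables (A : set bV) : measurable A -> A `<=` E ->
  measurable (F @` A : set bV) /\
  lam (F @` A) = (\int[lam]_(x in A) (`|\det (DF x)|)%:E)%E.
Proof.
move=> mA AE; split.
  by rewrite -(setIidl AE); exact: measurable_image_inj.
have [g gF mg] := inverse_measurable.
have mFE : measurable (F @` E : set bV) by exact: (measurable_image_open oE cF).
(* Transporting Lebesgue measure along the inverse shows that the volume of the image under [F] is a
   measure. *)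
have [m1 m1E] := image_measure lam mFE mg.
have m1F B : B `<=` E -> m1 B = lam (F @` B).
  move=> BE; rewrite m1E; congr (lam _); apply/seteqP; split.
    by move=> _ [[x Ex <-]] /=; rewrite gF// => Bx; exists x.
  by move=> _ [x Bx <-]; split; [exists x => //; exact: BE|rewrite /= gF//; exact: BE].
have mjE : measurable_fun (E : set bV) (fun x : bV => (jac x)%:E).
  exact/measurable_EFinP.
have [m2 m2E] := density_measure lam mE mjE (fun x _ => normr_ge0 (\det (DF x))).
have m2A (B : set bV) : measurable B -> B `<=` E -> m2 B = (\int[lam]_(x in B) (jac x)%:E)%E.
  by move=> mB BE; rewrite m2E// setIidl.
rewrite -(m1F _ AE) -/(jac _) -m2A//.
have lb (c : R) (B : set bV) : 0 <= c -> measurable B -> B `<=` E ->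
    (forall y, B y -> c <= jac y) -> (c%:E * lam B <= m2 B)%E.
  move=> c0 mB BE cj; rewrite m2A// -integral_cst//; apply: ge0_le_integral => //.
  by apply: measurable_funS mjE.
have ub (c : R) (B : set bV) : 0 <= c -> measurable B -> B `<=` E ->
    (forall y, B y -> jac y <= c) -> (m2 B <= c%:E * lam B)%E.
  move=> c0 mB BE cj; rewrite m2A// -integral_cst//; apply: ge0_le_integral => //.
    by move=> y _; rewrite lee_fin normr_ge0.
  by apply: measurable_funS mjE.
have jac_close x s : E x -> 0 < s < 1 -> exists2 d : R, 0 < d &
    forall y, `|y - x| < d -> (1 - s) * jac x <= jac y <= (1 + s) * jac x.
  move=> Ex /andP[s0 s1]; have e0 : 0 < s * jac x by rewrite mulr_gt0// jac_gt0.
  have /row_continuousP/(_ _ e0)[d d0 hd] := cjac Ex.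
  exists d => // y /hd /ltr_normlP[h1 h2]; apply/andP; split; lra.
have scale (c : R) (m : {measure set bV -> \bar R}) : 0 <= c ->
    exists m' : {measure set bV -> \bar R}, forall B, m' B = (c%:E * m B)%E.
  by move=> c0; exists (mscale (NngNum c0) m).
have c1 : {for 0, continuous (fun s : R => 1 + s)}.
  by apply: continuousD; [exact: cst_continuous|exact: cvg_id].
have c2 : {for 0, continuous (fun s : R => (1 - s)^-1)}.
  apply: continuousV; first by rewrite subr0 oner_eq0.
  by apply: continuousB; [exact: cst_continuous|exact: cvg_id].
have cX (f : R -> R) : {for 0, continuous f} -> {for 0, continuous (fun s => f s ^+ n)}.
  move=> cf; apply: (@continuous_comp _ _ _ f (fun x : R => x ^+ n)) => //.
  exact: exprn_continuous.
apply/eqP; rewrite eq_le; apply/andP; split.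
- apply: (@le_lim_scale _ _ _ (fun s => (1 + s) ^+ n * (1 - s)^-1) 1) => //.
  + by apply: continuousM => //; exact: cX.
  + by rewrite addr0 subr0 expr1n invr1 mulr1.
  move=> s /[dup] s01 /andP[s0 s1].
  have s1' : 0 < 1 - s by rewrite subr_gt0.
  have k0 : 0 <= (1 + s) ^+ n * (1 - s)^-1.
    by rewrite mulr_ge0 ?invr_ge0 ?(ltW s1')// exprn_ge0// addr_ge0// ltW.
  have [m m_E] := scale _ m2 k0; rewrite -m_E.
  move: A mA AE; apply: le_measure_local => x Ex.
  have [d1 d10 h1] := jacobian_local Ex s01.
  have [d2 d20 h2] := jac_close _ _ Ex s01.
  exists (Num.min d1 d2) => [|B mB BE Bd]; first by rewrite lt_min d10.
  rewrite m1F// m_E; have [|h3 _] := h1 _ mB BE.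
    by move=> y /Bd; rewrite lt_min => /andP[].
  apply: (le_trans h3); rewrite !EFinM -!muleA.
  apply: lee_wpmul2l; first by rewrite lee_fin exprn_ge0// addr_ge0// ltW.
  rewrite lee_pdivlMl// muleA -EFinM; apply: lb => //.
    by rewrite mulr_ge0// ltW.
  by move=> y /Bd; rewrite lt_min => /andP[_ /h2/andP[]].
- apply: (@le_lim_scale _ _ _ (fun s => (1 + s) * (1 - s)^-1 ^+ n) 1) => //.
  + by apply: continuousM => //; exact: cX.
  + by rewrite addr0 subr0 invr1 expr1n mulr1.
  move=> s /[dup] s01 /andP[s0 s1].
  have s1' : 0 < 1 - s by rewrite subr_gt0.
  have k0 : 0 <= (1 + s) * (1 - s)^-1 ^+ n.
    by rewrite mulr_ge0 ?addr_ge0 ?(ltW s0)// exprn_ge0// invr_ge0 ltW.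
  have [m m_E] := scale _ m1 k0; rewrite -m_E.
  move: A mA AE; apply: le_measure_local => x Ex.
  have [d1 d10 h1] := jacobian_local Ex s01.
  have [d2 d20 h2] := jac_close _ _ Ex s01.
  exists (Num.min d1 d2) => [|B mB BE Bd]; first by rewrite lt_min d10.
  rewrite m_E m1F//; have [|_ h3] := h1 _ mB BE.
    by move=> y /Bd; rewrite lt_min => /andP[].
  have jx := jac_gt0 Ex.
  apply: (@le_trans _ _ (((1 + s) * jac x)%:E * lam B)%E).
    apply: ub => //; first by rewrite mulr_ge0// ?(ltW jx)// addr_ge0// ltW.
    by move=> y /Bd; rewrite lt_min => /andP[_ /h2/andP[]].
  rewrite !EFinM -!muleA; apply: lee_wpmul2l.
    by rewrite lee_fin addr_ge0// ltW.
  rewrite -lee_pdivlMl//; apply: (le_trans h3).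
  by rewrite mulrC EFinM -muleA.
Qed.

End formula.

End change_of_variables.

Section sigma_finite_copy.
Context d (T : measurableType d) (R : realType).
Variables (mu : {measure set T -> \bar R}) (sf : sigma_finite setT mu).

(** An alias to which the sigma-finite structure can be attached, [mu] being declared as a mere
    measure. *)
Definition sigma_finite_copy : set T -> \bar R := mu.

HB.instance Definition _ := Measure.copy sigma_finite_copy mu.

HB.instance Definition _ :=
  Measure_isSigmaFinite.Build _ _ _ sigma_finite_copy sf.

Lemma sigma_finite_measure_of :
  exists nu : {sigma_finite_measure set T -> \bar R}, nu = mu :> (set T -> \bar R).
Proof. by exists sigma_finite_copy. Qed.

End sigma_finite_copy.

Lemma fubini_tonelli_rectangle d1 d2 (T1 : measurableType d1)
    (T2 : measurableType d2) (R : realType) (m1 : {measure set T1 -> \bar R})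
    (m2 : {sigma_finite_measure set T2 -> \bar R}) (b : set T1) (I : set T2)
    (f : T1 * T2 -> \bar R) : sigma_finite setT m1 ->
  measurable b -> measurable I -> measurable_fun (b `*` I) f ->
  (forall p, (b `*` I) p -> (0 <= f p)%E) ->
  (\int[m1 \x m2]_(p in b `*` I) f p = \int[m1]_(y in b) \int[m2]_(t in I) f (y, t))%E.
Proof.
move=> /sigma_finite_measure_of[m m1E] mb mI mf f0.
have mbI : measurable (b `*` I) by exact: measurableX.
have mfb : measurable_fun setT (f \_ (b `*` I)) by exact/(measurable_restrictT _ mbI).
have fb0 p : (0 <= (f \_ (b `*` I)) p)%E.
  by rewrite /patch; case: ifPn => //; rewrite inE => /f0.
rewrite [LHS]integral_mkcond [RHS]integral_mkcond.
rewrite (eq_measure_integral (m \x m2)%E); last first.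
  by move=> A mA _; rewrite /= /product_measure1 m1E.
rewrite -[X in _ = integral X _ _]m1E.
rewrite fubini_tonelli1//; apply: eq_integral => y _.
rewrite /fubini_F /= /patch; case: ifPn => yb.
  rewrite [RHS]integral_mkcond; apply: eq_integral => t _; rewrite /patch.
  by rewrite in_setX /= yb.
rewrite integral0_eq// => t _.
by rewrite in_setX /= (negbTE yb).
Qed.

(** * Lebesgue measure as a product, and Fubini *)

Section lebesgue_row_product.
Context {R : realType} {d : nat}.
Local Notation RT := (measurableTypeR R).
Local Notation lam n := (lebesgue_row n : {measure set (borel R n) -> \bar R}).

Definition row_snoc (p : borel R d * RT) : borel R (d + 1) :=
  row_mx (p.1 : 'rV[R]_d) (p.2 : R)%:M.

Lemma row_snoc_lshift p i : (row_snoc p : 'rV[R]_(d + 1)) 0 (lshift 1 i) = (p.1 : 'rV[R]_d) 0 i.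
Proof. by rewrite row_mxEl. Qed.

Lemma row_snoc_rshift p i : (row_snoc p : 'rV[R]_(d + 1)) 0 (rshift d i) = p.2.
Proof. by rewrite row_mxEr ord1 mxE eqxx. Qed.

(** The map is factored through tuples, where measurability can be checked coordinate by
    coordinate. *)
Lemma measurable_row_snoc : measurable_fun setT row_snoc.
Proof.
pose tup (p : borel R d * RT) : (d + 1).-tuple RT :=
  [tuple (row_snoc p : 'rV[R]_(d + 1)) 0 i | i < d + 1].
have -> : row_snoc = @row_of_tuple R (d + 1) \o tup.
  by apply/funext => p; apply/rowP => i; rewrite [RHS]mxE tnth_mktuple.
apply: measurableT_comp; first exact: measurable_row_of_tuple.
apply/measurable_fun_tnthP => i.
case: (split_ordP i) => j ->.
  rewrite (_ : _ \o _ = (fun x : 'rV[R]_d => x 0 j) \o fst).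
    exact: (measurableT_comp (measurable_coord j) measurable_fst).
  by apply/funext => p; rewrite /= tnth_mktuple row_snoc_lshift.
rewrite (_ : _ \o _ = snd) //.
by apply/funext => p; rewrite /= tnth_mktuple row_snoc_rshift.
Qed.

Lemma lebesgue_row_sigma_finite : sigma_finite setT (lam d).
Proof.
exists (fun k => [set x : 'rV[R]_d | `|x| < k%:R]).
  apply/esym/seteqP; split => // x _; exists (Num.bound `|(x : 'rV[R]_d)|) => //.
  by rewrite /= archi_boundP.
move=> k; split; first by apply: borel_open; exact: open_norm_ball.
exact: lebesgue_row_norm_ball.
Qed.

(** Both measures are finite on balls and take the same value on dyadic cubes, so the comparison of
    Borel measures applies in both directions. *)
Lemma lebesgue_row_snoc (A : set (borel R (d + 1))) : measurable A ->
  lam (d + 1) A = pushforward (lam d \x lebesgue_measure)%E row_snoc A.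
Proof.
have [P PE] := image_measure (lam d \x lebesgue_measure)%E measurableT measurable_row_snoc.
have PE' B : P B = ((lam d \x lebesgue_measure) (row_snoc @^-1` B))%E by rewrite PE setTI.
move=> mA; rewrite /pushforward -PE'.
have cubeE k z : P (cube k z) = lam (d + 1) (cube k z).
  rewrite PE' lebesgue_row_cube.
  pose I := `[(z 0 (rshift d 0))%:~R / 2 ^+ k, (z 0 (rshift d 0) + 1)%:~R / 2 ^+ k[%classic : set R.
  rewrite (_ : _ @^-1` _ = cube k (lsubmx z) `*` I).
    rewrite product_measure1E; [|exact: measurable_cube|exact: measurable_itv].
    have IE : (lebesgue_measure I = (2 ^- k)%:E)%E.
      apply: etrans (lebesgue_measure_itv _) _.
      rewrite /= lte_fin ltr_pM2r ?invr_gt0 ?exprn_gt0// ltr_int ltrDl ltr01.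
      by rewrite -EFinB -mulrBl intrD addrAC subrr add0r mul1r.
    rewrite lebesgue_row_cube [X in (_ * X)%E](_ : _ = (2 ^- k)%:E)//.
    by rewrite -EFinM addn1 exprSr.
  apply/seteqP; split => -[y t] /= h.
    split => [i|]; first by have := h (lshift 1 i); rewrite row_snoc_lshift !mxE.
    have := h (rshift d 0); rewrite row_snoc_rshift /I /= in_itv /=.
    by rewrite -ler_pdivrMr ?exprn_gt0// -ltr_pdivlMr ?exprn_gt0.
  case: h => h1; rewrite /I /= in_itv /= => h2 i; case: (split_ordP i) => j ->.
    by have := h1 j; rewrite row_snoc_lshift !mxE.
  rewrite row_snoc_rshift ord1.
  by rewrite -ler_pdivrMr ?exprn_gt0// -ltr_pdivlMr ?exprn_gt0.
apply/eqP; rewrite eq_le; apply/andP; split; apply: le_measure_borel => //.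
- move=> r; rewrite PE'.
  have [r0|r0] := leP r 0.
    rewrite (_ : _ @^-1` _ = set0) ?measure0//; apply/seteqP; split => // x /= xr.
    by have := lt_le_trans xr r0; rewrite normr_lt0.
  pose D := [set x : 'rV[R]_d | `|x| < r].
  pose I := `]- r, r[%classic : set R.
  have mD : measurable (D : set (borel R d)) by apply: borel_open; exact: open_norm_ball.
  have mrD : measurable (row_snoc @^-1` [set x : 'rV[R]_(d + 1) | `|x| < r]).
    rewrite -[X in measurable X]setTI; apply: measurable_row_snoc => //.
    by apply: borel_open; exact: open_norm_ball.
  apply: (@le_lt_trans _ _ ((lam d \x lebesgue_measure) (D `*` I))%E).
    apply: le_measure; rewrite ?inE//.
      by apply: measurableX => //; exact: measurable_itv.
    move=> -[y t] /= ytr; split => /=.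
      apply: row_norm_lt => // i; apply: le_lt_trans ytr.
      by rewrite -(row_snoc_lshift (y, t) i); exact: ler_coord_norm.
    rewrite /I /= in_itv /= -ltr_norml; apply: le_lt_trans ytr.
    have := ler_coord_norm (row_snoc (y, t) : 'rV[R]_(d + 1)) (rshift d 0).
    by rewrite row_snoc_rshift.
  rewrite product_measure1E//; last exact: measurable_itv.
  rewrite lte_mul_pinfty//.
    by rewrite ge0_fin_numE//; exact: lebesgue_row_norm_ball.
  rewrite [X in (X < _)%E](_ : _ = (r + r)%:E) ?ltry//.
  apply: etrans (lebesgue_measure_itv _) _.
  by rewrite /= lte_fin gtrN// -EFinB opprK.
- by move=> k z; rewrite cubeE.
- exact: lebesgue_row_norm_ball.
- by move=> k z; rewrite cubeE.
Qed.

Lemma lebesgue_row_fubini (D : set (borel R (d + 1))) (b : set (borel R d))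
    (I : set RT) (f : borel R (d + 1) -> \bar R) :
  measurable D -> measurable b -> measurable I -> row_snoc @^-1` D = b `*` I ->
  measurable_fun D f -> (forall x, D x -> (0 <= f x)%E) ->
  (\int[lam (d + 1)]_(x in D) f x =
   \int[lam d]_(y in b) \int[lebesgue_measure]_(t in I) f (row_snoc (y, t)))%E.
Proof.
move=> mD mb mI Db mf f0.
pose P : {measure set (borel R (d + 1)) -> \bar R} :=
  measure_function_pushforward__canonical__measure_function_Measure
    (lam d \x lebesgue_measure)%E measurable_row_snoc.
rewrite (eq_measure_integral P); last by move=> A mA _; exact: lebesgue_row_snoc.
rewrite (ge0_integral_pushforward measurable_row_snoc)//; last first.
  by move=> x; rewrite inE; exact: f0.
rewrite Db; apply: fubini_tonelli_rectangle => //.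
- exact: lebesgue_row_sigma_finite.
- rewrite -Db; apply: (measurable_comp mD) => //; last exact: measurable_funTS measurable_row_snoc.
  exact: image_preimage_subset.
- by move=> p; rewrite -Db => /f0.
Qed.

End lebesgue_row_product.

(** * Linear algebra *)

Section dot_product.
Context {R : realType} {n : nat}.
Implicit Types (u v w : 'rV[R]_n) (M : 'M[R]_n).

Lemma dotvE u v : dotv u v = \sum_i u 0 i * v 0 i.
Proof. by rewrite /dotv mxE; apply: eq_bigr => i _; rewrite mxE. Qed.

Lemma dotvC u v : dotv u v = dotv v u.
Proof. by rewrite !dotvE; apply: eq_bigr => i _; rewrite mulrC. Qed.

Lemma dotvDl u v w : dotv (u + v) w = dotv u w + dotv v w.
Proof. by rewrite /dotv mulmxDl mxE. Qed.

Lemma dotvZl a u v : dotv (a *: u) v = a * dotv u v.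
Proof. by rewrite /dotv -scalemxAl mxE. Qed.

Lemma dotvDr u v w : dotv u (v + w) = dotv u v + dotv u w.
Proof. by rewrite ![dotv u _]dotvC dotvDl. Qed.

Lemma dotvZr a u v : dotv u (a *: v) = a * dotv u v.
Proof. by rewrite ![dotv u _]dotvC dotvZl. Qed.

Lemma dotvNl u v : dotv (- u) v = - dotv u v.
Proof. by rewrite -scaleN1r dotvZl mulN1r. Qed.

Lemma dotvNr u v : dotv u (- v) = - dotv u v.
Proof. by rewrite ![dotv u _]dotvC dotvNl. Qed.

Lemma dotvBl u v w : dotv (u - v) w = dotv u w - dotv v w.
Proof. by rewrite dotvDl dotvNl. Qed.

Lemma dotvBr u v w : dotv u (v - w) = dotv u v - dotv u w.
Proof. by rewrite dotvDr dotvNr. Qed.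

Lemma dotv0l u : dotv 0 u = 0.
Proof. by rewrite -(scale0r 0) dotvZl mul0r. Qed.

Lemma dotv0r u : dotv u 0 = 0.
Proof. by rewrite dotvC dotv0l. Qed.

Lemma dotv_delta u i : dotv (delta_mx 0 i) u = u 0 i.
Proof. by rewrite /dotv -rowE !mxE. Qed.

Lemma dotv_mulmxr u v M : dotv u (v *m M) = dotv (u *m M^T) v.
Proof. by rewrite /dotv trmx_mul mulmxA. Qed.

Lemma dotvv_gt0 u : u != 0 -> 0 < dotv u u.
Proof.
move=> u0; rewrite dotvE; have [i ui] : exists i, u 0 i != 0.
  by move/rV0Pn : u0.
rewrite (bigD1 i)//= ltr_pwDl//; first by rewrite -expr2 exprn_even_gt0.
by rewrite sumr_ge0// => j _; rewrite -expr2 sqr_ge0.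
Qed.

Lemma dotv_norm u v : `|dotv u v| <= n%:R * `|u| * `|v|.
Proof.
rewrite dotvE; apply: le_trans (ler_norm_sum _ _ _) _.
rewrite -mulrA mulr_natl -[X in _ *+ X]card_ord -sumr_const; apply: ler_sum => i _.
by rewrite normrM ler_pM// ler_coord_norm.
Qed.

Lemma unitmx_inj M : (forall u, u *m M = 0 -> u = 0) -> M \in unitmx.
Proof.
move=> h; rewrite -row_free_unit -kermx_eq0; apply/rowV0P => u /sub_kermxP.
exact: h.
Qed.

Lemma unitmx_mulmx0 M u : M \in unitmx -> u *m M = 0 -> u = 0.
Proof. by move=> uM uM0; rewrite -(mulmxK uM u) uM0 mul0mx. Qed.

End dot_product.

(** * Pairs of positive definite matrices and symmetric functions of eigenvalues *)

Section positive_definite.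
Context {R : realType} {n : nat}.
Implicit Types (u v : 'rV[R]_n) (H J S : 'M[R]_n).

Definition pos_def H :=
  H^T = H /\ forall u, u != 0 -> 0 < dotv (u *m H) u.

Lemma sym_dotv H u v : H^T = H -> dotv (u *m H) v = dotv (v *m H) u.
Proof. by move=> sH; rewrite dotvC dotv_mulmxr sH. Qed.

Lemma pos_def_semi H : H^T = H -> (forall u, 0 <= dotv (u *m H) u) ->
  H \in unitmx -> pos_def H.
Proof.
move=> sH H0 uH; split => // u u0; rewrite lt_neqAle H0 andbT eq_sym.
apply/eqP => uHu0; set v := u *m H; set b := dotv (v *m H) v.
have v0 : v != 0 by apply: contra_neq u0; exact: unitmx_mulmx0.
have a0 := dotvv_gt0 v0; set a := dotv v v in a0.
(* If the form vanished at u, its value at t u + v would be 2 t a + b, affine in t; this t makes it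
   -1. *)
pose t := - (b + 1) / (2 * a).
have := H0 (t *: u + v).
rewrite mulmxDl -scalemxAl !dotvDl !dotvDr !dotvZl !dotvZr uHu0 (sym_dotv v u sH).
rewrite -/v -/a -/b !mulr0 add0r addrA -mulrDl -mulr2n.
have -> : t *+ 2 * a = - (b + 1).
  by rewrite /t mulr2n; field; rewrite gt_eqF.
lra.
Qed.

Lemma pos_def_unit H : pos_def H -> H \in unitmx.
Proof.
move=> [_ H0]; apply: unitmx_inj => u uH0; apply/eqP/contraT => /H0.
by rewrite uH0 dotv0l ltxx.
Qed.

(** For an eigenvector v of [S] with eigenvalue k, v H = k (v J), so k is the quotient of two
    positive values of quadratic forms. *)
Lemma pos_def_root H J S k : pos_def H -> pos_def J -> H = S *m J ->
  root (char_poly S) k -> 0 < k.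
Proof.
move=> [_ H0] [_ J0] HE; rewrite -eigenvalue_root_char => /eigenvalueP[v vS v0].
have := H0 _ v0; rewrite HE mulmxA vS -scalemxAl dotvZl pmulr_lgt0//.
exact: J0.
Qed.

Lemma char_poly_horner S x : (char_poly S).[x] = \det (x%:M - S).
Proof.
rewrite -[LHS]/(horner_eval x _) -det_map_mx; congr determinant.
apply/matrixP => i j; rewrite mxE /char_poly_mx !mxE /= /horner_eval.
by rewrite hornerD hornerN hornerMn hornerX hornerC.
Qed.

Import complex.

Let toC : R -> complex R := real_complex R.

Let Re_mulmx (v : 'rV[complex R]_n) S j :
  Re ((v *m map_mx toC S) 0 j) = (map_mx (@Re R) v *m S) 0 j.
Proof.
rewrite !mxE (big_morph (@Re R) (id1 := 0) (op1 := +%R)) //.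
  by apply: eq_bigr => i _; rewrite !mxE; case: (v 0 i) => a b /=; rewrite mulr0 subr0.
by move=> [a b] [c e].
Qed.

Let Im_mulmx (v : 'rV[complex R]_n) S j :
  Im ((v *m map_mx toC S) 0 j) = (map_mx (@Im R) v *m S) 0 j.
Proof.
rewrite !mxE (big_morph (@Im R) (id1 := 0) (op1 := +%R)) //.
  by apply: eq_bigr => i _; rewrite !mxE; case: (v 0 i) => a b /=; rewrite mulr0 add0r.
by move=> [a b] [c e].
Qed.

(* For a complex eigenvector [a + i b] of [S] with eigenvalue [x + i y],
   [a H = (x a - y b) J] and [b H = (x b + y a) J]; pairing with [b] and [a],
   the symmetry of [H] and [J] gives [y (a J a + b J b) = 0]. *)
Lemma pos_def_char_poly_split H J S : pos_def H -> pos_def J -> H = S *m J ->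
  exists k : {ffun 'I_n -> R}, char_poly S = \prod_(j < n) ('X - (k j)%:P).
Proof.
move=> [sH H0] [sJ J0] HE.
have [r pE] := closed_field_poly_normal (char_poly (map_mx toC S)).
move: pE; rewrite (monicP (char_poly_monic _)) scale1r => pE.
have rreal z : z \in r -> z = toC (Re z).
  rewrite -root_prod_XsubC -pE -eigenvalue_root_char => /eigenvalueP[v vS v0].
  move: z vS => [x y] vS /=; suff -> : y = 0 by [].
  pose a := map_mx (@Re R) v; pose b := map_mx (@Im R) v.
  have aS : a *m S = x *: a - y *: b.
    by apply/rowP => j; rewrite -Re_mulmx vS !mxE; case: (v 0 j).
  have bS : b *m S = x *: b + y *: a.
    by apply/rowP => j; rewrite -Im_mulmx vS !mxE; case: (v 0 j).
  have := sym_dotv a b sH.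
  rewrite HE !mulmxA aS bS !(mulmxDl, mulmxBl) mulNmx -!scalemxAl.
  rewrite !(dotvDl, dotvNl, dotvZl) (sym_dotv b a sJ).
  move/eqP; rewrite -subr_eq0 opprD addrACA subrr add0r -opprD oppr_eq0 -mulrDr mulf_eq0.
  case/orP => [/eqP//|/eqP ab0].
  have J0' u : 0 <= dotv (u *m J) u.
    by have [->|/J0/ltW//] := eqVneq u 0; rewrite dotv0r.
  have a0 : a = 0.
    apply/eqP/contraT => /J0 h; have := J0' b; lra.
  have b0 : b = 0.
    apply/eqP/contraT => /J0 h; have := J0' a; lra.
  case/eqP : v0; apply/rowP => j; rewrite mxE.
  have := congr1 (fun u : 'rV[R]_n => u 0 j) a0; have := congr1 (fun u : 'rV[R]_n => u 0 j) b0.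
  by rewrite !mxE; case: (v 0 j) => /= ? ? -> ->.
pose s := map (@Re R) r.
have sE : char_poly S = \prod_(x <- s) ('X - x%:P).
  apply: (@map_poly_inj _ _ (real_complex R)); rewrite map_char_poly.
  rewrite -[map_mx _ S]/(map_mx toC S) pE rmorph_prod big_map.
  rewrite [LHS]big_seq [RHS]big_seq; apply: eq_bigr => z /rreal zE.
  by rewrite rmorphB /= map_polyX map_polyC {1}zE.
have size_s : size s = n.
  by apply: succn_inj; rewrite -(size_char_poly S) sE size_prod_XsubC.
exists [ffun j : 'I_n => s`_j]; rewrite sE (big_nth 0) size_s big_mkord.
by apply: eq_bigr => j _; rewrite ffunE.
Qed.

Lemma det_add_scale H J S (k : 'I_n -> R) t : H = S *m J -> J \in unitmx ->
  char_poly S = \prod_(j < n) ('X - (k j)%:P) -> (forall j, k j != 0) ->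
  \det (J + t *: H) = \det H * \prod_(j < n) ((k j)^-1 + t).
Proof.
move=> HE uJ SE k0.
have hE x : \det (x%:M - S) = \prod_(j < n) (x - k j).
  rewrite -char_poly_horner SE horner_prod; apply: eq_bigr => j _.
  by rewrite !hornerE.
have detS : \det S = \prod_(j < n) k j.
  have := hE 0; rewrite raddf0 sub0r -scaleN1r detZ.
  rewrite (eq_bigr (fun j => - 1 * k j)) => [|j _]; last by rewrite sub0r mulN1r.
  rewrite big_split /= prodr_const card_ord => /mulfI; apply.
  by rewrite signr_eq0.
have det1 : \det (1%:M + t *: S) = \prod_(j < n) (1 + t * k j).
  (* The general case evaluates the characteristic polynomial at -1/t, so t = 0 is treated apart. *)
  have [->|t0] := eqVneq t 0.
    by rewrite scale0r addr0 det1 big1// => j _; rewrite mul0r addr0.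
  have -> : 1%:M + t *: S = - t *: ((- t^-1)%:M - S).
    rewrite scalerBr scale_scalar_mx mulrN mulNr opprK divff//.
    by rewrite scaleNr opprK.
  rewrite detZ hE -[X in _ ^+ X]card_ord -prodr_const -big_split /=.
  by apply: eq_bigr => j _; field.
have -> : J + t *: H = (1%:M + t *: S) *m J by rewrite mulmxDl mul1mx HE scalemxAl.
rewrite HE !det_mulmx det1 detS mulrAC -big_split /=; congr (_ * _).
by apply: eq_bigr => j _; field.
Qed.

Lemma prod_add_expand (r : 'I_n -> R) t : \prod_(j < n) (r j + t) =
  \sum_(i < n.+1) t ^+ (n - i) *
    \sum_(J : {set 'I_n} | #|J| == i) \prod_(j in J) r j.
Proof.
rewrite (@bigA_distr _ _ _ _ +%R).
rewrite (partition_big (fun J : {set 'I_n} => inord #|J| : 'I_n.+1) xpredT)//=.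
apply: eq_bigr => i _; rewrite mulr_sumr; apply: eq_big => J.
  have Jn : (#|J| < n.+1)%N by rewrite ltnS -[X in (_ <= X)%N]card_ord max_card.
  by rewrite -(inj_eq val_inj) /= inordK.
have Jn : (#|J| < n.+1)%N by rewrite ltnS -[X in (_ <= X)%N]card_ord max_card.
move=> /eqP Ji; have {}Ji : #|J| = i by rewrite -Ji inordK.
rewrite (bigID (mem J))/= mulrC; congr (_ * _).
  rewrite (eq_bigr (fun=> t)); last by move=> j /negbTE ->.
  rewrite prodr_const; congr (_ ^+ _).
  apply: (@addnI i); rewrite subnKC; last by rewrite -ltnS.
  by rewrite -{1}Ji cardC card_ord.
by apply: eq_bigr => j ->.
Qed.

(** The nodes are 1, ..., n + 1, without 0, because the Steiner formula is available for positive
    parameters. *)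
Lemma vandermonde_inverse : exists c : 'I_n.+1 -> 'I_n.+1 -> R,
  forall (a : 'I_n.+1 -> R) i,
    a i = \sum_k c i k * \sum_(j < n.+1) a j * k.+1%:R ^+ j.
Proof.
pose x : 'rV[R]_n.+1 := \row_k k.+1%:R.
pose W : 'M[R]_n.+1 := Vandermonde n.+1 x.
have uW : W \in unitmx.
  rewrite unitmxE unitfE det_Vandermonde; apply/prodf_neq0 => i _.
  apply/prodf_neq0 => j ij; rewrite !mxE subr_eq0 eqr_nat eqSS.
  by rewrite gtn_eqF.
exists (fun i k => invmx W k i) => a i.
have := congr1 (fun M : 'rV[R]_n.+1 => M 0 i) (mulmxK uW (\row_j a j)).
rewrite !mxE => <-; apply: eq_bigr => k _; rewrite mulrC; congr (_ * _).
by rewrite !mxE; apply: eq_bigr => j _; rewrite !mxE.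
Qed.

End positive_definite.

(** * Strict differentiability *)

Section one_variable.
Context {R : realType}.

Lemma is_derive_epsP (W : normedModType R) (phi : R -> W) (s : R) (D : W) :
  is_derive s (1 : R) phi D <-> forall e : R, 0 < e -> exists2 d : R, 0 < d &
    forall k, `|k| < d -> `|phi (s + k) - phi s - k *: D| <= e * `|k|.
Proof.
split=> [hphi e e0|h].
  have /cvgrPdist_le/(_ _ e0) : h^-1 *: ((phi \o shift s) (h *: 1) - phi s) @[h --> 0^'] --> D.
    have -> : D = 'D_1 phi s by rewrite derive_val.
    exact: ex_derive.
  rewrite near_withinE -nbhs_nearE -nbhs_ballE => -[d /= d0 hd].
  exists d => // k kd; have [->|k0] := eqVneq k 0.
    by rewrite addr0 subrr scale0r subrr !normr0 mulr0.
  have := hd k; rewrite /ball /= sub0r normrN => /(_ kd k0).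
  rewrite /shift /= [k *: 1]mulr1 (addrC k) distrC => hk.
  rewrite -[X in `|X|](scalerKV k0) scalerBr scalerA mulVf// scale1r normrZ mulrC.
  by rewrite ler_pM2r ?normr_gt0.
suff lim : h^-1 *: ((phi \o shift s) (h *: 1) - phi s) @[h --> 0^'] --> D.
  by split; [exact: cvgP lim|exact: cvg_lim lim].
apply/cvgrPdist_le => e e0; rewrite near_withinE -nbhs_nearE -nbhs_ballE.
have [d d0 hd] := h e e0; exists d => //= k.
rewrite /ball /= sub0r normrN => kd k0.
rewrite /shift /= [k *: 1]mulr1 (addrC k) distrC.
rewrite -[X in _ - X](scalerK k0) -scalerBr normrZ normfV ler_pdivrMl ?normr_gt0//.
by rewrite mulrC; exact: hd.
Qed.

Lemma is_derive_line (V W : normedModType R) (f : V -> W) (z v : V) (s : R) :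
  derivable f (z + s *: v) v ->
  is_derive s (1 : R) (fun r => f (z + r *: v)) ('D_v f (z + s *: v)).
Proof.
have E : (fun h : R => h^-1 *: (((fun r => f (z + r *: v)) \o shift s) (h *: 1) - f (z + s *: v)))
    = (fun h => h^-1 *: ((f \o shift (z + s *: v)) (h *: v) - f (z + s *: v))).
  apply/funext => h /=; rewrite /shift /= [h *: 1]mulr1 scalerDl.
  by rewrite addrCA.
by move=> df; split; rewrite /derivable /derive E.
Qed.

Lemma mean_value_bound (phi dphi : R -> R) (a b D e : R) :
  (forall x, Num.min a b <= x <= Num.max a b -> is_derive x (1 : R) phi (dphi x)) ->
  (forall x, Num.min a b <= x <= Num.max a b -> `|dphi x - D| <= e) ->
  `|phi b - phi a - D * (b - a)| <= e * `|b - a|.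
Proof.
wlog ab : a b / a <= b => [th|].
  move=> h1 h2; have [ab|] := boolP (a <= b); first exact: th.
  rewrite -ltNge => /ltW ba.
  have := th b a ba; rewrite minC maxC => /(_ h1 h2) {th}.
  have -> : phi b - phi a - D * (b - a) = - (phi a - phi b - D * (a - b)) by ring.
  by rewrite normrN (distrC b a).
rewrite min_l// max_r// => h1 h2.
have [||x /itvP xab ->] := MVT_segment ab (f := phi) (df := dphi).
- by move=> x /itvP xab; apply: h1; rewrite !xab.
- apply: derivable_within_continuous => x /itvP xab.
  by have := h1 x; rewrite !xab => /(_ isT)[].
rewrite -mulrBl normrM; apply: ler_wpM2r => //; apply: h2.
by rewrite !xab.
Qed.

End one_variable.

(** * Rules of strict differentiation and symmetry of second derivatives *)

Section scalar_strict_differentiability.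
Context {R : realType}.

Definition sdiff1 m (f : 'rV[R]_m -> R) (x g : 'rV[R]_m) :=
  forall e : R, 0 < e -> exists2 d : R, 0 < d & forall u v,
    `|u - x| < d -> `|v - x| < d -> `|f u - f v - dotv (u - v) g| <= e * `|u - v|.

Lemma sdiff_coord m n (F : 'rV[R]_m -> 'rV[R]_n) x L :
  sdiff F x L <-> forall j, sdiff1 (fun u => F u 0 j) x (col j L)^T.
Proof.
have E u v j : F u 0 j - F v 0 j - dotv (u - v) (col j L)^T =
    (F u - F v - (u - v) *m L) 0 j.
  rewrite dotvE !mxE; congr (_ - _); apply: eq_bigr => i _.
  by rewrite !mxE.
split=> [sF j e e0|h e e0].
  have [d d0 hd] := sF e e0; exists d => // u v ud vd.
  by rewrite E; apply: le_trans (ler_coord_norm _ _) (hd _ _ ud vd).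
have /choice[d hd] j : exists d : R, 0 < d /\ forall u v : 'rV[R]_m,
    `|u - x| < d -> `|v - x| < d -> `|(F u - F v - (u - v) *m L) 0 j| <= e * `|u - v|.
  have [d d0 hd] := h j e e0; exists d; split => // u v ud vd.
  by rewrite -E; exact: hd.
exists (\big[Num.min/1]_j d j) => [|u v].
  by apply: lt_bigmin => // j _; have [] := hd j.
move=> /bigmin_gtP[_ ud] /bigmin_gtP[_ vd]; apply: row_norm_le => [|j].
  by rewrite mulr_ge0// ltW.
by have [_] := hd j; apply; [exact: ud|exact: vd].
Qed.

Lemma sdiff1_sdiff m (f : 'rV[R]_m -> R) x g :
  sdiff1 f x g <-> sdiff (fun u => (f u)%:M : 'rV[R]_1) x g^T.
Proof.
have E : (fun u => ((f u)%:M : 'rV[R]_1) 0 0) = f.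
  by apply/funext => u; rewrite mxE.
have E' : (col 0 g^T)^T = g by apply/rowP => i; rewrite !mxE.
split=> [sf|/sdiff_coord/(_ 0)]; last by rewrite E E'.
by apply/sdiff_coord => j; rewrite ord1 E E'.
Qed.

Lemma sdiff1_continuous m (f : 'rV[R]_m -> R) x g :
  sdiff1 f x g -> {for x, continuous f}.
Proof.
move=> /sdiff1_sdiff/sdiff_continuous/row_continuousP h.
apply/row_continuousP => e e0; have [d d0 hd] := h e e0; exists d => // u /hd.
apply: le_lt_trans; rewrite -raddfB /=.
by have := ler_coord_norm ((f u - f x)%:M : 'rV[R]_1) 0; rewrite mxE.
Qed.

Lemma sdiff1_cst m (c : R) (x : 'rV[R]_m) : sdiff1 (fun=> c) x 0.
Proof.
move=> e e0; exists 1 => // u v _ _.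
by rewrite subrr dotv0r subrr normr0 mulr_ge0// ltW.
Qed.

Lemma sdiff1_dotv m (g x : 'rV[R]_m) : sdiff1 (fun u => dotv u g) x g.
Proof.
move=> e e0; exists 1 => // u v _ _.
by rewrite dotvBl subrr normr0 mulr_ge0// ltW.
Qed.

Lemma sdiff1_eq m (f : 'rV[R]_m -> R) x g g' : g = g' -> sdiff1 f x g -> sdiff1 f x g'.
Proof. by move=> ->. Qed.

Lemma sdiff1_near m (f f' : 'rV[R]_m -> R) (x g : 'rV[R]_m) (r : R) : 0 < r ->
  (forall u, `|u - x| < r -> f u = f' u) -> sdiff1 f x g -> sdiff1 f' x g.
Proof.
move=> r0 ff sf e e0; have [d d0 hd] := sf e e0.
exists (Num.min d r) => [|u v]; first by rewrite lt_min d0.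
rewrite !lt_min => /andP[ud ur] /andP[vd vr].
by rewrite -!ff//; exact: hd.
Qed.

Lemma sdiff1D m (f h : 'rV[R]_m -> R) x g k : sdiff1 f x g -> sdiff1 h x k ->
  sdiff1 (fun u => f u + h u) x (g + k).
Proof.
move=> sf sh e e0; have e2 : 0 < e / 2 by rewrite divr_gt0.
have [d1 d10 h1] := sf _ e2; have [d2 d20 h2] := sh _ e2.
exists (Num.min d1 d2) => [|u v]; first by rewrite lt_min d10.
rewrite !lt_min => /andP[u1 u2] /andP[v1 v2].
rewrite dotvDr (_ : _ - _ = (f u - f v - dotv (u - v) g) +
  (h u - h v - dotv (u - v) k)); last by ring.
apply: le_trans (ler_normD _ _) _; rewrite [e]splitr mulrDl.
by apply: lerD; [exact: h1|exact: h2].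
Qed.

Lemma sdiff1Z m (c : R) (f : 'rV[R]_m -> R) x g : sdiff1 f x g ->
  sdiff1 (fun u => c * f u) x (c *: g).
Proof.
move=> sf e e0; have e2 : 0 < e / (1 + `|c|) by rewrite divr_gt0// ltr_pwDl.
have [d d0 h] := sf _ e2; exists d => // u v ud vd.
rewrite dotvZr -!mulrBr normrM.
apply: (@le_trans _ _ ((1 + `|c|) * `|f u - f v - dotv (u - v) g|)).
  by rewrite ler_wpM2r// lerDr.
rewrite -ler_pdivlMl ?ltr_pwDl// mulrA [_^-1 * _]mulrC.
exact: h.
Qed.

Lemma sdiff1N m (f : 'rV[R]_m -> R) x g : sdiff1 f x g ->
  sdiff1 (fun u => - f u) x (- g).
Proof.
move=> /(sdiff1Z (-1)); rewrite scaleN1r; apply: sdiff1_near ltr01 _ => u _.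
by rewrite mulN1r.
Qed.

Lemma sdiff1B m (f h : 'rV[R]_m -> R) x g k : sdiff1 f x g -> sdiff1 h x k ->
  sdiff1 (fun u => f u - h u) x (g - k).
Proof. by move=> sf /sdiff1N; exact: sdiff1D. Qed.

Lemma sdiff1_sum m (I : finType) (f : I -> 'rV[R]_m -> R) x g :
  (forall i, sdiff1 (f i) x (g i)) -> sdiff1 (fun u => \sum_i f i u) x (\sum_i g i).
Proof.
move=> h; rewrite /index_enum; elim: (Finite.enum _) => [|i r IH].
  rewrite big_nil; apply: sdiff1_near ltr01 _ (sdiff1_cst 0 x) => u _.
  by rewrite big_nil.
rewrite big_cons; apply: sdiff1_near ltr01 _ (sdiff1D (h i) IH) => u _.
by rewrite big_cons.
Qed.

Lemma sdiff1_bounded m (f : 'rV[R]_m -> R) x g : sdiff1 f x g ->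
  exists2 d : R, 0 < d & exists2 c : R, 0 < c & forall u v,
    `|u - x| < d -> `|v - x| < d -> `|f u - f v| <= c * `|u - v|.
Proof.
move=> sf; have [d d0 hd] := sf 1 ltr01.
exists d => //; exists (1 + m%:R * `|g|) => [|u v ud vd].
  by rewrite ltr_pwDl// mulr_ge0.
rewrite -[X in `|X|](subrK (dotv (u - v) g)) mulrDl mul1r.
apply: le_trans (ler_normD _ _) _; apply: lerD; first by rewrite -[leRHS]mul1r hd.
by rewrite mulrAC; exact: dotv_norm.
Qed.

Lemma sdiff1M m (f h : 'rV[R]_m -> R) x g k : sdiff1 f x g -> sdiff1 h x k ->
  sdiff1 (fun u => f u * h u) x (f x *: k + h x *: g).
Proof.
move=> sf sh e e0.
have [d1 d10 [c c0 h1]] := sdiff1_bounded sf.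
have [d2 d20 [c' c'0 h2]] := sdiff1_bounded sh.
have e1 : 0 < e / 4 / (1 + `|f x|) by rewrite !divr_gt0// ltr_pwDl.
have e2 : 0 < e / 4 / (1 + `|h x|) by rewrite !divr_gt0// ltr_pwDl.
have e3 : 0 < e / 4 / c by rewrite !divr_gt0.
have e4 : 0 < e / 4 / c' by rewrite !divr_gt0.
have [d3 d30 h3] := sf _ e2; have [d4 d40 h4] := sh _ e1.
have [d5 d50 h5] : exists2 d5 : R, 0 < d5 & forall u, `|u - x| < d5 -> `|f u - f x| <= e / 4 / c'.
  have /row_continuousP/(_ _ e4)[d5 d50 h5] := sdiff1_continuous sf.
  by exists d5 => // u /h5/ltW.
have [d6 d60 h6] : exists2 d6 : R, 0 < d6 & forall u, `|u - x| < d6 -> `|h u - h x| <= e / 4 / c.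
  have /row_continuousP/(_ _ e3)[d6 d60 h6] := sdiff1_continuous sh.
  by exists d6 => // u /h6/ltW.
exists (Num.min (Num.min d1 d2) (Num.min (Num.min d3 d4) (Num.min d5 d6))) => [|u v].
  by rewrite !lt_min d10 d20 d30 d40 d50 d60.
rewrite !lt_min => /andP[/andP[u1 u2] /andP[/andP[u3 u4] /andP[u5 u6]]].
move=> /andP[/andP[v1 v2] /andP[/andP[v3 v4] /andP[v5 v6]]].
rewrite dotvDr !dotvZr.
(* Two of the four terms are errors of the strict derivatives; the other two multiply a Lipschitz
   increment by an increment that is small near x. *)
rewrite (_ : _ - _ = (f u - f x) * (h u - h v) + f x * (h u - h v - dotv (u - v) k)
   + ((f u - f v) * (h v - h x) + h x * (f u - f v - dotv (u - v) g))); last by ring.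
have -> : e * `|u - v| =
    e / 4 * `|u - v| + e / 4 * `|u - v| + (e / 4 * `|u - v| + e / 4 * `|u - v|).
  by field.
have aux (p q q' : R) : 0 < p -> 0 <= q' -> `|q| <= q' / p -> p * `|q| <= q'.
  by move=> p0 q0; rewrite ler_pdivlMr// mulrC.
apply: le_trans (ler_normD _ _) _.
apply: lerD; apply: le_trans (ler_normD _ _) _; apply: lerD; rewrite normrM.
- apply: (@le_trans _ _ (e / 4 / c' * (c' * `|u - v|))).
    by apply: ler_pM => //; [exact: h5|exact: h2].
  by rewrite mulrA divfK// gt_eqF.
- apply: (@le_trans _ _ ((1 + `|f x|) * (e / 4 / (1 + `|f x|) * `|u - v|))).
    by apply: ler_pM => //; [rewrite lerDr|exact: h4].
  by rewrite mulrA [X in X * _]mulrC divfK// gt_eqF// ltr_pwDl.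
- apply: (@le_trans _ _ ((c * `|u - v|) * (e / 4 / c))).
    by apply: ler_pM => //; [exact: h1|exact: h6].
  by rewrite mulrC mulrA divfK// gt_eqF.
- apply: (@le_trans _ _ ((1 + `|h x|) * (e / 4 / (1 + `|h x|) * `|u - v|))).
    by apply: ler_pM => //; [rewrite lerDr|exact: h3].
  by rewrite mulrA [X in X * _]mulrC divfK// gt_eqF// ltr_pwDl.
Qed.

Lemma sdiff1V m (f : 'rV[R]_m -> R) x g : f x != 0 -> sdiff1 f x g ->
  sdiff1 (fun u => (f u)^-1) x (- (f x) ^- 2 *: g).
Proof.
move=> fx0 sf e e0.
have [d1 d10 [c c0 h1]] := sdiff1_bounded sf.
have cV : {for x, continuous (fun u => (f u)^-1)}.
  by apply: continuousV => //; exact: sdiff1_continuous sf.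
pose V u := (f u)^-1; rewrite -/(V x).
(* If V u and V v are within eta <= 1 of V x, then V u V v differs from V x ^ 2 by at most eta (2 |V
   x| + 1); [c] is the Lipschitz constant of [f]. *)
have eta0 : 0 < Num.min 1 (e / 2 / (c * (2 * `|V x| + 1))).
  by rewrite lt_min ltr01 !divr_gt0// mulr_gt0// ltr_wpDl// mulr_ge0.
set eta := Num.min _ _ in eta0.
have eta1 : eta <= 1 by rewrite ge_min lexx.
have etae : c * (eta * (2 * `|V x| + 1)) <= e / 2.
  rewrite mulrCA -ler_pdivlMr ?ge_min ?lexx ?orbT//.
  by rewrite mulr_gt0// ltr_wpDl// mulr_ge0.
have /row_continuousP/(_ _ eta0)[d3 d30 h3] := cV.
have fx00 : 0 < `|f x| by rewrite normr_gt0.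
have /row_continuousP/(_ _ fx00)[d4 d40 h4] := sdiff1_continuous sf.
have fn0 u : `|u - x| < d4 -> f u != 0.
  by move=> /h4; apply: contraTneq => ->; rewrite sub0r normrN ltxx.
have e1 : 0 < e / 2 / (1 + `|V x ^+ 2|) by rewrite !divr_gt0// ltr_pwDl.
have [d2 d20 h2] := sf _ e1.
exists (Num.min (Num.min d1 d2) (Num.min d3 d4)) => [|u v].
  by rewrite !lt_min d10 d20 d30 d40.
rewrite !lt_min => /andP[/andP[u1 u2] /andP[u3 u4]] /andP[/andP[v1 v2] /andP[v3 v4]].
have hu := h3 u u3; have hv := h3 v v3.
rewrite -/(V u) -/(V x) in hu; rewrite -/(V v) -/(V x) in hv.
rewrite dotvZr -/(V u) -/(V v) (_ : _ - _ = - ((f u - f v) * ((V u - V x) * V v + V x * (V v - V x))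
   + V x ^+ 2 * (f u - f v - dotv (u - v) g))); last first.
  rewrite -exprVn -/(V x).
  have : V u * f u = 1 by rewrite mulVf// fn0.
  have : V v * f v = 1 by rewrite mulVf// fn0.
  move: (V u) (V v) (V x) (f u) (f v) => p q r a b qb pa.
  have -> : p - q = - ((a - b) * (p * q)).
    rewrite (_ : p - q = p * (q * b) - q * (p * a)); last by rewrite qb pa !mulr1.
    ring.
  ring.
rewrite normrN (_ : e * `|u - v| = e / 2 * `|u - v| + e / 2 * `|u - v|); last by field.
apply: le_trans (ler_normD _ _) _; apply: lerD.
  rewrite normrM; apply: le_trans (_ : c * `|u - v| * (eta * (2 * `|V x| + 1)) <= _).
    apply: ler_pM => //; first exact: h1.
    apply: le_trans (ler_normD _ _) _; rewrite !normrM.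
    have Vv : `|V v| <= `|V x| + 1.
      rewrite -[V v](subrK (V x)) addrC; apply: le_trans (ler_normD _ _) _.
      by rewrite lerD2l; apply: le_trans (ltW hv) eta1.
    apply: (@le_trans _ _ (eta * (`|V x| + 1) + `|V x| * eta)).
      by apply: lerD; apply: ler_pM => //; exact: ltW.
    lra.
  by rewrite mulrAC ler_wpM2r.
rewrite normrM; apply: (@le_trans _ _ ((1 + `|V x ^+ 2|) * (e / 2 / (1 + `|V x ^+ 2|) * `|u - v|))).
  by apply: ler_pM => //; [rewrite lerDr|exact: h2].
by rewrite mulrA [X in X * _]mulrC divfK// gt_eqF// ltr_pwDl.
Qed.

Lemma sdiff1_comp m n (f : 'rV[R]_n -> R) (F : 'rV[R]_m -> 'rV[R]_n) x L g :
  sdiff F x L -> sdiff1 f (F x) g -> sdiff1 (fun u => f (F u)) x (g *m L^T).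
Proof.
move=> sF sf e e0.
have [d1 d10 h1] := sF 1 ltr01; have [c c0 cL] := mulmx_bounded L.
have e1 : 0 < e / 2 / (1 + c) by rewrite !divr_gt0// addr_gt0.
have e2 : 0 < e / 2 / (1 + n%:R * `|g|) by rewrite !divr_gt0// ltr_pwDl// mulr_ge0.
have [d2 d20 h2] := sf _ e1; have [d3 d30 h3] := sF _ e2.
have /row_continuousP/(_ _ d20)[d4 d40 h4] := sdiff_continuous sF.
exists (Num.min (Num.min d1 d3) d4) => [|u v]; first by rewrite !lt_min d10 d30 d40.
rewrite !lt_min => /andP[/andP[u1 u3] u4] /andP[/andP[v1 v3] v4].
have -> : dotv (u - v) (g *m L^T) = dotv ((u - v) *m L) g.
  by rewrite /dotv trmx_mul trmxK mulmxA.
have -> : f (F u) - f (F v) - dotv ((u - v) *m L) g =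
    (f (F u) - f (F v) - dotv (F u - F v) g) + dotv (F u - F v - (u - v) *m L) g.
  by rewrite (dotvBl (F u - F v)); ring.
rewrite [e]splitr mulrDl; apply: le_trans (ler_normD _ _) _; apply: lerD.
  apply: le_trans (h2 _ _ (h4 _ u4) (h4 _ v4)) _.
  rewrite -mulrA ler_pM2l ?divr_gt0// mulrC ler_pdivrMr ?addr_gt0// mulrC mulrDl mul1r.
  rewrite -[X in `|X|](subrK ((u - v) *m L)); apply: le_trans (ler_normD _ _) _.
  by apply: lerD; [rewrite -[leRHS]mul1r h1|exact: cL].
apply: le_trans (dotv_norm _ _) _; rewrite mulrAC.
apply: (@le_trans _ _ ((1 + n%:R * `|g|) * (e / 2 / (1 + n%:R * `|g|) * `|u - v|))).
  by apply: ler_pM; [rewrite mulr_ge0|by []|rewrite lerDr|exact: h3].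
by rewrite mulrA [X in X * _]mulrC divfK// gt_eqF// ltr_pwDl// mulr_ge0.
Qed.

Lemma sdiff_comp m n p (G : 'rV[R]_n -> 'rV[R]_p) (F : 'rV[R]_m -> 'rV[R]_n) x L M :
  sdiff F x L -> sdiff G (F x) M -> sdiff (fun u => G (F u)) x (L *m M).
Proof.
move=> sF /sdiff_coord sG; apply/sdiff_coord => j.
apply: sdiff1_eq (sdiff1_comp sF (sG j)).
rewrite -trmx_mul; congr (_^T); apply/colP => i; rewrite !mxE.
by apply: eq_bigr => k _; rewrite !mxE.
Qed.

Lemma sdiff_mulmxr m n p (F : 'rV[R]_m -> 'rV[R]_n) x L (M : 'M[R]_(n, p)) :
  sdiff F x L -> sdiff (fun u => F u *m M) x (L *m M).
Proof.
move=> sF; apply: (sdiff_comp (G := fun v => v *m M) sF) => e e0.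
exists 1 => // u v _ _.
by rewrite mulmxBl subrr normr0 mulr_ge0// ltW.
Qed.

Lemma sdiff_id m (x : 'rV[R]_m) : sdiff id x 1%:M.
Proof.
by move=> e e0; exists 1 => // u v _ _; rewrite mulmx1 subrr normr0 mulr_ge0// ltW.
Qed.

Lemma sdiff_near m n (F G : 'rV[R]_m -> 'rV[R]_n) x L (r : R) : 0 < r ->
  (forall u, `|u - x| < r -> F u = G u) -> sdiff F x L -> sdiff G x L.
Proof.
move=> r0 FG /sdiff_coord sF; apply/sdiff_coord => j.
by apply: sdiff1_near r0 _ (sF j) => u /FG ->.
Qed.

Lemma sdiff_row_mx m n (F : 'rV[R]_m -> 'rV[R]_n) (f : 'rV[R]_m -> R) x L g :
  sdiff F x L -> sdiff1 f x g ->
  sdiff (fun u => row_mx (F u) (f u)%:M) x (row_mx L g^T).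
Proof.
move=> /sdiff_coord sF sf; apply/sdiff_coord => j; case: (split_ordP j) => k ->.
  apply: sdiff1_near ltr01 _ (sdiff1_eq _ (sF k)) => [u _|].
    by rewrite row_mxEl.
  by rewrite colKl.
apply: sdiff1_near ltr01 _ (sdiff1_eq _ sf) => [u _|].
  by rewrite row_mxEr ord1 mxE.
by rewrite colKr; apply/rowP => i; rewrite !mxE ord1.
Qed.

Lemma sdiffD m n (F G : 'rV[R]_m -> 'rV[R]_n) x L M :
  sdiff F x L -> sdiff G x M -> sdiff (fun u => F u + G u) x (L + M).
Proof.
move=> /sdiff_coord sF /sdiff_coord sG; apply/sdiff_coord => j.
apply: sdiff1_near ltr01 _ (sdiff1_eq _ (sdiff1D (sF j) (sG j))) => [u _|].
  by rewrite mxE.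
by apply/rowP => i; rewrite !mxE.
Qed.

Lemma sdiff_scale m n (f : 'rV[R]_m -> R) (F : 'rV[R]_m -> 'rV[R]_n) x g L :
  sdiff1 f x g -> sdiff F x L ->
  sdiff (fun u => f u *: F u) x (f x *: L + g^T *m F x).
Proof.
move=> sf /sdiff_coord sF; apply/sdiff_coord => j.
apply: sdiff1_near ltr01 _ (sdiff1_eq _ (sdiff1M sf (sF j))) => [u _|].
  by rewrite mxE.
by apply/rowP => i; rewrite !mxE big_ord1 !mxE [F x 0 j * _]mulrC.
Qed.

Lemma sdiff1_dotv2 m n (F G : 'rV[R]_m -> 'rV[R]_n) x L M :
  sdiff F x L -> sdiff G x M ->
  sdiff1 (fun u => dotv (F u) (G u)) x (F x *m M^T + G x *m L^T).
Proof.
move=> /sdiff_coord sF /sdiff_coord sG.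
have := sdiff1_sum (fun j => sdiff1M (sF j) (sG j)).
move=> h; apply: sdiff1_near ltr01 _ (sdiff1_eq _ h) => [u _|].
  by rewrite dotvE.
apply/rowP => i; rewrite summxE !mxE -big_split /=.
by apply: eq_bigr => j _; rewrite !mxE.
Qed.

Lemma sdiff_differential m n (F : 'rV[R]_m -> 'rV[R]_n) x L h :
  sdiff F x L -> 'd F x h = h *m L.
Proof.
move=> sF; have -> // : 'd F x = mulmxr L :> ('rV[R]_m -> 'rV[R]_n).
apply: diff_unique; first exact: mulmxr_continuous.
apply/eqaddoP => _ /posnumP[e].
have [d d0 hd] := sF e%:num [gt0 of e%:num].
apply/nbhs_ballP; exists d => //= k; rewrite -ball_normE /ball_ /= sub0r normrN => kd.
have := hd (k + x) x; rewrite addrK subrr normr0 => /(_ kd d0).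
by rewrite opprD addrA.
Qed.

Lemma sdiff1_is_derive_line m (f : 'rV[R]_m -> R) (z v g : 'rV[R]_m) (s : R) :
  sdiff1 f (z + s *: v) g -> is_derive s (1 : R) (fun r => f (z + r *: v)) (dotv v g).
Proof.
move=> sf; apply/is_derive_epsP => e e0.
have e1 : 0 < e / (1 + `|v|) by rewrite divr_gt0// ltr_pwDl.
have [d d0 hd] := sf _ e1; exists (d / (1 + `|v|)) => [|k].
  by rewrite divr_gt0// ltr_pwDl.
rewrite ltr_pdivlMr ?ltr_pwDl// => kd.
have E : z + (s + k) *: v - (z + s *: v) = k *: v.
  by rewrite scalerDl opprD addrACA subrr add0r addrAC subrr add0r.
have kv : `|k *: v| <= `|k| * (1 + `|v|) by rewrite normrZ ler_wpM2l// lerDr.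
have := hd (z + (s + k) *: v) (z + s *: v).
rewrite E subrr normr0 dotvZl => /(_ _ d0) h; apply: le_trans (h _) _.
  exact: le_lt_trans kd.
by rewrite -mulrA ler_pM2l// ler_pdivrMl ?ltr_pwDl// mulrC.
Qed.

(* A telescoping sum over the coordinates and the mean value theorem. *)
Lemma Ck1_sdiff1 m (U : set 'rV[R]_m) f x : open U -> U x -> Ck_on 1 U f ->
  sdiff1 f x (gradient f x).
Proof.
move=> oU Ux [_ df] e e0.
have /row_nbhsP[r r0 rU] : nbhs x U by exact: open_nbhs_nbhs.
have e1 : 0 < e / (1 + m%:R) by rewrite divr_gt0// ltr_pwDl.
have /choice[d hd] (i : 'I_m) : exists d : R, 0 < d /\
    forall u, `|u - x| < d -> `|partial i f u - partial i f x| < e / (1 + m%:R).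
  have [_ [/(_ x Ux)/row_continuousP/(_ _ e1)[d d0 hd] _]] := df i.
  by exists d.
exists (Num.min r (\big[Num.min/1]_i d i)) => [|u v].
  by rewrite lt_min r0 /=; apply: lt_bigmin => // i _; have [] := hd i.
rewrite !lt_min => /andP[ur /bigmin_gtP[_ ud]] /andP[vr /bigmin_gtP[_ vd]].
pose w k : 'rV[R]_m := \row_i if (i < k)%N then u 0 i else v 0 i.
have w0 : w 0 = v by apply/rowP => i; rewrite mxE.
have wm : w m = u by apply/rowP => i; rewrite mxE ltn_ord.
have wS (k : 'I_m) : w k.+1 = w k + (u 0 k - v 0 k) *: delta_mx 0 k.
  apply/rowP => i; rewrite !mxE eqxx /= ltnS leq_eqVlt.
  have [->|ik] := eqVneq i k; first by rewrite eqxx ltnn mulr1 addrC subrK.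
  by rewrite (inj_eq val_inj) (negbTE ik) mulr0 addr0.
(* Balls of the sup norm are boxes, so the path from v to u that changes one coordinate at a time
   stays in them. *)
have near_x (k : 'I_m) (s c : R) : `|u - x| < c -> `|v - x| < c ->
    Num.min 0 (u 0 k - v 0 k) <= s <= Num.max 0 (u 0 k - v 0 k) ->
    `|w k + s *: delta_mx 0 k - x| < c.
  move=> uc vc; have c0 : 0 < c by exact: le_lt_trans uc.
  move=> sk; apply: row_norm_lt => // i; rewrite !mxE eqxx /=.
  have ui : `|u 0 i - x 0 i| < c.
    by apply: le_lt_trans uc; have := ler_coord_norm (u - x) i; rewrite !mxE.
  have vi : `|v 0 i - x 0 i| < c.
    by apply: le_lt_trans vc; have := ler_coord_norm (v - x) i; rewrite !mxE.
  have [->|ik] := eqVneq i k; last first.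
    by rewrite mulr0 addr0; case: ifP.
  rewrite ltnn mulr1; have := sk.
  have := ler_coord_norm (u - x) k; have := ler_coord_norm (v - x) k; rewrite !mxE.
  move=> /le_lt_trans/(_ vc) vk /le_lt_trans/(_ uc) uk; move: vk uk.
  have [h|h] := lerP 0 (u 0 k - v 0 k);
    rewrite !ltr_norml => /andP[? ?] /andP[? ?] /andP[? ?]; apply/andP; split; lra.
have step (k : 'I_m) : `|f (w k.+1) - f (w k) - (u - v) 0 k * partial k f x|
    <= e / (1 + m%:R) * `|u - v|.
  rewrite wS.
  have := @mean_value_bound R (fun s => f (w k + s *: delta_mx 0 k))
    (fun s => partial k f (w k + s *: delta_mx 0 k)) 0 (u 0 k - v 0 k)
    (partial k f x) (e / (1 + m%:R)).
  rewrite scale0r addr0 subr0 => h.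
  rewrite !mxE mulrC; apply: le_trans (h _ _) _ => [s sk|s sk|].
  - apply: is_derive_line; have [+ _] := df k; apply; apply: rU.
    exact: near_x.
  - by apply/ltW; have [_] := hd k; apply; apply: near_x => //; [exact: ud|exact: vd].
  - apply: ler_wpM2l; first exact: ltW.
    by have := ler_coord_norm (u - v) k; rewrite !mxE.
have -> : f u - f v - dotv (u - v) (gradient f x) =
    \sum_(k < m) (f (w k.+1) - f (w k) - (u - v) 0 k * partial k f x).
  rewrite big_split /= sumrN dotvE; congr (_ - _); last first.
    by apply: eq_bigr => k _; rewrite [gradient f x 0 k]mxE.
  by rewrite -{1}wm -{1}w0 -(telescope_sumr (f \o w)) // big_mkord.
apply: le_trans (ler_norm_sum _ _ _) _.
apply: le_trans (ler_sum _ (fun k _ => step k)) _.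
rewrite sumr_const card_ord -[leLHS]mulr_natl mulrA ler_wpM2r//.
by rewrite mulrCA ler_piMr ?(ltW e0)// ler_pdivrMr ?ltr_pwDl// mul1r lerDr.
Qed.

Lemma mean_value_theorem01 (phi dphi : R -> R) :
  (forall r : R, 0 <= r <= 1 -> is_derive r (1 : R) phi (dphi r)) ->
  exists2 r : R, 0 <= r <= 1 & phi 1 - phi 0 = dphi r.
Proof.
move=> h; have [||r r01 ->] := MVT_segment ler01 (f := phi) (df := dphi).
- by move=> r /itvP rab; apply: h; rewrite !rab.
- apply: derivable_within_continuous => r /itvP rab.
  by have := h r; rewrite !rab => /(_ isT)[].
exists r; first by move: r01; rewrite in_itv.
by rewrite subr0 mulr1.
Qed.

(** The second difference of [h] along a and b is symmetric in a and b. By the mean value theorem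
    along a, it is an increment of [gam] by b paired with a, which strictness at x compares with
    [H]. *)
Lemma second_derivative_symmetric m (h : 'rV[R]_m -> R) (gam : 'rV[R]_m -> 'rV[R]_m)
    x H r : 0 < r -> (forall z, `|z - x| < r -> sdiff1 h z (gam z)) ->
  sdiff gam x H -> H^T = H.
Proof.
move=> r0 sh sg.
have bound (e : R) : 0 < e -> exists2 d : R, 0 < d & forall a b : 'rV[R]_m,
    `|a| < d -> `|b| < d ->
    `|h (x + a + b) - h (x + a) - h (x + b) + h x - dotv a (b *m H)| <=
    m%:R * `|a| * (e * `|b|).
  move=> e0; have [d d0 hd] := sg e e0.
  exists (Num.min d r / 2) => [|a b]; first by rewrite divr_gt0// lt_min d0.
  set c := Num.min d r / 2 => ac bc.
  have cd : c + c <= d by rewrite /c -splitr ge_min lexx.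
  have cr : c + c <= r by rewrite /c -splitr ge_min lexx orbT.
  have ta (t : R) : 0 <= t <= 1 -> `|t *: a| < c.
    move=> /andP[t0 t1]; rewrite normrZ ger0_norm//; apply: le_lt_trans ac.
    by rewrite ler_piMl.
  have tab (t : R) : 0 <= t <= 1 -> `|t *: a + b| < c + c.
    by move=> /ta h1; apply: le_lt_trans (ler_normD _ _) _; exact: ltrD.
  have ta' (t : R) : 0 <= t <= 1 -> `|t *: a| < c + c.
    by move=> /ta h1; apply: lt_trans h1 _; rewrite ltrDl; apply: le_lt_trans ac.
  pose phi t := h (x + b + t *: a) - h (x + t *: a).
  have [|t t01] := @mean_value_theorem01 phi
      (fun t => dotv a (gam (x + b + t *: a)) - dotv a (gam (x + t *: a))).
    move=> t t01; apply: is_deriveB; apply: sdiff1_is_derive_line; apply: sh.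
      rewrite (_ : x + b + t *: a - x = t *: a + b).
        by apply: lt_le_trans cr; exact: tab.
      by apply/rowP => k; rewrite !mxE; ring.
    by rewrite addrC addKr; apply: lt_le_trans cr; exact: ta'.
  rewrite /phi !scale1r !scale0r !addr0 -dotvBr => E.
  rewrite (_ : _ + h x = h (x + b + a) - h (x + a) - (h (x + b) - h x)); last first.
    by rewrite (addrAC x b a); ring.
  rewrite E -dotvBr; apply: le_trans (dotv_norm _ _) _.
  apply: ler_wpM2l; first by rewrite mulr_ge0.
  have := hd (x + b + t *: a) (x + t *: a).
  rewrite (_ : x + b + t *: a - (x + t *: a) = b); last first.
    by rewrite opprD addrACA subrr addr0 addrC addKr.
  apply.
    rewrite (_ : x + b + t *: a - x = t *: a + b).
      by apply: lt_le_trans cd; exact: tab.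
    by apply/rowP => k; rewrite !mxE; ring.
  by rewrite addrC addKr; apply: lt_le_trans cd; exact: ta'.
have sym (a b : 'rV[R]_m) : dotv a (b *m H) = dotv b (a *m H).
  apply/eqP; rewrite -subr_eq0 -normr_eq0 eq_le normr_ge0 andbT.
  apply/ler_addgt0Pr => e e0; rewrite add0r.
  (* With a and b scaled by t, both the asymmetry and the error are quadratic in t; [K] absorbs the
     two errors, so t cancels. *)
  pose K := 2 * (m%:R * `|a| * `|b|) + 1.
  have K0 : 0 < K by rewrite ltr_wpDl// mulr_ge0// !mulr_ge0.
  have [d d0 hd] := bound _ (divr_gt0 e0 K0).
  pose t := d / (1 + `|a| + `|b|).
  have ab0 : 0 < 1 + `|a| + `|b| by rewrite -addrA ltr_pwDl// addr_ge0.
  have t0 : 0 < t by rewrite divr_gt0.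
  have ta : `|t *: a| < d.
    rewrite normrZ gtr0_norm// /t mulrAC ltr_pdivrMr// ltr_pM2l//.
    by rewrite addrAC ltrDr ltr_pwDl.
  have tb : `|t *: b| < d.
    rewrite normrZ gtr0_norm// /t mulrAC ltr_pdivrMr// ltr_pM2l//.
    by rewrite ltrDr ltr_pwDl.
  have h1 := hd _ _ ta tb; have h2 := hd _ _ tb ta.
  have nZ (z : 'rV[R]_m) : `|t *: z| = t * `|z| by rewrite normrZ gtr0_norm.
  rewrite -!scalemxAl !dotvZl !dotvZr !nZ in h1 h2.
  rewrite (addrAC x (t *: b)) in h2.
  move: h1 h2; set D := h _ - _ - _ + _; set D' := h _ - _ - _ + _.
  rewrite (_ : D' = D); last by rewrite /D' /D; ring.
  set A := dotv a _; set B := dotv b _ => h1 h2.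
  have : `|t * t * (A - B)| <= t * t * e.
    have -> : t * t * (A - B) = (D - t * (t * B)) - (D - t * (t * A)) by ring.
    apply: le_trans (ler_normB _ _) _; apply: le_trans (lerD h2 h1) _.
    have -> : m%:R * (t * `|b|) * (e / K * (t * `|a|)) + m%:R * (t * `|a|) * (e / K * (t * `|b|))
      = t * t * (e / K * (2 * (m%:R * `|a| * `|b|))) by ring.
    apply: ler_wpM2l; first by rewrite mulr_ge0// ltW.
    by rewrite -mulrA ler_piMr ?(ltW e0)// mulrC ler_pdivrMr// mul1r /K lerDl.
  by rewrite normrM ger0_norm ?ler_pM2l ?mulr_gt0// mulr_ge0// ltW.
apply/matrixP => i j; have := sym (delta_mx 0 i) (delta_mx 0 j).
by rewrite !dotv_delta -!rowE !mxE.
Qed.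

End scalar_strict_differentiability.

(** * Implicit differentiation and convex functions *)

Section implicit_and_convex.
Context {R : realType}.

(** [X] is given and continuous, so no inverse function has to be constructed: strictness of [G] at
    X y expresses increments of [X] by those of [h], up to a small multiple of the increments of [X]
    themselves. *)
Lemma sdiff_implicit m n (X : 'rV[R]_m -> 'rV[R]_n) (G : 'rV[R]_n -> 'rV[R]_n)
    (h : 'rV[R]_m -> 'rV[R]_n) y L H r : 0 < r ->
  (forall u, `|u - y| < r -> G (X u) = h u) -> {for y, continuous X} ->
  sdiff G (X y) H -> H \in unitmx -> sdiff h y L -> sdiff X y (L *m invmx H).
Proof.
move=> r0 GX cX sG uH sh e e0.
have [c c0 cH] := mulmx_bounded (invmx H); have [k k0 kL] := mulmx_bounded L.
have key (eta : R) : 0 < eta -> exists2 d : R, 0 < d & forall u v,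
    `|u - y| < d -> `|v - y| < d ->
    `|X u - X v - (h u - h v) *m invmx H| <= c * eta * `|X u - X v|.
  move=> eta0; have [d d0 hd] := sG _ eta0.
  have /row_continuousP/(_ _ d0)[d1 d10 hd1] := cX.
  exists (Num.min r d1) => [|u v]; first by rewrite lt_min r0.
  rewrite !lt_min => /andP[ur u1] /andP[vr v1]; rewrite -!GX//.
  have -> : X u - X v - (G (X u) - G (X v)) *m invmx H =
      - ((G (X u) - G (X v) - (X u - X v) *m H) *m invmx H).
    by rewrite [in RHS]mulmxBl mulmxK// opprB.
  rewrite normrN; apply: le_trans (cH _) _; rewrite -mulrA ler_pM2l//.
  by apply: hd; exact: hd1.
(* First use, with an error of half the increment of [X]: absorbing it gives the Lipschitz constant
   2 c (1 + k). *)
have c2 : 0 < (2 * c)^-1 by rewrite invr_gt0 mulr_gt0.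
have [d1 d10 h1] := key _ c2; have [d2 d20 h2] := sh 1 ltr01.
have e1 : 0 < e / 2 / c by rewrite !divr_gt0.
have C0 : 0 < 2 * c * (1 + k) by rewrite !mulr_gt0// addr_gt0.
(* Second use: by that Lipschitz constant the error falls below e / 2 times the norm of u - v. *)
have e2 : 0 < e / 2 / c / (2 * c * (1 + k)) by rewrite divr_gt0.
have [d3 d30 h3] := key _ e2; have [d4 d40 h4] := sh _ e1.
exists (Num.min (Num.min d1 d2) (Num.min d3 d4)) => [|u v].
  by rewrite !lt_min d10 d20 d30 d40.
rewrite !lt_min => /andP[/andP[u1 u2] /andP[u3 u4]] /andP[/andP[v1 v2] /andP[v3 v4]].
have hb : `|h u - h v| <= (1 + k) * `|u - v|.
  rewrite -[X in `|X|](subrK ((u - v) *m L)); apply: le_trans (ler_normD _ _) _.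
  rewrite mulrDl mul1r; apply: lerD; last exact: kL.
  by rewrite -[leRHS]mul1r; exact: h2.
have Xb : `|X u - X v| <= 2 * c * (1 + k) * `|u - v|.
  have := h1 u v u1 v1; have := cH (h u - h v).
  have -> : c * (2 * c)^-1 = 2^-1 by field; rewrite gt_eqF.
  move=> a1 a2; have : `|X u - X v| <= 2^-1 * `|X u - X v| + c * `|h u - h v|.
    rewrite -[X in `|X| <= _](subrK ((h u - h v) *m invmx H)).
    by apply: le_trans (ler_normD _ _) _; exact: lerD.
  have : c * `|h u - h v| <= c * ((1 + k) * `|u - v|) by rewrite ler_pM2l.
  lra.
have -> : X u - X v - (u - v) *m (L *m invmx H) =
    (X u - X v - (h u - h v) *m invmx H) + (h u - h v - (u - v) *m L) *m invmx H.
  by rewrite (mulmxBl (h u - h v) ((u - v) *m L)) -mulmxA addrA subrK.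
rewrite (_ : e * `|u - v| = e / 2 * `|u - v| + e / 2 * `|u - v|); last by field.
apply: le_trans (ler_normD _ _) _; apply: lerD.
  apply: le_trans (h3 _ _ u3 v3) _.
  apply: (@le_trans _ _ (c * (e / 2 / c / (2 * c * (1 + k))) * (2 * c * (1 + k) * `|u - v|))).
    by apply: ler_wpM2l => //; rewrite mulr_ge0// ltW.
  rewrite le_eqVlt; apply/orP; left; apply/eqP; field.
  by rewrite !gt_eqF// addr_gt0.
apply: le_trans (cH _) _; rewrite -ler_pdivlMl//.
apply: le_trans (h4 _ _ u4 v4) _.
by rewrite mulrA [c^-1 * _]mulrC.
Qed.

Lemma Ck2_sdiff m (U : set 'rV[R]_m) f : open U -> Ck_on 2 U f ->
  forall x, U x -> sdiff1 f x (gradient f x) /\ sdiff (gradient f) x (hessian f x).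
Proof.
move=> oU [cf df] x Ux; split.
  apply: Ck1_sdiff1 oU Ux _; split => // i; have [d1 [d2 _]] := df i.
  by split.
apply/sdiff_coord => j; have [_ d1] := df j.
apply: sdiff1_near ltr01 _ (sdiff1_eq _ (Ck1_sdiff1 oU Ux d1)) => [u _|].
  by rewrite mxE.
by apply/rowP => i; rewrite !mxE.
Qed.

Lemma sdiff1_line_bound m (f : 'rV[R]_m -> R) x g (w : 'rV[R]_m) (e : R) : 0 < e ->
  sdiff1 f x g -> exists2 d : R, 0 < d & forall t : R, 0 < t < d ->
    `|f (x + t *: w) - f x - t * dotv w g| <= e * t.
Proof.
move=> e0 sf; have e1 : 0 < e / (1 + `|w|) by rewrite divr_gt0// ltr_pwDl.
have [d d0 hd] := sf _ e1; exists (d / (1 + `|w|)) => [|t /andP[t0]].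
  by rewrite divr_gt0// ltr_pwDl.
rewrite ltr_pdivlMr ?ltr_pwDl// => td.
have E : x + t *: w - x = t *: w by rewrite addrC addKr.
have tw : `|t *: w| <= t * (1 + `|w|).
  by rewrite normrZ gtr0_norm// ler_pM2l// lerDr.
have := hd (x + t *: w) x; rewrite E subrr normr0 dotvZl => /(_ _ d0) h.
apply: le_trans (h (le_lt_trans tw td)) _.
by rewrite -mulrA ler_pM2l// ler_pdivrMl ?ltr_pwDl// mulrC.
Qed.

Lemma sdiff1_local_max m (f : 'rV[R]_m -> R) x g r : 0 < r -> sdiff1 f x g ->
  (forall u, `|u - x| < r -> f u <= f x) -> g = 0.
Proof.
move=> r0 sf fmax; apply/eqP/contraT => g0.
have gg := dotvv_gt0 g0; have e0 : 0 < dotv g g / 2 by rewrite divr_gt0.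
have [d d0 hd] := sdiff1_line_bound g e0 sf.
pose t := Num.min (d / 2) (r / 2 / (1 + `|g|)).
have g1 : 0 < 1 + `|g| by rewrite ltr_pwDl.
have t0 : 0 < t by rewrite lt_min !divr_gt0.
have td : t < d by rewrite gt_min ltr_pdivrMr// ltr_pMr// ltr1n.
have := hd t; rewrite t0 td => /(_ isT).
have : f (x + t *: g) <= f x.
  apply: fmax; rewrite addrC addKr normrZ gtr0_norm//.
  apply: (@le_lt_trans _ _ (r / 2)); last by rewrite ltr_pdivrMr// ltr_pMr// ltr1n.
  apply: (@le_trans _ _ (t * (1 + `|g|))); first by rewrite ler_pM2l// lerDr.
  by rewrite -ler_pdivlMr// ge_min lexx orbT.
rewrite ler_norml => h1 /andP[h2 _].
have := mulr_gt0 t0 gg; lra.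
Qed.

Lemma convex_setP (V : lmodType R) (K : set V) : convex_set K ->
  forall x y (t : R), 0 <= t <= 1 -> K x -> K y -> K (x + t *: (y - x)).
Proof.
move=> cK x y t /andP[t0 t1] Kx Ky; have := cK y x (Itv01 t0 t1).
rewrite !inE => /(_ Ky Kx).
rewrite -[conv _ _ _]/(t *: y + (1 - t) *: x).
by rewrite scalerBl scale1r addrCA -scalerBr.
Qed.

Lemma convex_functionP m (U : set 'rV[R]_m) f : convex_function U f ->
  forall x y (t : R), 0 <= t <= 1 -> U x -> U y ->
  f (x + t *: (y - x)) <= f x + t * (f y - f x).
Proof.
move=> cf x y t /andP[t0 t1] Ux Uy.
have h : f (t *: y + (1 - t) *: x) <= t * f y + (1 - t) * f x.
  by apply: (cf (Itv01 t0 t1) y x); rewrite inE.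
have -> : x + t *: (y - x) = t *: y + (1 - t) *: x.
  by rewrite [in RHS]scalerBl scale1r [RHS]addrCA -scalerBr.
by apply: le_trans h _; rewrite mulrBl mul1r addrCA -mulrBr.
Qed.

Lemma convex_gradient_le m (U : set 'rV[R]_m) f x y g : convex_function U f ->
  U x -> U y -> sdiff1 f x g -> f x + dotv (y - x) g <= f y.
Proof.
move=> cf Ux Uy sf; apply/ler_addgt0Pr => e e0.
have [d d0 hd] := sdiff1_line_bound (y - x) e0 sf.
pose t := Num.min (d / 2) (2^-1).
have t0 : 0 < t by rewrite lt_min divr_gt0//= invr_gt0.
have td : t < d by rewrite gt_min ltr_pdivrMr// ltr_pMr// ltr1n.
have t1 : 0 <= t <= 1.
  by rewrite ltW//= ge_min invf_le1// ler1n orbT.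
have := hd t; rewrite t0 td => /(_ isT); rewrite ler_norml => /andP[h1 _].
have h2 := convex_functionP cf t1 Ux Uy.
rewrite -(ler_pM2l t0); lra.
Qed.

Definition subgradient m (U : set 'rV[R]_m) (f : 'rV[R]_m -> R) (gam : 'rV[R]_m -> 'rV[R]_m) :=
  forall x y, U x -> U y -> f x + dotv (y - x) (gam x) <= f y.

(** The two subgradient inequalities squeeze f u - f v between the pairings of u - v with gam v and
    with gam u, both close to gam x. *)
Lemma subgradient_sdiff1 m (U : set 'rV[R]_m) f gam x : open U -> U x ->
  subgradient U f gam -> {for x, continuous gam} -> sdiff1 f x (gam x).
Proof.
move=> oU Ux sub cg e e0.
have e1 : 0 < e / (1 + m%:R) by rewrite divr_gt0// ltr_pwDl.
have /row_continuousP/(_ _ e1)[d d0 hd] := cg.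
have /row_nbhsP[r r0 rU] : nbhs x U by exact: open_nbhs_nbhs.
exists (Num.min d r) => [|u v]; first by rewrite lt_min d0.
rewrite !lt_min => /andP[/hd ud /rU Uu] /andP[/hd vd /rU Uv].
have h1 := sub u v Uu Uv; have h2 := sub v u Uv Uu.
have b (z : 'rV[R]_m) : `|gam z - gam x| < e / (1 + m%:R) ->
    `|dotv (u - v) (gam z - gam x)| <= e * `|u - v|.
  move=> zx; apply: le_trans (dotv_norm _ _) _.
  apply: (@le_trans _ _ ((1 + m%:R) * `|u - v| * (e / (1 + m%:R)))).
    apply: ler_pM => //; last exact: ltW.
    by rewrite ler_wpM2r// lerDr.
  by rewrite mulrAC [X in X * _]mulrC divfK// gt_eqF// ltr_pwDl.
move: h1; rewrite -opprB dotvNl => h1.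
have := b _ ud; have := b _ vd; rewrite !dotvBr !ler_norml => /andP[? ?] /andP[? ?].
by apply/andP; split; lra.
Qed.

(** Adding two subgradient inequalities shows that [gam] is monotone, so its derivative is positive
    semidefinite; it is symmetric as a second derivative, and invertibility makes it definite. *)
Lemma subgradient_pos_def m (U : set 'rV[R]_m) f gam x H : open U -> U x ->
  subgradient U f gam -> (forall z, U z -> sdiff1 f z (gam z)) ->
  sdiff gam x H -> H \in unitmx -> pos_def H.
Proof.
move=> oU Ux sub sf sg uH.
have /row_nbhsP[r r0 rU] : nbhs x U by exact: open_nbhs_nbhs.
apply: pos_def_semi => // [|w].
  by apply: (second_derivative_symmetric r0) sg => z /rU; exact: sf.
rewrite leNgt; apply/negP => wHw.
pose n1 := 1 + m%:R * `|w| * `|w|.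
have n10 : 0 < n1 by rewrite ltr_pwDl// !mulr_ge0.
have e0 : 0 < - dotv (w *m H) w / n1 by rewrite divr_gt0// oppr_gt0.
have [d d0 hd] := sg _ e0.
pose t := Num.min d r / 2 / (1 + `|w|).
have w1 : 0 < 1 + `|w| by rewrite ltr_pwDl.
have t0 : 0 < t by rewrite !divr_gt0// lt_min d0.
have tw : `|t *: w| < Num.min d r.
  rewrite normrZ gtr0_norm//; apply: (@lt_le_trans _ _ (t * (1 + `|w|))).
    by rewrite ltr_pM2l// ltrDr.
  by rewrite /t divfK ?gt_eqF// ler_pdivrMr// ler_peMr ?ler1n// ltW// lt_min d0.
have E : x + t *: w - x = t *: w by rewrite addrC addKr.
have Ut : U (x + t *: w) by apply: rU; rewrite E; move: tw; rewrite lt_min => /andP[].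
have := hd (x + t *: w) x; rewrite E subrr normr0 => /(_ _ d0) h.
have {}h := h _; move: tw; rewrite lt_min => /andP[td _]; have {}h := h td.
have := sub _ _ Ux Ut; have := sub _ _ Ut Ux.
rewrite E -opprB E dotvNl !dotvZl => h1 h2.
have h3 : 0 <= dotv w (gam (x + t *: w) - gam x).
  by rewrite dotvBr -(ler_pM2l t0) mulr0 mulrBr; lra.
have h4 : `|dotv w (gam (x + t *: w) - gam x - t *: w *m H)| <=
    m%:R * `|w| * (- dotv (w *m H) w / n1 * `|t *: w|).
  by apply: le_trans (dotv_norm _ _) _; apply: ler_wpM2l => //; rewrite mulr_ge0.
move: h4; rewrite dotvBr -scalemxAl dotvZr (dotvC w (w *m H)) normrZ (gtr0_norm t0).
rewrite ler_norml => /andP[_ h4].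
have h5 : m%:R * `|w| * (- dotv (w *m H) w / n1 * (t * `|w|)) < t * - dotv (w *m H) w.
  have -> : m%:R * `|w| * (- dotv (w *m H) w / n1 * (t * `|w|)) =
      t * (- dotv (w *m H) w) * ((m%:R * `|w| * `|w|) / n1) by ring.
  have p0 : 0 < t * - dotv (w *m H) w by apply: mulr_gt0 => //; rewrite oppr_gt0.
  rewrite -[ltRHS]mulr1 (ltr_pM2l p0).
  by rewrite ltr_pdivrMr// mul1r /n1 ltrDr.
lra.
Qed.

End implicit_and_convex.

(** * The inverse Gauss map *)

Section support_points.
Context {R : realType}.

Lemma row_closureP n (A : set 'rV[R]_n) x :
  closure A x <-> forall e : R, 0 < e -> exists2 z, A z & `|z - x| < e.
Proof.
split=> [cA e e0|h U /row_nbhsP[e e0 eU]].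
  have [|z [Az ze]] := cA [set z | `|z - x| < e].
    by apply/row_nbhsP; exists e.
  by exists z.
by have [z Az /eU Uz] := h e e0; exists z.
Qed.

Lemma closure_convex n (K : set 'rV[R]_n) : convex_set K ->
  forall x y (t : R), 0 <= t <= 1 -> closure K x -> closure K y ->
  closure K (x + t *: (y - x)).
Proof.
move=> cK x y t /[dup] t01 /andP[t0 t1] /row_closureP cx /row_closureP cy.
apply/row_closureP => e e0; have e2 : 0 < e / 2 by rewrite divr_gt0.
have [x' Kx' xx] := cx _ e2; have [y' Ky' yy] := cy _ e2.
exists (x' + t *: (y' - x')); first exact: convex_setP.
rewrite (_ : _ - _ = (1 - t) *: (x' - x) + t *: (y' - y)); last first.
  by apply/rowP => i; rewrite !mxE; ring.
apply: le_lt_trans (ler_normD _ _) _; rewrite !normrZ [e]splitr.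
apply: ler_ltD; rewrite ger0_norm ?subr_ge0//.
  apply: le_trans (ltW xx); rewrite ler_piMl//; lra.
by apply: le_lt_trans yy; rewrite ler_piMl.
Qed.

(** * Linear forms and supporting hyperplanes *)

Section pairing.
Context {d : nat}.
Local Notation V := 'rV[R]_(d + 1).
Implicit Types (phi : 'cV[R]_(d + 1)) (u v : V).

Lemma pairingD phi u v : pairing phi (u + v) = pairing phi u + pairing phi v.
Proof. by rewrite /pairing mulmxDl mxE. Qed.

Lemma pairingZ phi a v : pairing phi (a *: v) = a * pairing phi v.
Proof. by rewrite /pairing -scalemxAl mxE. Qed.

Lemma pairingB phi u v : pairing phi (u - v) = pairing phi u - pairing phi v.
Proof. by rewrite pairingD -scaleN1r pairingZ mulN1r. Qed.

Lemma pairing_dotv phi v : pairing phi v = dotv v phi^T.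
Proof. by rewrite /pairing /dotv trmxK. Qed.

Lemma pairing_row_mx (A : 'M[R]_(d + 1)) phi (p : 'rV[R]_d) c :
  pairing phi (row_mx p c%:M *m A) =
  dotv p (lsubmx (A *m phi)^T) + c * rsubmx (A *m phi)^T 0 0.
Proof.
set g := (A *m phi)^T.
rewrite /pairing -mulmxA -[A *m phi]trmxK -/g -{1}[g]hsubmxK tr_row_mx mul_row_col mxE.
by congr (_ + _); rewrite mul_scalar_mx !mxE.
Qed.

Lemma row_mxE v : v = row_mx (lsubmx v) (rsubmx v 0 0)%:M.
Proof.
rewrite -[LHS]hsubmxK; congr row_mx.
by apply/matrixP => i j; rewrite !ord1 [RHS]mxE eqxx.
Qed.

Lemma mulmx_row_mxE (A : 'M[R]_(d + 1)) v : A \in unitmx ->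
  v = row_mx (lsubmx (v *m invmx A)) (rsubmx (v *m invmx A) 0 0)%:M *m A.
Proof. by move=> uA; rewrite -row_mxE mulmxKV. Qed.

Lemma pairing_continuous phi : continuous (pairing phi).
Proof.
move=> v; have -> : pairing phi = (fun u => dotv u phi^T).
  by apply/funext => u; rewrite pairing_dotv.
exact: sdiff1_continuous (sdiff1_dotv _ _).
Qed.

Lemma pairing_colinear phi psi : phi != 0 ->
  (forall v, pairing phi v = 0 -> pairing psi v = 0) -> exists a, psi = a *: phi.
Proof.
move=> phi0 h.
have n0 : dotv phi^T phi^T != 0 by rewrite gt_eqF// dotvv_gt0// trmx_eq0.
pose v0 := (dotv phi^T phi^T)^-1 *: phi^T.
have v01 : pairing phi v0 = 1 by rewrite pairing_dotv dotvZl mulVf.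
exists (pairing psi v0); apply/colP => i.
have := h (delta_mx 0 i - pairing phi (delta_mx 0 i) *: v0).
rewrite pairingB pairingZ v01 mulr1 subrr => /(_ erefl)/eqP.
rewrite pairingB pairingZ subr_eq0 => /eqP.
by rewrite /pairing -!rowE !mxE => ->; rewrite mulrC.
Qed.

Lemma closure_le (K : set V) (f : V -> R) c : continuous f ->
  (forall X, K X -> f X <= c) -> forall X, closure K X -> f X <= c.
Proof.
move=> cf Kf X /row_closureP cX; rewrite leNgt; apply/negP => cfX.
have e0 : 0 < f X - c by rewrite subr_gt0.
have [r r0 hr] := (row_continuousP _ _).1 (cf X) _ e0.
have [Z KZ /hr] := cX _ r0; rewrite ltr_distl subKr => /andP[+ _].
by rewrite ltNge Kf.
Qed.

(** The definition of a supporting hyperplane does not fix the side of [K]. A segment joining points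
    of [K] on both sides would meet the hyperplane inside [K], hence the two cases. *)
Lemma support_side (K : set V) phi c : convex_set K -> supporting_hyperplane K phi c ->
  (forall X, closure K X -> pairing phi X <= c) \/
  (forall X, closure K X -> pairing (- phi) X <= - c).
Proof.
move=> cK [_ Kphi _].
have Kc X : K X -> pairing phi X != c.
  move=> KX; apply/eqP => Xc.
  have : ([set P | pairing phi P = c] `&` K) X by [].
  by rewrite Kphi.
have same X Y : K X -> K Y -> pairing phi X < c -> c < pairing phi Y -> False.
  move=> KX KY Xc cY; have XY : pairing phi X < pairing phi Y by exact: lt_trans cY.
  pose t := (c - pairing phi X) / (pairing phi Y - pairing phi X).
  have YX0 : 0 < pairing phi Y - pairing phi X by rewrite subr_gt0.
  have t01 : 0 <= t <= 1.
    apply/andP; split; first by rewrite divr_ge0// ltW// subr_gt0.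
    by rewrite ler_pdivrMr// mul1r lerD2r ltW.
  have := Kc _ (convex_setP cK t01 KX KY).
  rewrite pairingD pairingZ pairingB divfK ?(lt0r_neq0 YX0)// => /eqP; apply.
  by rewrite addrC subrK.
have pairingNphi X : pairing (- phi) X = - pairing phi X.
  by rewrite /pairing mulmxN mxE.
have [[X [KX Xc]]|noX] := pselect (exists X, K X /\ pairing phi X < c).
  left; apply: closure_le; first exact: pairing_continuous.
  by move=> Y KY; rewrite leNgt; apply/negP; exact: same Xc.
right; apply: closure_le; first exact: pairing_continuous.
move=> X KX; rewrite pairingNphi lerN2 leNgt; apply/negP => Xc.
by apply: noX; exists X.
Qed.

Lemma supporting_scale (K : set V) phi a P : a != 0 ->
  supporting_at K phi P -> supporting_at K (a *: phi) P.
Proof.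
move=> a0 [fP [phi0 Kphi _]]; split => //; split.
- by rewrite scaler_eq0 negb_or a0.
- apply/seteqP; split => // X [/= XP KX].
  suff : ([set Z | pairing phi Z = pairing phi P] `&` K) X by rewrite Kphi.
  split => //=; apply: (mulfI a0).
  by move: XP; rewrite /pairing -!scalemxAr mxE [RHS]mxE.
- by exists P.
Qed.

End pairing.

(** * Tangent vectors and charts of the boundary *)

Section tangent.
Context {d : nat}.
Local Notation V := 'rV[R]_(d + 1).
Implicit Types (K : set V) (phi : 'cV[R]_(d + 1)) (P v : V).

(** The form is maximal at time 0 along any curve in the frontier, and both signs of the time are
    available. *)
Lemma tangent_vectors_max K phi P v :
  (forall X, closure K X -> pairing phi X <= pairing phi P) ->
  tangent_vectors K P v -> pairing phi v = 0.
Proof.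
move=> Kmax [g [g0 dg gK]].
pose n1 := 1 + (d + 1)%:R * `|phi^T|.
have n10 : 0 < n1 by rewrite ltr_pwDl// mulr_ge0.
have small e : 0 < e -> exists2 r : R, 0 < r & forall k, `|k| < r ->
    k * pairing phi v <= e * `|k|.
  move=> e0; have e1 : 0 < e / n1 by rewrite divr_gt0.
  have [r1 r10 h1] := (is_derive_epsP _ _ _).1 dg _ e1.
  have /nbhs_ballP[r2 /= r20 h2] := gK.
  exists (Num.min r1 r2) => [|k]; first by rewrite lt_min r10.
  rewrite lt_min => /andP[/h1 k1 k2].
  have /h2[cg _] : ball (0 : R) r2 k by rewrite -ball_normE /= sub0r normrN.
  have : pairing phi (g k - P) <= 0 by rewrite pairingB subr_le0; exact: Kmax.
  move: k1; rewrite add0r g0; set w := g k - P - k *: v => k1.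
  have -> : g k - P = w + k *: v by rewrite /w subrK.
  rewrite pairingD pairingZ -lerBrDl sub0r => /le_trans; apply.
  rewrite pairing_dotv; apply: le_trans (ler_norm _) _.
  rewrite normrN; apply: le_trans (dotv_norm _ _) _.
  apply: (@le_trans _ _ (n1 * `|w|)).
    by rewrite mulrAC ler_wpM2r// lerDr.
  by rewrite mulrC -ler_pdivlMr// mulrAC.
apply/eqP; rewrite -normr_le0; apply/ler_addgt0Pr => e e0; rewrite add0r.
have [r r0 hr] := small e e0.
have r2 : 0 < r / 2 by rewrite divr_gt0.
have rr : `|r / 2| < r by rewrite gtr0_norm// ltr_pdivrMr// ltr_pMr// ltr1n.
rewrite ler_norml; apply/andP; split.
  have := hr (- (r / 2)); rewrite normrN => /(_ rr).
  by rewrite gtr0_norm// mulrC mulrN -mulNr ler_pM2r// lerNl.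
by have := hr _ rr; rewrite gtr0_norm// mulrC ler_pM2r.
Qed.

Lemma sdiff_is_derive0 m n (F : 'rV[R]_m -> 'rV[R]_n) x L w : sdiff F x L ->
  is_derive (0 : R) (1 : R) (fun t => F (x + t *: w)) (w *m L).
Proof.
move=> sF; apply/is_derive_epsP => e e0.
pose n1 := 1 + `|w|; have n10 : 0 < n1 by rewrite ltr_pwDl.
have e1 : 0 < e / n1 by rewrite divr_gt0.
have [r r0 hr] := sF _ e1; exists (r / n1); first by rewrite divr_gt0.
move=> k; rewrite ltr_pdivlMr// => kr.
have kw : `|k *: w| <= n1 * `|k| by rewrite normrZ mulrC ler_wpM2r// lerDr.
have := hr (x + k *: w) x.
rewrite subrr normr0 addrAC subrr add0r -scalemxAl scale0r add0r addr0 => /(_ _ r0) h.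
apply: le_trans (h _) _; first by apply: le_lt_trans kw _; rewrite mulrC.
by apply: le_trans (ler_wpM2l (ltW e1) kw) _; rewrite mulrA divfK// lt0r_neq0.
Qed.

(* Contrary to [C2plus], the hessian is required to be definite. *)
Definition convex_chart K (A : 'M[R]_(d + 1)) W f U x :=
  [/\ A \in unitmx, open U, open W /\ U (row_mx x (f x)%:M *m A) /\ W x,
      [/\ forall z, W z -> sdiff1 f z (gradient f z),
          forall z, W z -> sdiff (gradient f) z (hessian f z) &
          forall z, W z -> pos_def (hessian f z)] &
      frontier K `&` U = [set row_mx x (f x)%:M *m A | x in W] `&` U].

Lemma C2plus_chart K P : C2plus K -> frontier K P ->
  exists A W f U x, convex_chart K A W f U x /\ P = row_mx x (f x)%:M *m A.
Proof.
move=> KC fP; have [A [W [f [U [uA [oU UP] [oW cW] [f2 cf Hf] KU]]]]] := KC _ fP.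
have : (frontier K `&` U) P by [].
rewrite KU => -[[x Wx xP] _].
have df := Ck2_sdiff oW f2.
exists A, W, f, U, x; split => //; split => //; first by rewrite xP.
split=> [z /df[]//|z /df[]//|z Wz].
apply: (subgradient_pos_def oW Wz _ _ (df z Wz).2 (Hf z Wz)).
  by move=> a b Wa Wb; exact: convex_gradient_le cf Wa Wb (df a Wa).1.
by move=> a /df[].
Qed.

Lemma chart_frontier K A W f U x : convex_chart K A W f U x ->
  exists2 r : R, 0 < r & forall z, `|z - x| < r ->
    W z /\ frontier K (row_mx z (f z)%:M *m A).
Proof.
move=> [uA oU [oW [UP Wx]] [df _ _] KU].
have /row_nbhsP[r1 r10 h1] : nbhs x W by exact: open_nbhs_nbhs.
have sP : sdiff (fun z => row_mx z (f z)%:M *m A) x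
    (row_mx 1%:M (gradient f x)^T *m A).
  exact: sdiff_mulmxr (sdiff_row_mx (sdiff_id x) (df x Wx)).
have /row_nbhsP[e e0 eU] : nbhs (row_mx x (f x)%:M *m A) U by exact: open_nbhs_nbhs.
have [r2 r20 h2] := (row_continuousP _ _).1 (sdiff_continuous sP) _ e0.
exists (Num.min r1 r2) => [|z]; first by rewrite lt_min r10.
rewrite lt_min => /andP[/h1 Wz /h2 /eU Uz]; split => //.
suff : (frontier K `&` U) (row_mx z (f z)%:M *m A) by case.
by rewrite KU; split => //; exists z.
Qed.

Lemma chart_tangent K A W f U x w : convex_chart K A W f U x ->
  tangent_vectors K (row_mx x (f x)%:M *m A)
    (row_mx w (dotv w (gradient f x))%:M *m A).
Proof.
move=> ch; have [r r0 hr] := chart_frontier ch.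
have [_ _ [_ [_ Wx]] [df _ _] _] := ch.
exists (fun t => row_mx (x + t *: w) (f (x + t *: w))%:M *m A).
have sP : sdiff (fun z => row_mx z (f z)%:M *m A) x
    (row_mx 1%:M (gradient f x)^T *m A).
  exact: sdiff_mulmxr (sdiff_row_mx (sdiff_id x) (df x Wx)).
split; first by rewrite scale0r addr0.
  have -> : row_mx w (dotv w (gradient f x))%:M *m A =
      w *m (row_mx 1%:M (gradient f x)^T *m A).
    rewrite mulmxA mul_mx_row mulmx1; congr (row_mx _ _ *m _).
    by apply/matrixP => i j; rewrite !ord1 mxE eqxx.
  exact: (@sdiff_is_derive0 _ _ _ _ _ _ sP).
pose n1 := 1 + `|w|; have n10 : 0 < n1 by rewrite ltr_pwDl.
apply/nbhs_ballP; exists (r / n1); first by rewrite /= divr_gt0.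
move=> t; rewrite -ball_normE /= sub0r normrN ltr_pdivlMr// => tr.
apply: (hr _ _).2; rewrite addrAC subrr add0r normrZ.
by apply: le_lt_trans tr; rewrite ler_wpM2l// lerDr.
Qed.

(** On the graph, the form becomes a linear function plus b f with a maximum at x, b being its last
    coefficient; this is the first-order condition. If b were 0 the whole form would vanish. *)
Lemma chart_gradient K phi A W f U x : convex_chart K A W f U x ->
  phi != 0 -> (forall X, closure K X ->
    pairing phi X <= pairing phi (row_mx x (f x)%:M *m A)) ->
  let g := (A *m phi)^T in
  lsubmx g + rsubmx g 0 0 *: gradient f x = 0 /\ rsubmx g 0 0 != 0.
Proof.
move=> ch phi0 Kmax g.
have [uA _ [_ [_ Wx]] [df _ _] _] := ch.
have E := pairing_row_mx A phi; rewrite -/g in E.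
have h : lsubmx g + rsubmx g 0 0 *: gradient f x = 0.
  have [r r0 hr] := chart_frontier ch.
  apply: (sdiff1_local_max r0 (sdiff1D (sdiff1_dotv _ _) (sdiff1Z _ (df x Wx)))).
  move=> z /hr[_ [/Kmax]]; rewrite !E => + _.
  by rewrite [_ * f z]mulrC [_ * f x]mulrC.
split => //; apply/eqP => b0; move: h; rewrite b0 scale0r addr0 => a0.
have g0 : g = 0.
  rewrite -[g]hsubmxK a0; apply/rowP => i; rewrite !mxE; case: splitP => k _.
    by rewrite mxE.
  by rewrite ord1.
move/eqP: phi0; apply; rewrite -[phi](mulKmx uA).
by rewrite -[A *m phi]trmxK -/g g0 trmx0 mulmx0.
Qed.

(** Conversely to [tangent_vectors_max], a vector of the kernel is determined by its first d chart
    coordinates, as the last coefficient of the form is nonzero, and a curve in the graph realises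
    them. *)
Lemma tangent_vectors_ker K phi P : C2plus K -> frontier K P -> phi != 0 ->
  (forall X, closure K X -> pairing phi X <= pairing phi P) ->
  tangent_vectors K P = [set v | pairing phi v = 0].
Proof.
move=> KC fP phi0 Kmax; apply/seteqP; split => v /=.
  exact: tangent_vectors_max.
move=> phiv; have [A [W [f [U [x [ch PE]]]]]] := C2plus_chart KC fP.
have [uA _ _ _ _] := ch.
rewrite PE in Kmax *; have [_ b0] := chart_gradient ch phi0 Kmax.
have := chart_tangent (lsubmx (v *m invmx A)) ch.
set w := lsubmx _; set u := row_mx w _ *m A => tu.
suff -> : v = u by [].
have := tangent_vectors_max Kmax tu; have vE := mulmx_row_mxE v uA.
rewrite -phiv {1}vE /u !pairing_row_mx.
by move/addrI/(mulIf b0) => ->.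
Qed.
End tangent.
End support_points.

(** * Covectors of the dual domain and the inverse Gauss map *)

Section dual_domain.
Context {R : realType} {d : nat}.
Local Notation V := 'rV[R]_(d + 1).

Lemma bounded_setP n (A : set 'rV[R]_n) : bounded_set A ->
  exists2 M : R, 0 < M & forall x, A x -> `|x| <= M.
Proof.
move=> [M [Mr hM]]; exists (1 + `|M|); first by rewrite ltr_pwDl.
move=> x Ax; apply: (hM (1 + `|M|)) => //.
by apply: le_lt_trans (ler_norm _) _; rewrite ltrDr.
Qed.

Lemma trmx_norm_le n (phi : 'cV[R]_n) : `|phi^T| <= `|phi|.
Proof. by apply: row_norm_le => // i; rewrite mxE ler_entry_norm. Qed.

Lemma continuous_within n (f : 'rV[R]_n -> R) (A : set 'rV[R]_n) :
  continuous f -> {within A, continuous f}.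
Proof. by move=> cf; apply: continuous_subspaceT. Qed.

(** The closure of [Omega] is compact, so the strict inequalities hold with a uniform margin. This
    is what makes the dual domain open. *)
Lemma dual_domain_margin (Omega : set 'rV[R]_d) y :
  bounded_set Omega -> Omega 0 -> dual_domain Omega y ->
  exists m M : R, [/\ m < 1, 0 < M & forall x, Omega x -> dotv x y <= m /\ `|x| <= M].
Proof.
move=> bO O0 Oy; have [M M0 hM] := bounded_setP bO.
have cM x : closure Omega x -> `|x| <= M.
  move=> /row_closureP cx; apply/ler_addgt0Pr => e e0.
  have [z Oz zx] := cx _ e0; rewrite -[x](subrKC z).
  by apply: le_trans (ler_normD _ _) _; rewrite lerD ?hM// distrC ltW.
have kO : compact (closure Omega).
  apply: bounded_closed_compact; last exact: closed_closure.
  exists M; split; first exact: num_real.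
  by move=> N MN x cx; apply: le_trans (cM x cx) (ltW MN).
have cy : continuous (fun x : 'rV[R]_d => dotv x y).
  by move=> x; apply: sdiff1_continuous (sdiff1_dotv y x).
have sO := @subset_closure _ Omega.
have [|c] := EVT_max_rV _ kO (continuous_within (A := closure Omega) cy).
  by exists 0; exact: sO.
rewrite inE => cc hc; exists (dotv c y), M; split => // [|x Ox]; first exact: Oy.
by split; [apply: hc; rewrite inE; exact: sO|exact: hM].
Qed.

Lemma dual_domainP (Omega : set 'rV[R]_d) y m : m < 1 ->
  (forall x, Omega x -> dotv x y <= m) -> dual_domain Omega y.
Proof.
move=> m1 h x cx; apply: le_lt_trans m1; rewrite leNgt; apply/negP => mx.
have cy := sdiff1_continuous (sdiff1_dotv y x).
have e0 : 0 < dotv x y - m by rewrite subr_gt0.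
have [r r0 hr] := (row_continuousP _ _).1 cy _ e0.
have [z Oz /hr] := (row_closureP _ _).1 cx _ r0.
by rewrite ltr_distl subKr => /andP[+ _]; rewrite ltNge h.
Qed.

Lemma dual_domain_open (Omega : set 'rV[R]_d) : bounded_set Omega -> Omega 0 ->
  open (dual_domain Omega).
Proof.
move=> bO O0; rewrite openE => y Oy; apply/row_nbhsP.
have [m [M [m1 M0 h]]] := dual_domain_margin bO O0 Oy.
pose n1 := 1 + d%:R * M; have n10 : 0 < n1 by rewrite ltr_pwDl// mulr_ge0// ltW.
pose m' := (m + 1) / 2.
exists ((m' - m) / n1); first by rewrite divr_gt0// /m'; lra.
move=> u; rewrite ltr_pdivlMr// => uy; apply: (@dual_domainP _ _ m') => [|x Ox].
  by rewrite /m'; lra.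
have [xm xM] := h x Ox.
have -> : dotv x u = dotv x y + dotv x (u - y) by rewrite dotvBr addrC subrK.
suff : dotv x (u - y) <= m' - m by lra.
apply: le_trans (ler_norm _) _; apply: le_trans (dotv_norm _ _) _.
apply: le_trans (ltW uy); rewrite mulrC ler_wpM2l//.
by rewrite /n1; apply: ler_wpDl => //; rewrite ler_wpM2l.
Qed.

Lemma pairing_covector (B : 'M[R]_(d + 1)) y (p : 'rV[R]_d) q : B \in unitmx ->
  pairing (covector B y) (row_mx p q%:M *m B) = dotv p y - q.
Proof.
move=> uB; rewrite pairing_row_mx /covector mulKVmx// trmxK row_mxKl row_mxKr.
by rewrite mxE eqxx mulrN1.
Qed.

Section adapted.
Variables (C : set V) (B : 'M[R]_(d + 1)) (Omega : set 'rV[R]_d).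
Hypothesis CB : adapted_basis C B Omega.

Lemma adapted_unitmx : B \in unitmx.
Proof. by have [B1 _ _] := CB; rewrite unitmxE B1 unitr1. Qed.

Local Notation uB := adapted_unitmx.

Lemma covector_neq0 y : covector B y != 0.
Proof.
apply/eqP => y0; have := pairing_covector y 0 1 uB.
by rewrite y0 /pairing mulmx0 mxE dotv0l => /eqP; rewrite eq_sym subr_eq0 eq_sym oner_eq0.
Qed.

Lemma adapted_cone_lt0 y v : dual_domain Omega y -> C v ->
  pairing (covector B y) v < 0.
Proof.
have [_ _ ->] := CB => Oy [t [x [t0 Ox ->]]].
rewrite pairingZ pairing_covector ?uB// pmulr_rlt0// subr_lt0.
by apply: Oy; exact: subset_closure.
Qed.

(** [dual_cone] is an interior, so a neighbourhood of forms must be nonpositive on the cone: the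
    margin 1 - m absorbs perturbations, the section of the cone at height 1 being bounded. *)
Lemma covector_P_dual y : dual_domain Omega y -> P_dual C (covector B y).
Proof.
move=> Oy; split; first exact: covector_neq0.
exists 1; first exact: oner_neq0.
have [_ [bO _ _ O0] CE] := CB.
have [m [M [m1 M0 h]]] := dual_domain_margin bO O0 Oy.
have [c c0 hc] := mulmx_bounded B.
pose n1 := (d + 1)%:R * (c * (M + 1)).
have n10 : 0 < n1 by rewrite !mulr_gt0 ?addr_gt0// ltr0n addn1.
rewrite scale1r /dual_cone /interior; apply/nbhs_ballP; exists ((1 - m) / n1).
  by rewrite /= divr_gt0// subr_gt0.
move=> phi; rewrite -ball_normE /= ltr_pdivlMr// => phic v.
rewrite CE => -[t [x [t0 Ox ->]]]; rewrite pairingZ pmulr_rle0//.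
set w := _ *m B; have [xm xM] := h x Ox.
have -> : pairing phi w = pairing (covector B y) w + pairing (phi - covector B y) w.
  by rewrite /pairing mulmxBr [X in _ = _ + X]mxE [X in _ = _ + (_ + X)]mxE addrC subrK.
rewrite pairing_covector ?uB// [X in _ + X]pairing_dotv.
suff : dotv w (phi - covector B y)^T <= 1 - m by move: xm; lra.
apply: le_trans (ler_norm _) _; apply: le_trans (dotv_norm _ _) _.
apply: le_trans (ltW phic); rewrite mulrC; apply: ler_pM => //.
- by apply: le_trans (trmx_norm_le _) _; rewrite distrC.
- rewrite /n1 ler_wpM2l//; apply: le_trans (hc _) _; rewrite ler_pM2l//.
  apply: row_norm_le => [|i]; first by rewrite addr_ge0// ltW.
  rewrite mxE; case: splitP => k _.
    by apply: le_trans (ler_coord_norm _ _) _; apply: ler_wpDr.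
  by rewrite ord1 mxE eqxx normr1 lerDr ltW.
Qed.

End adapted.

Lemma eq0_le_eps (a c : R) : (forall e : R, 0 < e -> `|a| <= c * e) -> a = 0.
Proof.
move=> h; apply/eqP; rewrite -normr_le0; apply/ler_addgt0Pr => e e0; rewrite add0r.
have c1 : 0 < 1 + `|c| by rewrite ltr_pwDl.
have e1 : 0 < e / (1 + `|c|) by rewrite divr_gt0.
apply: le_trans (h _ e1) _; rewrite mulrCA.
apply: ler_piMr; [exact: ltW|rewrite ler_pdivrMr// mul1r].
by apply: le_trans (ler_norm _) _; rewrite lerDr.
Qed.

Lemma lsubmxE m n p (w : 'M[R]_(m, n + p)) : lsubmx w = w *m col_mx 1%:M 0.
Proof. by rewrite -{2}[w]hsubmxK mul_row_col mulmx1 mulmx0 addr0. Qed.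

(** * Homographies between directions and gradients of charts *)

Section projective_map.
Context {n : nat}.
Implicit Types (M : 'M[R]_(n + 1)) (u : 'rV[R]_n).

Definition proj_denominator M u : R := rsubmx (row_mx u (-1)%:M *m M) 0 0.

(* The homography of the hyperplane of the points with last coordinate [-1]; it
   expresses the gradient of a chart at the support point in terms of the direction. *)
Definition proj_map M u : 'rV[R]_n :=
  - (proj_denominator M u)^-1 *: lsubmx (row_mx u (-1)%:M *m M).

Lemma proj_mapE M u : proj_denominator M u != 0 ->
  row_mx (proj_map M u) (-1)%:M =
  - (proj_denominator M u)^-1 *: (row_mx u (-1)%:M *m M).
Proof.
move=> b0; rewrite [X in _ = _ *: X]row_mxE scale_row_mx scale_scalar_mx.
by rewrite mulNr mulVf.
Qed.

Lemma proj_mapK M u : M \in unitmx -> proj_denominator M u != 0 ->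
  proj_denominator (invmx M) (proj_map M u) != 0 /\
  proj_map (invmx M) (proj_map M u) = u.
Proof.
move=> uM b0; have E : row_mx (proj_map M u) (-1)%:M *m invmx M =
    - (proj_denominator M u)^-1 *: row_mx u (-1)%:M.
  by rewrite proj_mapE// -scalemxAl mulmxK.
have DE : proj_denominator (invmx M) (proj_map M u) = (proj_denominator M u)^-1.
  rewrite [LHS]/proj_denominator E scale_row_mx scale_scalar_mx row_mxKr mxE eqxx.
  by rewrite mulr1n mulrN1 opprK.
split; first by rewrite DE invr_eq0.
rewrite [LHS]/proj_map DE E invrK scale_row_mx row_mxKl scalerA.
by rewrite mulrNN mulfV// scale1r.
Qed.

Lemma sdiff_row_snoc u : sdiff (fun u : 'rV[R]_n => row_mx u (-1)%:M : 'rV[R]_(n + 1)) u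
  (row_mx 1%:M 0).
Proof. by rewrite -[0]trmx0; exact: sdiff_row_mx (sdiff_id u) (sdiff1_cst _ _). Qed.

Lemma sdiff_proj_map M u : proj_denominator M u != 0 ->
  exists L, sdiff (proj_map M) u L.
Proof.
move=> b0; have sM := sdiff_mulmxr M (sdiff_row_snoc u).
have sl := sdiff_mulmxr (col_mx 1%:M 0 : 'M[R]_(n + 1, n)) sM.
have sr := (sdiff_coord _ _ _).1 sM (rshift n 0).
have br v : (row_mx v (-1)%:M *m M) 0 (rshift n 0) = proj_denominator M v.
  by rewrite /proj_denominator [RHS]mxE.
have b0' : (row_mx u (-1)%:M *m M) 0 (rshift n 0) != 0 by rewrite br.
eexists; apply: sdiff_near ltr01 _ (sdiff_scale (sdiff1N (sdiff1V b0' sr)) sl) => v _.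
by rewrite /proj_map br lsubmxE.
Qed.

(** The homography of the inverse matrix is a local inverse and also differentiable, so the chain
    rule yields invertibility without computing the derivative. *)
Lemma sdiff_proj_map_unit M u : M \in unitmx -> proj_denominator M u != 0 ->
  exists2 L, L \in unitmx & sdiff (proj_map M) u L.
Proof.
move=> uM b0; have [L sL] := sdiff_proj_map b0.
have [b0' K] := proj_mapK uM b0.
have [L' sL'] := sdiff_proj_map b0'.
exists L => //; suff : L *m L' = 1%:M by move=> /mulmx1_unit[].
have sM := sdiff_mulmxr M (sdiff_row_snoc u).
have sr := (sdiff_coord _ _ _).1 sM (rshift n 0).
have br v : (row_mx v (-1)%:M *m M) 0 (rshift n 0) = proj_denominator M v.
  by rewrite /proj_denominator [RHS]mxE.
have c0 : 0 < `|proj_denominator M u| by rewrite normr_gt0.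
have [r r0 hr] := (row_continuousP _ _).1 (sdiff1_continuous sr) _ c0.
have sid : sdiff id u (L *m L').
  apply: sdiff_near r0 _ (sdiff_comp sL sL') => v /hr; rewrite !br => vb.
  apply: (proj_mapK uM _).2; apply: contraTneq vb => ->.
  by rewrite sub0r normrN ltxx.
apply/row_matrixP => i; rewrite !rowE -(sdiff_differential _ sid).
by rewrite (sdiff_differential _ (sdiff_id u)).
Qed.

End projective_map.

(** * Support points of a C-convex domain *)

Section support_point.
Variables (C : set V) (B : 'M[R]_(d + 1)) (Omega : set 'rV[R]_d) (K : set V).
Hypotheses (CB : adapted_basis C B Omega) (CK : C_convex_domain C K) (KC : C2plus K).
Local Notation O' := (dual_domain Omega).
Local Notation cov := (covector B).
Let uB : B \in unitmx := adapted_unitmx CB.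

Lemma adapted_cone_point : C (row_mx 0 1%:M *m B).
Proof. by have [_ [_ _ _ O0] ->] := CB; exists 1, 0; rewrite scale1r. Qed.

Lemma adapted_cone_scale t v : 0 < t -> C v -> C (t *: v).
Proof.
have [_ _ ->] := CB => t0 [s [x [s0 Ox ->]]].
by exists (t * s), x; rewrite scalerA mulr_gt0.
Qed.

(** Of the two sides, the other is impossible: [K] is stable under adding vectors of the cone, along
    which the form decreases without bound. *)
Lemma supporting_le y P : O' y -> supporting_at K (cov y) P ->
  forall X, closure K X -> pairing (cov y) X <= pairing (cov y) P.
Proof.
move=> Oy [fP sP]; have [[[X KX] _ cK] KCK _ _] := CK.
have [//|h] := support_side cK sP; exfalso.
have Cv := adapted_cone_point; set v := row_mx _ _ *m B in Cv.
have v0 := adapted_cone_lt0 CB Oy Cv.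
pose t := 1 + `|(pairing (cov y) P - pairing (cov y) X) / pairing (cov y) v|.
have t0 : 0 < t by rewrite ltr_pwDl.
have KXv : K (X + t *: v).
  by rewrite -KCK; exists X => //; exists (t *: v) => //; exact: adapted_cone_scale.
have := h _ (subset_closure KXv).
have -> Z : pairing (- cov y) Z = - pairing (cov y) Z by rewrite /pairing mulmxN mxE.
rewrite lerN2 pairingD pairingZ -lerBlDl leNgt => /negP; apply.
rewrite -ltr_ndivrMr//; apply: le_lt_trans (ler_norm _) _.
by rewrite ltrDr.
Qed.

Lemma supporting_lt y P X : supporting_at K (cov y) P -> K X ->
  (forall X, closure K X -> pairing (cov y) X <= pairing (cov y) P) ->
  pairing (cov y) X < pairing (cov y) P.
Proof.
move=> [_ [_ KH _]] KX h; rewrite lt_neqAle h ?andbT; last exact: subset_closure.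
apply/eqP => XP.
suff : ([set Z | pairing (cov y) Z = pairing (cov y) P] `&` K) X by rewrite KH.
by [].
Qed.

Lemma closure_max_frontier y P X : O' y -> supporting_at K (cov y) P ->
  closure K X -> pairing (cov y) P <= pairing (cov y) X -> frontier K X.
Proof.
move=> Oy sP cX PX; have [[_ oK _] _ _ _] := CK; split => //.
move=> /interior_subset KX.
by have := supporting_lt sP KX (supporting_le Oy sP); rewrite ltNge PX.
Qed.

(* Between two support points the frontier contains a segment, along which the
   function of a chart is affine, against the definiteness of its hessian. *)
Lemma supporting_unique y P Q : O' y -> supporting_at K (cov y) P ->
  supporting_at K (cov y) Q -> P = Q.
Proof.
move=> Oy sP sQ.
have PQ : pairing (cov y) P = pairing (cov y) Q.
  apply: le_anti; rewrite !supporting_le//.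
    by have [[]] := sQ.
  by have [[]] := sP.
have [[_ _ cK] _ _ _] := CK.
have [[cP _] _] := sP; have [[cQ _] _] := sQ.
(* Parametrised from the midpoint, so that small s of both signs stay on the segment. *)
pose seg (s : R) := (P + 2^-1 *: (Q - P)) + s *: (Q - P).
have fseg s : `|s| <= 2^-1 -> frontier K (seg s).
  rewrite ler_norml => /andP[s1 s2].
  have -> : seg s = P + (2^-1 + s) *: (Q - P) by rewrite /seg scalerDl addrA.
  apply: (closure_max_frontier Oy sP); last first.
    by rewrite pairingD pairingZ pairingB PQ subrr mulr0 addr0.
  by apply: closure_convex => //; lra.
have h0 : `|0 : R| <= 2^-1 by rewrite normr0 invr_ge0.
have := fseg 0 h0; rewrite {1}/seg scale0r addr0; set M := P + _ => fM.
have [A [W [f [U [x [ch ME]]]]]] := C2plus_chart KC fM.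
have [uA oU [oW [UM Wx]] [df ddf Hpos] KU] := ch.
set u := lsubmx ((Q - P) *m invmx A).
set q := rsubmx ((Q - P) *m invmx A) 0 0.
have uqE : Q - P = row_mx u q%:M *m A by exact: mulmx_row_mxE.
(* In the chart the segment is a piece of the graph, so f is affine with slope q along u near x. *)
have [r r0 hr] : exists2 r : R, 0 < r & forall s : R, `|s| < r ->
    W (x + s *: u) /\ f (x + s *: u) = f x + s * q.
  have /row_nbhsP[e e0 eU] : nbhs M U by rewrite ME; exact: open_nbhs_nbhs.
  pose n1 := 1 + `|Q - P|; have n10 : 0 < n1 by rewrite ltr_pwDl.
  exists (Num.min 2^-1 (e / n1)).
    by rewrite lt_min invr_gt0 ltr0n divr_gt0.
  move=> s; rewrite lt_min ltr_pdivlMr// => /andP[/ltW/fseg fs se].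
  have : (frontier K `&` U) (seg s).
    split => //; apply: eU; rewrite /seg -/M addrAC subrr add0r normrZ.
    by apply: le_lt_trans se; rewrite ler_wpM2l// lerDr.
  rewrite KU => -[[z Wz zE] _].
  have : row_mx z (f z)%:M = row_mx (x + s *: u) (f x + s * q)%:M.
    apply: (can_inj (mulmxK uA)); rewrite zE /seg -/M ME uqE.
    rewrite scalemxAl -mulmxDl scale_row_mx add_row_mx; congr (row_mx _ _ *m A).
    by rewrite scale_scalar_mx -raddfD.
  move=> /eq_row_mx[<- /matrixP/(_ 0 0)]; rewrite !mxE eqxx !mulr1n => fz.
  by split => //; rewrite -fz.
have half_lt (a : R) : 0 < a -> 0 < a / 2 < a.
  by move=> a0; rewrite divr_gt0//= ltr_pdivrMr// ltr_pMr// ltr1n.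
have dq s : `|s| < r -> dotv u (gradient f (x + s *: u)) = q.
  move=> sr; have [Ws fs] := hr s sr.
  have /is_derive_epsP D := sdiff1_is_derive_line (df _ Ws) (v := u).
  apply/eqP; rewrite eq_sym -subr_eq0; apply/eqP/(@eq0_le_eps _ 1) => e e0.
  have [a a0 ha] := D e e0.
  have m0 : 0 < Num.min a (r - `|s|) by rewrite lt_min a0 subr_gt0.
  have /andP[b0] := half_lt _ m0; set b := _ / 2 in b0 *; rewrite lt_min => /andP[ba bs].
  have bn : `|b| = b by exact: gtr0_norm.
  have [|_ fb] := hr (s + b).
    by apply: le_lt_trans (ler_normD _ _) _; rewrite bn -ltrBrDl.
  have := ha b; rewrite bn => /(_ ba); rewrite fb fs.
  set D' := dotv _ _; have -> : f x + (s + b) * q - (f x + s * q) - b *: D' = b * (q - D').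
    by rewrite -[b *: D']/(b * D'); ring.
  by rewrite normrM bn mulrC ler_pM2r// mul1r.
(* The directional derivative along u is constant on the segment, so its own derivative vanishes. *)
have uH : dotv u (u *m hessian f x) = 0.
  apply: (@eq0_le_eps _ (d%:R * `|u|)) => e e0.
  have /is_derive_epsP D := sdiff_is_derive0 u (ddf x Wx).
  have [a a0 ha] := D e e0.
  have m0 : 0 < Num.min a r by rewrite lt_min a0.
  have /andP[b0] := half_lt _ m0; set b := _ / 2 in b0 *; rewrite lt_min => /andP[ba br].
  have bn : `|b| = b by exact: gtr0_norm.
  have := ha b; rewrite bn add0r => /(_ ba); set w := _ - _ => wb.
  have : dotv u w = - (b * dotv u (u *m hessian f x)).
    rewrite /w !dotvBr dotvZr dq ?bn// dq ?normr0// subrr sub0r //.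
  move=> wE; rewrite -(ler_pM2l b0).
  have -> : b * `|dotv u (u *m hessian f x)| = `|dotv u w| by rewrite wE normrN normrM bn.
  apply: le_trans (dotv_norm _ _) _; rewrite mulrCA ler_wpM2l ?mulr_ge0//.
  by rewrite mulrC.
have u0 : u = 0.
  apply/eqP; apply: contraT => u0; have := (Hpos x Wx).2 u u0.
  by rewrite dotvC uH ltxx.
have q0 : q = 0.
  have /andP[r2 rr] := half_lt _ r0.
  have [|_] := hr (r / 2); first by rewrite gtr0_norm.
  rewrite u0 scaler0 addr0 -[LHS]addr0 => /addrI/esym/eqP.
  by rewrite mulf_eq0 (gt_eqF r2) => /eqP.
apply/eqP; rewrite eq_sym -subr_eq0 uqE u0 q0.
have -> : (0%:M : 'M[R]_1) = 0 by rewrite raddf0.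
by rewrite row_mx0 mul0mx.
Qed.

Lemma supporting_closure_max y P X : O' y -> supporting_at K (cov y) P ->
  closure K X -> pairing (cov y) P <= pairing (cov y) X -> supporting_at K (cov y) X.
Proof.
move=> Oy sP cX PX; have fX := closure_max_frontier Oy sP cX PX.
have XP : pairing (cov y) X = pairing (cov y) P.
  by apply/eqP; rewrite eq_le PX andbT; exact: supporting_le Oy sP _ cX.
have [fP [c0 H _]] := sP; split => //; split => //; first by rewrite XP.
by exists X.
Qed.

(** If the tangent vectors at P form the kernel of [cov y], the form of some supporting hyperplane
    at P vanishes on that kernel, hence is a multiple of [cov y], and the multiple supports as
    well. *)
Lemma gauss_mapP y P : O' y ->
  gauss_map C K P (cov y) <-> supporting_at K (cov y) P.
Proof.
move=> Oy; split=> [[[phi _ sphi] _ TE]|sP]; last first.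
  have Py := covector_P_dual CB Oy; split => //; first by exists (cov y).
  apply: (tangent_vectors_ker KC) => //; [by case: sP|by case: sP => _ []|].
  exact: supporting_le.
have [[_ _ cK] _ _ _] := CK.
have tphi v : tangent_vectors K P v -> pairing phi v = 0.
  have [_ sH] := sphi; have [h|h] := support_side cK sH.
    exact: tangent_vectors_max.
  have NE X : pairing (- phi) X = - pairing phi X by rewrite /pairing mulmxN mxE.
  move=> /(@tangent_vectors_max _ _ _ (- phi)); rewrite !NE => H.
  by apply/eqP; rewrite -oppr_eq0 H.
have [a phiE] := pairing_colinear (covector_neq0 CB y) (psi := phi) (fun v hv =>
  tphi v (eq_ind_r (fun S : set V => S v) hv TE)).
have a0 : a != 0.
  by apply/eqP => a0; have [_ [/eqP]] := sphi; rewrite phiE a0 scale0r.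
have -> : cov y = a^-1 *: phi by rewrite phiE scalerA mulVf// scale1r.
by apply: supporting_scale; first by rewrite invr_eq0.
Qed.

Local Notation Pt := (inverse_gauss_map C K B).

Lemma inverse_gauss_map_supporting y : O' y -> supporting_at K (cov y) (Pt y).
Proof.
move=> Oy; apply/gauss_mapP => //.
suff Ex : exists P, gauss_map C K P (cov y) by exact: (xgetPex 0 Ex).
have [_ _ /(_ _ (covector_P_dual CB Oy))[c sc] _] := CK.
have [_ _ [P [/= Pc fP]]] := sc; exists P; apply/gauss_mapP => //.
by split; rewrite ?Pc.
Qed.

Lemma inverse_gauss_map_unique y P : O' y -> supporting_at K (cov y) P -> P = Pt y.
Proof.
by move=> Oy sP; exact: supporting_unique Oy sP (inverse_gauss_map_supporting Oy).
Qed.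

(** All covectors have last coordinate -1, so a change of direction is seen by the first d
    coordinates alone. *)
Lemma covectorB y u v : pairing (cov u) v - pairing (cov y) v =
  dotv (lsubmx (v *m invmx B)) (u - y).
Proof.
rewrite (mulmx_row_mxE v uB) !pairing_covector// mulmxK// row_mxKl dotvBr.
ring.
Qed.

(** The form attains its maximum on the compact intersection of the sphere with the closure of [K];
    uniqueness of the support point makes it strictly smaller than at [Pt y]. *)
Lemma supporting_sphere_gap y e : O' y -> 0 < e -> exists2 g : R, 0 < g &
  forall Z, closure K Z -> `|Z - Pt y| = e -> pairing (cov y) (Z - Pt y) <= - g.
Proof.
move=> Oy e0; have sP := inverse_gauss_map_supporting Oy.
pose S := closure K `&` [set Z : V | `|Z - Pt y| = e].
have [Sne|noS] := pselect (S !=set0); last first.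
  by exists 1 => // Z cZ Ze; exfalso; apply: noS; exists Z.
have cn : continuous (fun Z : V => `|Z - Pt y|).
  move=> Z; apply/row_continuousP => r r0; exists r => // u uZ.
  apply: le_lt_trans (ler_dist_dist _ _) _.
  by rewrite opprB addrA subrK.
have kS : compact S.
  apply: bounded_closed_compact.
    exists (`|Pt y| + e); split; first exact: num_real.
    move=> N /ltW eN Z [_ /= Ze]; apply: le_trans eN; rewrite -[Z](subrK (Pt y)).
    by apply: le_trans (ler_normD _ _) _; rewrite addrC Ze.
  apply: closedI; first exact: closed_closure.
  by apply: (@closed_comp _ _ _ [set e]) => [Z _|]; [exact: cn|exact: closed_eq].
have [Z0] := EVT_max_rV Sne kS (continuous_within (A := S) (@pairing_continuous _ _ (cov y))).
rewrite inE => -[cZ0 Z0e] hZ.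
have : pairing (cov y) Z0 < pairing (cov y) (Pt y).
  rewrite ltNge; apply/negP => PZ.
  have Z0P := inverse_gauss_map_unique Oy (supporting_closure_max Oy sP cZ0 PZ).
  by move: Z0e e0; rewrite /= -Z0P subrr normr0 => <-; rewrite ltxx.
rewrite -subr_gt0 => g0; exists (pairing (cov y) (Pt y) - pairing (cov y) Z0) => //.
move=> Z cZ Ze; rewrite pairingB opprB lerD2r; apply: hZ.
by rewrite inE.
Qed.

(* If [Pt u] left the ball of radius [e] around [Pt y], the segment joining them
   would cross the sphere at a point where the form [cov u] is larger than at [Pt y]. *)
Lemma inverse_gauss_map_continuous y : O' y -> {for y, continuous Pt}.
Proof.
move=> Oy; apply/row_continuousP => e e0.
have [_ [bO _ _ O0] _] := CB.
have /row_nbhsP[r1 r10 h1] : nbhs y O'.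
  by apply: open_nbhs_nbhs; split => //; exact: dual_domain_open.
have [g g0 hg] := supporting_sphere_gap Oy e0.
have [c c0 hc] := mulmx_bounded (invmx B).
(* Bounds the change of the form at Z - Pt y per unit of the norm of u - y, for Z on the sphere of
   radius e. *)
pose n1 := 1 + d%:R * (c * e).
have n10 : 0 < n1 by rewrite ltr_pwDl// !mulr_ge0// ltW.
exists (Num.min r1 (g / n1)) => [|u]; first by rewrite lt_min r10 divr_gt0.
rewrite lt_min ltr_pdivlMr// => /andP[/h1 Ou uy].
rewrite ltNge; apply/negP => eP.
have [[_ _ cK] _ _ _] := CK.
have sP := inverse_gauss_map_supporting Oy; have sU := inverse_gauss_map_supporting Ou.
have [[cP _] _] := sP; have [[cU _] _] := sU.
have n0 : 0 < `|Pt u - Pt y| by exact: lt_le_trans eP.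
pose s := e / `|Pt u - Pt y|.
have s0 : 0 < s by rewrite divr_gt0.
have s01 : 0 <= s <= 1 by rewrite ltW//= ler_pdivrMr// mul1r.
have cZ := closure_convex cK s01 cP cU; set Z := _ + _ in cZ.
have ZP : Z - Pt y = s *: (Pt u - Pt y) by rewrite /Z addrAC subrr add0r.
have Ze : `|Z - Pt y| = e by rewrite ZP normrZ gtr0_norm// divfK// lt0r_neq0.
have := hg Z cZ Ze.
have : 0 <= pairing (cov u) (Z - Pt y).
  by rewrite ZP pairingZ mulr_ge0// ?(ltW s0)// pairingB subr_ge0; exact: supporting_le.
have := covectorB y u (Z - Pt y); set w := dotv _ _ => wE.
suff : w < g by lra.
apply: le_lt_trans (ler_norm _) _; apply: le_lt_trans (dotv_norm _ _) _.
apply: le_lt_trans uy; rewrite mulrC ler_wpM2l//.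
apply: (@le_trans _ _ (d%:R * (c * e))); last by rewrite lerDr.
rewrite ler_wpM2l//.
apply: row_norm_le => [|i]; first by rewrite mulr_ge0// ltW.
rewrite mxE; apply: le_trans (ler_coord_norm _ _) _.
by apply: le_trans (hc _) _; rewrite Ze.
Qed.

(** The chart coordinate x(u) of the support point solves grad f (x u) = proj_map M u, by the
    first-order condition. Implicit differentiation applies since the hessian is definite and x is
    continuous, and invertibility of the derivative of the homography carries over to that of x. *)
Lemma inverse_gauss_map_sdiff_chart y : O' y ->
  exists (A : 'M[R]_(d + 1)) DP, [/\ A \in unitmx,
    lsubmx (DP *m invmx A) \in unitmx & sdiff Pt y DP].
Proof.
move=> Oy; have sP := inverse_gauss_map_supporting Oy.
have cP := inverse_gauss_map_continuous Oy.
have [fP _] := sP.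
have [A [W [f [U [x0 [ch PE]]]]]] := C2plus_chart KC fP.
have [uA oU [oW [UP _]] [df ddf Hpos] KU] := ch; rewrite -PE in UP.
pose x u := lsubmx (Pt u *m invmx A).
(* [M] changes the coordinates of a covector from the basis [B] to those of the chart. *)
pose M := (A *m invmx B)^T.
have uM : M \in unitmx by rewrite unitmx_tr unitmx_mul uA unitmx_inv.
have [_ [bO _ _ O0] _] := CB.
have /row_nbhsP[r1 r10 h1] : nbhs y O'.
  by apply: open_nbhs_nbhs; split => //; exact: dual_domain_open.
have /row_nbhsP[e e0 eU] : nbhs (Pt y) U by exact: open_nbhs_nbhs.
have [r2 r20 h2] := (row_continuousP _ _).1 cP _ e0.
pose r := Num.min r1 r2; have r0 : 0 < r by rewrite lt_min r10.
have near u : `|u - y| < r -> [/\ W (x u), Pt u = row_mx (x u) (f (x u))%:M *m A,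
    proj_denominator M u != 0 & gradient f (x u) = proj_map M u].
  rewrite lt_min => /andP[/h1 Ou /h2/eU Uu].
  have sU := inverse_gauss_map_supporting Ou.
  have : (frontier K `&` U) (Pt u) by case: sU.
  rewrite KU => -[[z Wz zP] _].
  have zE : x u = z by rewrite /x -zP mulmxK// row_mxKl.
  have chz : convex_chart K A W f U z by split => //; rewrite zP.
  have Kmax := supporting_le Ou sU; rewrite -zP in Kmax.
  have gE : (A *m cov u)^T = row_mx u (-1)%:M *m M.
    by rewrite /M /covector mulmxA trmx_mul trmxK.
  have [] := chart_gradient chz (covector_neq0 CB u) Kmax; rewrite gE => h b0.
  rewrite zE -zP; split => //; rewrite /proj_map scaleNr.
  apply: (scalerI b0); move/eqP: h; rewrite addrC addr_eq0 => /eqP ->.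
  by rewrite scalerN scalerA mulfV// scale1r.
have yr : `|y - y| < r by rewrite subrr normr0.
have [Wx PxE b0 gE] := near y yr.
have [L uL sL] := sdiff_proj_map_unit uM b0.
have cx : {for y, continuous x}.
  apply/row_continuousP => e' e'0.
  have [c c0 hc] := mulmx_bounded (invmx A).
  have [r' r'0 hr] := (row_continuousP _ _).1 cP _ (divr_gt0 e'0 c0).
  exists r' => // u /hr; rewrite ltr_pdivlMr// => uy.
  have -> : x u - x y = lsubmx ((Pt u - Pt y) *m invmx A).
    by rewrite /x mulmxBl raddfB.
  apply: le_lt_trans uy; rewrite mulrC; apply: le_trans (hc _).
  by apply: row_norm_le => // i; rewrite mxE ler_coord_norm.
have uH := pos_def_unit (Hpos _ Wx).
have sx : sdiff x y (L *m invmx (hessian f (x y))).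
  apply: (sdiff_implicit r0 _ cx (ddf _ Wx) uH sL) => u /near[_ _ _ ->].
  by [].
have sPt := sdiff_mulmxr A (sdiff_row_mx sx (sdiff1_comp sx (df _ Wx))).
have PtE u : `|u - y| < r -> row_mx (x u) (f (x u))%:M *m A = Pt u by move=> /near[].
exists A; eexists; split; [exact: uA| |exact: sdiff_near r0 PtE sPt].
by rewrite mulmxK// row_mxKl unitmx_mul uL unitmx_inv.
Qed.

(** For fixed y, the form [cov y] at [Pt u] is maximal at u = y, so it kills the derivative; this
    gives the last column J y^T. A vector killed by J is killed by the whole derivative, hence by
    its invertible part in the chart. *)
Lemma inverse_gauss_map_sdiff y : O' y ->
  exists2 J : 'M[R]_d, J \in unitmx & sdiff Pt y (row_mx J (J *m y^T) *m B).
Proof.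
move=> Oy; have [A [DP [uA uL sDP]]] := inverse_gauss_map_sdiff_chart Oy.
have [_ [bO _ _ O0] _] := CB.
have sP := inverse_gauss_map_supporting Oy.
have /row_nbhsP[r r0 hr] : nbhs y O'.
  by apply: open_nbhs_nbhs; split => //; exact: dual_domain_open.
have tg : DP *m cov y = 0.
  apply: trmx_inj; rewrite trmx_mul trmx0.
  apply: (sdiff1_local_max r0 (sdiff1_comp sDP (sdiff1_dotv (cov y)^T _))) => u /hr Ou.
  rewrite -!pairing_dotv; apply: supporting_le => //.
  by have [[]] := inverse_gauss_map_supporting Ou.
have DPE : DP = row_mx (lsubmx (DP *m invmx B)) (rsubmx (DP *m invmx B)) *m B.
  by rewrite hsubmxK mulmxKV.
move: tg; rewrite {1}DPE /covector mulmxA mulmxK// tr_row_mx mul_row_col.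
rewrite tr_scalar_mx mul_mx_scalar scaleN1r => /eqP; rewrite subr_eq0 => /eqP qE.
exists (lsubmx (DP *m invmx B)); last by rewrite qE -DPE.
apply: unitmx_inj => w wJ; apply: (unitmx_mulmx0 uL).
rewrite -mulmx_lsub mulmxA DPE -qE.
by rewrite mulmxA mul_mx_row mulmxA wJ mul0mx row_mx0 !mul0mx; apply/rowP => i; rewrite !mxE.
Qed.

(** The first d coordinates [p] of the support point are subgradients of the support function [s].
    As [p] is continuous it is the gradient of [s], so its derivative J is a hessian. *)
Lemma inverse_gauss_map_pos_def y : O' y ->
  exists2 J : 'M[R]_d, pos_def J & sdiff Pt y (row_mx J (J *m y^T) *m B).
Proof.
move=> Oy; have [J uJ sJ] := inverse_gauss_map_sdiff Oy; exists J => //.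
pose p u := lsubmx (Pt u *m invmx B).
pose s u := pairing (cov u) (Pt u).
have sp : sdiff p y J.
  have := sdiff_mulmxr (col_mx 1%:M 0 : 'M[R]_(d + 1, d)) (sdiff_mulmxr (invmx B) sJ).
  rewrite mulmxK// -lsubmxE row_mxKl; apply: sdiff_near ltr01 _ => u _.
  by rewrite /p lsubmxE.
have [_ [bO _ _ O0] _] := CB; have oO := dual_domain_open bO O0.
have sub : subgradient O' s p.
  move=> u v Ou Ov; have := covectorB u v (Pt u).
  rewrite dotvC -/(p u) => <-; rewrite addrC subrK.
  apply: supporting_le => //; first exact: inverse_gauss_map_supporting.
  by have [[]] := inverse_gauss_map_supporting Ou.
have ds z : O' z -> sdiff1 s z (p z).
  move=> Oz; apply: (subgradient_sdiff1 oO Oz sub).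
  have [J' _ sJ'] := inverse_gauss_map_sdiff Oz.
  have := sdiff_mulmxr (col_mx 1%:M 0 : 'M[R]_(d + 1, d)) (sdiff_mulmxr (invmx B) sJ').
  have -> : p = (fun u => Pt u *m invmx B *m col_mx 1%:M 0).
    by apply/funext => u; rewrite /p lsubmxE.
  exact: sdiff_continuous.
exact: subgradient_pos_def oO Oy sub ds sp uJ.
Qed.

End support_point.
End dual_domain.

(** * The Steiner formula *)

Lemma integral_exprn (R : realType) (e : R) (m : nat) : 0 < e ->
  (\int[lebesgue_measure]_(t in `]0%R, e[%classic) (t ^+ m)%:E =
   (e ^+ m.+1 / m.+1%:R)%:E)%E.
Proof.
move=> e0; pose F (t : R) := t ^+ m.+1 / m.+1%:R.
have dF (t : R) : is_derive t (1 : R) F (t ^+ m).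
  have dX : is_derive t (1 : R) (fun s : R => s ^+ m.+1) (m.+1%:R * t ^+ m).
    apply: DeriveDef; first exact: exprn_derivable.
    by rewrite exp_derive /= [LHS]mulr1.
  rewrite /F; apply: is_derive_eq.
  by rewrite !scaler0 add0r -[LHS]/(_ * _) mulKf// pnatr_eq0.
have cF (t : R) : {for t, continuous F}.
  by apply: differentiable_continuous; apply/derivable1_diffP; case: (dF t).
have cX (t : R) : {for t, continuous (fun s : R => s ^+ m)} by exact: exprn_continuous.
have mX : measurable_fun setT (EFin \o (fun t : R => t ^+ m)).
  by apply/measurable_EFinP; exact: measurable_funX.
rewrite -(@integral_itv_bndoo _ 0 e _ true false); last exact: measurable_funTS.
rewrite (@continuous_FTC2 _ _ F)//.
- by rewrite /F expr0n mul0r sube0.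
- by apply: continuous_subspaceT => t; exact: cX.
- split=> [t _|?|]; [by case: (dF t)|by apply: cvg_at_right_filter; exact: cF|].
  by apply: cvg_at_left_filter; exact: cF.
- by move=> t _; rewrite derive1E; case: (dF t).
Qed.

(** * Radon measures on open sets *)

Section radon.
Context {R : realType} {n : nat}.
Implicit Types (U : set 'rV[R]_n) (mu : {measure set (borel R n) -> \bar R}).

Lemma measure_exhaustion U (A : (set 'rV[R]_n)^nat) mu (b : set (borel R n)) :
  (forall k, compact (A k)) -> nondecreasing_seq A -> \bigcup_k A k = U ->
  measurable b -> b `<=` U -> mu (b `&` A k) @[k --> \oo] --> mu b.
Proof.
move=> kA ndA AU mb bU; have mA k : measurable (b `&` A k : set (borel R n)).
  by apply: measurableI => //; exact: borel_compact.
have bE : b = \bigcup_k (b `&` A k) by rewrite -setI_bigcupr AU; apply/esym/setIidPl.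
rewrite {2}bE; apply: nondecreasing_cvg_mu => //; first by rewrite -bE.
by move=> k l kl; apply/subsetPset; apply: setIS; apply/subsetPset; exact: ndA.
Qed.

(** Exhaust [U] by compact sets; on each of them the measure is finite, hence regular, and a closed
    subset of a compact set is compact. *)
Lemma radon_on_finite U mu : open U ->
  (forall A : set 'rV[R]_n, compact A -> A `<=` U -> (mu A < +oo)%E) -> radon_on U mu.
Proof.
move=> oU fin; split => // b mb bU.
have [A [kA ndA AU]] := open_sigma_compact oU.
apply/le_anti/andP; split; last first.
  apply: ge_ereal_sup => _ [F [kF Fb] <-]; apply: le_measure => //; rewrite inE//.
  exact: borel_compact.
have cb := measure_exhaustion (mu := mu) kA ndA AU mb bU.
set s := ereal_sup _; suff h k : (mu (b `&` A k) <= s)%E.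
  rewrite -(cvg_lim _ cb)//; apply: lime_le; first by apply: cvgP cb.
  by apply: nearW => k; exact: h.
have mA : measurable (A k : set (borel R n)) by exact: borel_compact.
have mid : measurable_fun (A k : set (borel R n)) (id : borel R n -> borel R n).
  exact: measurable_id.
have [nu nuE] := image_measure mu mA mid.
have nufin : (nu setT < +oo)%E.
  by rewrite nuE preimage_setT setIT; apply: fin => //; rewrite -AU; exact: bigcup_sup.
have mbA : measurable (b `&` A k) by exact: measurableI.
apply/lee_addgt0Pr => e e0.
have [F [G [cF oG Fb bG GF]]] := finite_measure_regular nufin mbA e0.
have kF : compact F.
  apply: (subclosed_compact cF (kA k)) => x /Fb[].
  by [].
have mF : measurable (F : set (borel R n)) by exact: borel_compact.
apply: (@le_trans _ _ (mu F + nu (G `\` F))%E).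
  have mGF : measurable (G `\` F : set (borel R n)).
    by apply: measurableD => //; exact: borel_open.
  rewrite nuE; apply: le_trans (measureU2 _ _ _) => //; last exact: measurableI.
  apply: le_measure; rewrite ?inE//.
    by apply: measurableU => //; exact: measurableI.
  move=> x [bx Ax]; have [Fx|nFx] := pselect (F x); [by left|right].
  by split => //; split => //; apply: bG.
apply: leeD; last exact: ltW.
by apply: ereal_sup_ubound; exists F => //; split => // x /Fb[].
Qed.

End radon.

(** * The affine sphere and the principal radii *)

Section curvature.
Context {R : realType} {d : nat}.
Local Notation V := 'rV[R]_(d + 1).
Variables (C : set V) (B : 'M[R]_(d + 1)) (Omega : set 'rV[R]_d) (K : set V)
  (omega : 'rV[R]_d -> R).
Hypotheses (CB : adapted_basis C B Omega) (CK : C_convex_domain C K) (KC : C2plus K)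
  (CY : cheng_yau Omega omega).
Local Notation O' := (dual_domain Omega).
Local Notation cov := (covector B).
Local Notation Pt := (inverse_gauss_map C K B).
Local Notation N := (affine_sphere B omega).
Let uB : B \in unitmx := adapted_unitmx CB.

Lemma adapted_dual_open : open O'.
Proof. by have [_ [bO _ _ O0] _] := CB; exact: dual_domain_open. Qed.

Lemma cheng_yau_sdiff y : O' y ->
  sdiff1 omega y (gradient omega y) /\ sdiff (gradient omega) y (hessian omega y).
Proof. by have [so _ _ _ _] := CY => Oy; exact: Ck2_sdiff adapted_dual_open (so 2%N) _ Oy. Qed.

Lemma cheng_yau_subgradient : subgradient O' omega (gradient omega).
Proof.
have [_ co _ _ _] := CY => u v Ou Ov.
exact: convex_gradient_le co Ou Ov (cheng_yau_sdiff Ou).1.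
Qed.

(** Convexity gives semidefiniteness, and the Monge-Ampere equation a nonzero determinant. *)
Lemma cheng_yau_pos_def y : O' y -> pos_def (hessian omega y).
Proof.
have [_ _ o0 oD _] := CY => Oy.
apply: (subgradient_pos_def adapted_dual_open Oy cheng_yau_subgradient).
- by move=> z /cheng_yau_sdiff[].
- by have [] := cheng_yau_sdiff Oy.
- by rewrite unitmxE oD// unitrV unitrX// unitfE oppr_eq0 lt_eqF ?o0.
Qed.

(** The gradient of omega produced by the product rule cancels against that of - omega, leaving a
    derivative of the same form as that of the inverse Gauss map. *)
Lemma affine_sphere_sdiff y : O' y ->
  sdiff N y (row_mx (hessian omega y) (hessian omega y *m y^T) *m B).
Proof.
move=> Oy; have [d1 d2] := cheng_yau_sdiff Oy.
apply: sdiff_mulmxr; have := sdiff_row_mx d2 (sdiff1B (sdiff1_dotv2 d2 (sdiff_id y)) d1).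
by rewrite trmx1 mulmx1 addrAC subrr add0r trmx_mul trmxK.
Qed.

(** The left-hand side is the value at z of the tangent of omega at y, which lies below the convex
    function omega. *)
Lemma affine_sphere_pairing y z : O' y -> O' z -> pairing (cov z) (N y) <= omega z.
Proof.
move=> Oy Oz; rewrite pairing_covector// opprB addrCA -dotvBr dotvC addrC.
rewrite addrC; exact: cheng_yau_subgradient.
Qed.

Lemma affine_sphere_pairing_id y : pairing (cov y) (N y) = omega y.
Proof. by rewrite pairing_covector// opprB addrCA subrr addr0. Qed.

Local Notation k := (principal_curvatures C K B omega).

(** [shape_operator] is chosen with default 0, so some endomorphism must be shown to satisfy the
    defining identity: H J^-1 does, both differentials having the form (Z, Z y^T) B. *)
Lemma shape_operatorP y J : O' y -> pos_def J ->
  sdiff Pt y (row_mx J (J *m y^T) *m B) ->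
  hessian omega y = shape_operator C K B omega y *m J.
Proof.
move=> Oy pJ sJ; have sN := affine_sphere_sdiff Oy; have uJ := pos_def_unit pJ.
suff : forall X : 'rV[R]_d, 'd N y X = 'd Pt y (X *m shape_operator C K B omega y).
  move=> h; apply/row_matrixP => i; rewrite !rowE.
  have := etrans (esym (sdiff_differential (delta_mx 0 i) sN))
    (etrans (h (delta_mx 0 i)) (sdiff_differential _ sJ)).
  rewrite !mulmxA => /(can_inj (mulmxK uB)).
  by rewrite !mul_mx_row => /eq_row_mx[-> _].
have Ex : exists S : 'M[R]_d, forall X : 'rV[R]_d, 'd N y X = 'd Pt y (X *m S).
  exists (hessian omega y *m invmx J) => X.
  apply: etrans (sdiff_differential X sN) (etrans _ (esym (sdiff_differential _ sJ))).
  by rewrite !mulmxA !mul_mx_row !mulmxA !mulmxKV.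
exact: (xgetPex 0 Ex).
Qed.

Lemma principal_curvaturesP y J : O' y -> pos_def J ->
  sdiff Pt y (row_mx J (J *m y^T) *m B) ->
  char_poly (shape_operator C K B omega y) = \prod_(j < d) ('X - (k y j)%:P).
Proof.
move=> Oy pJ sJ.
have Ex := pos_def_char_poly_split (cheng_yau_pos_def Oy) pJ (shape_operatorP Oy pJ sJ).
exact: (xgetPex 0 Ex).
Qed.

Lemma principal_curvatures_gt0 y j : O' y -> 0 < k y j.
Proof.
move=> Oy; have [J pJ sJ] := inverse_gauss_map_pos_def CB CK KC Oy.
apply: (pos_def_root (cheng_yau_pos_def Oy) pJ (shape_operatorP Oy pJ sJ)).
rewrite (principal_curvaturesP Oy pJ sJ) /root horner_prod (bigD1 j)//=.
by rewrite hornerXsubC subrr mul0r.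
Qed.

Local Notation r := (principal_radius C K B omega).

Lemma principal_radius_gt0 y j : O' y -> 0 < r y j.
Proof. by move=> Oy; rewrite invr_gt0 principal_curvatures_gt0. Qed.

Lemma det_principal_radius y J t : O' y -> pos_def J ->
  sdiff Pt y (row_mx J (J *m y^T) *m B) ->
  \det (J + t *: hessian omega y) = (- omega y) ^- d.+2 * \prod_(j < d) (r y j + t).
Proof.
move=> Oy pJ sJ; have [_ _ _ oD _] := CY.
rewrite (det_add_scale t (shape_operatorP Oy pJ sJ) (pos_def_unit pJ)
  (principal_curvaturesP Oy pJ sJ)) => [|j].
  by rewrite oD.
by rewrite gt_eqF// principal_curvatures_gt0.
Qed.

Lemma sigma_gt0 (i : 'I_d.+1) y : O' y -> 0 < sigma C K B omega i y.
Proof.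
move=> Oy; have id : (i <= d)%N by rewrite -ltnS.
rewrite /sigma mulr_gt0 ?invr_gt0 ?ltr0n ?bin_gt0//.
(* One index set of size i is enough for the sum of positive products to be nonzero. *)
pose J0 : {set 'I_d} := finset (fun j : 'I_d => (j < i)%N).
have J0i : #|J0| == i.
  rewrite cardsE -sum1_card (eq_bigl (fun j : 'I_d => (j < i)%N))//.
  by rewrite (big_ord_narrow id) sum_nat_const card_ord muln1.
have pr (J : {set 'I_d}) : 0 < \prod_(j in J) r y j.
  by apply: prodr_gt0 => j _; exact: principal_radius_gt0.
rewrite (bigD1 J0)//= ltr_pwDl//; apply: sumr_ge0 => J _; exact: ltW.
Qed.

End curvature.

(** * The Steiner map, its volume and the coefficient measures *)

Section steiner.
Context {R : realType} {d : nat}.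
Local Notation V := 'rV[R]_(d + 1).
Local Notation lam n := (lebesgue_row n : {measure set (borel R n) -> \bar R}).
Variables (C : set V) (B : 'M[R]_(d + 1)) (Omega : set 'rV[R]_d) (K : set V)
  (omega : 'rV[R]_d -> R).
Hypotheses (CB : adapted_basis C B Omega) (CK : C_convex_domain C K) (KC : C2plus K)
  (CY : cheng_yau Omega omega).
Local Notation O' := (dual_domain Omega).
Local Notation cov := (covector B).
Local Notation Pt := (inverse_gauss_map C K B).
Local Notation N := (affine_sphere B omega).
Local Notation r := (principal_radius C K B omega).
Let uB : B \in unitmx := adapted_unitmx CB.

Lemma covector_inj y z (a : R) : cov y = a *: cov z -> y = z.
Proof.
have iB : invmx B \in unitmx by rewrite unitmx_inv.
move=> yz; have : row_mx y (-1)%:M = a *: row_mx z (-1)%:M :> 'rV[R]_(d + 1).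
  apply: trmx_inj; rewrite linearZ /=.
  by apply: (can_inj (mulKmx iB)); rewrite -scalemxAr.
move=> E; have : row_mx y (-1)%:M = row_mx (a *: z) (- a)%:M :> 'rV[R]_(d + 1).
  by rewrite E scale_row_mx scale_scalar_mx mulrN1.
move=> /eq_row_mx[-> /matrixP/(_ 0 0)]; rewrite !mxE eqxx !mulr1n => /oppr_inj <-.
by rewrite scale1r.
Qed.

Definition steiner_map (u : V) : V :=
  Pt (lsubmx u) + rsubmx u 0 0 *: N (lsubmx u).

Definition steiner_domain : set V := [set u | O' (lsubmx u) /\ 0 < rsubmx u 0 0].

(* The support function of [P + t N(y)] in the direction [z] is at most
   [s(z) + t omega(z)], with equality for [z = y]. *)
Lemma steiner_map_inj : set_inj steiner_domain steiner_map.
Proof.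
have [_ _ o0 _ _] := CY.
have main u v : steiner_domain u -> steiner_domain v -> steiner_map u = steiner_map v ->
    rsubmx v 0 0 <= rsubmx u 0 0 /\
    (rsubmx u 0 0 = rsubmx v 0 0 -> lsubmx u = lsubmx v).
  move=> [Ou u0] [Ov v0]; rewrite /steiner_map => E.
  set y := lsubmx u in Ou E *; set z := lsubmx v in Ov E *.
  set s := rsubmx u 0 0 in u0 E *; set t := rsubmx v 0 0 in v0 E *.
  have sU := inverse_gauss_map_supporting CB CK KC Ou.
  have sV := inverse_gauss_map_supporting CB CK KC Ov.
  have [[cV _] _] := sV.
  have h1 := supporting_le CB CK Ou sU cV.
  have h2 := affine_sphere_pairing CB CY Ov Ou.
  have Ep : pairing (cov y) (Pt y) + s * omega y =
      pairing (cov y) (Pt z) + t * pairing (cov y) (N z).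
    by rewrite -(affine_sphere_pairing_id omega CB y) -!pairingZ -!pairingD E.
  have h3 : t * pairing (cov y) (N z) <= t * omega y by rewrite ler_pM2l.
  (* The equality and the two bounds give s omega(y) <= t omega(y), and omega(y) is negative.
     Applying this to both orders of u and v will give s = t. *)
  split; first by rewrite -(ler_nM2r (o0 y Ou)); lra.
  (* For equal heights [Pt z] also supports in the direction y. The kernels of [cov y] and [cov z]
     are then the same set of tangent vectors, so the covectors are proportional, and equal by their
     last coordinate. *)
  move=> st; have PP : pairing (cov y) (Pt y) <= pairing (cov y) (Pt z).
    by rewrite st in Ep; lra.
  have sy := supporting_closure_max CB CK Ou sU cV PP.
  have [_ _ T1] := (gauss_mapP CB CK KC _ Ou).2 sy.
  have [_ _ T2] := (gauss_mapP CB CK KC _ Ov).2 sV.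
  have [a] := pairing_colinear (covector_neq0 CB z) (psi := cov y) (fun w hw =>
    eq_ind (tangent_vectors K (Pt z)) (fun S : set V => S w)
      (eq_ind_r (fun S : set V => S w) hw T2) _ T1).
  exact: covector_inj.
move=> u v; rewrite !inE => Eu Ev uv.
have [h1 h1'] := main u v Eu Ev uv; have [h2 _] := main v u Ev Eu (esym uv).
have rE : rsubmx u 0 0 = rsubmx v 0 0 by apply: le_anti; rewrite h1 h2.
by rewrite (row_mxE u) (row_mxE v) rE h1'.
Qed.

Lemma steiner_map_sdiff u J : O' (lsubmx u) ->
  sdiff Pt (lsubmx u) (row_mx J (J *m (lsubmx u)^T) *m B) ->
  let M := J + rsubmx u 0 0 *: hessian omega (lsubmx u) in
  exists2 D, sdiff steiner_map u D & \det D = \det M * - omega (lsubmx u).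
Proof.
move=> Ou sJ M; have sN := affine_sphere_sdiff CB CY Ou.
set y := lsubmx u in Ou sJ M sN *.
pose E : 'M[R]_(d + 1, d) := col_mx 1%:M 0.
have sE : sdiff (fun u : V => lsubmx u) u E.
  have := sdiff_mulmxr E (sdiff_id u); rewrite mul1mx.
  by apply: sdiff_near ltr01 _ => v _; rewrite lsubmxE.
have sr : sdiff1 (fun u : V => rsubmx u 0 0) u (row_mx 0 1%:M).
  apply: sdiff1_near ltr01 _ (sdiff1_dotv (row_mx 0 1%:M) u) => v _.
  rewrite /dotv -{1}[v]hsubmxK tr_row_mx mul_row_col trmx0 mulmx0 add0r trmx1 mulmx1.
  by [].
have sS := sdiffD (sdiff_comp sE sJ) (sdiff_scale sr (sdiff_comp sE sN)).
eexists; first exact: sS.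
rewrite -/y.
(* The last column is the product of the others with y^T, except for the corner - omega; a unipotent
   shear removes it and leaves a block triangular matrix. *)
have -> : E *m (row_mx J (J *m y^T) *m B) + (rsubmx u 0 0 *: (E *m (row_mx (hessian omega y)
    (hessian omega y *m y^T) *m B)) + (row_mx 0 1%:M)^T *m N y) =
    block_mx M 0 (gradient omega y) (- omega y)%:M *m block_mx 1%:M y^T 0 1%:M *m B.
  rewrite /affine_sphere !mulmxA scalemxAl -!mulmxDl; congr (_ *m B).
  rewrite mulmx_block !mulmx1 !mulmx0 !addr0 tr_row_mx trmx0 trmx1.
  rewrite /E !mul_col_mx !mul1mx !mul0mx scale_col_mx !scaler0 !add_col_mx !add0r !addr0.
  rewrite /block_mx; congr col_mx.
    by rewrite scale_row_mx add_row_mx scalemxAl -mulmxDl.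
  congr row_mx; apply/matrixP => i j; rewrite !ord1 !mxE eqxx !mulr1n.
  by rewrite /dotv mxE.
have [B1 _ _] := CB.
by rewrite !det_mulmx det_lblock det_ublock !det1 !mulr1 det_scalar1 B1 mulr1.
Qed.

Local Notation f i y := (sigma C K B omega i y * affine_sphere_density omega y).

Definition jacobian (y : 'rV[R]_d) (t : R) : R :=
  (- omega y) ^- d.+2 * \prod_(j < d) (r y j + t) * - omega y.

(** The binomial coefficient undoes the normalisation of [sigma], and the factor - omega lowers the
    exponent d + 2 to that of the canonical volume. *)
Lemma jacobian_expand y t : O' y ->
  jacobian y t = \sum_(i < d.+1) 'C(d, i)%:R * t ^+ (d - i) * f i y.
Proof.
have [_ _ o0 _ _] := CY => Oy; rewrite /jacobian prod_add_expand.
have w0 : - omega y != 0 by rewrite oppr_eq0 lt_eqF// o0.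
have wE : (- omega y) ^- d.+2 * - omega y = (- omega y) ^- d.+1.
  by rewrite exprS invfM mulrAC mulVf// mul1r.
rewrite mulrAC wE mulr_sumr; apply: eq_bigr => i _.
have C0 : 'C(d, i)%:R != 0 :> R by rewrite pnatr_eq0 -lt0n bin_gt0 -ltnS.
rewrite /sigma /affine_sphere_density; set e := \sum_(J | _) _.
move: (_ ^- _) (t ^+ _) => W T.
by rewrite -!mulrA (mulrCA T) (mulVKf C0) [RHS]mulrA [RHS]mulrC.
Qed.

Lemma density_ge0 (i : 'I_d.+1) y : O' y -> 0 <= f i y.
Proof.
have [_ _ o0 _ _] := CY => Oy; rewrite mulr_ge0//.
  by rewrite ltW// (sigma_gt0 CB CK KC CY).
by rewrite invr_ge0 exprn_ge0// oppr_ge0 ltW// o0.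
Qed.

Lemma jacobian_gt0 y t : O' y -> 0 < t -> 0 < jacobian y t.
Proof.
have [_ _ o0 _ _] := CY => Oy t0; have w0 : 0 < - omega y by rewrite oppr_gt0 o0.
rewrite !mulr_gt0// ?invr_gt0 ?exprn_gt0//; apply: prodr_gt0 => j _.
by rewrite addr_gt0// (principal_radius_gt0 CB CK KC CY).
Qed.

Lemma inverse_gauss_map_jacobian : exists J : 'rV[R]_d -> 'M[R]_d,
  forall y, O' y -> pos_def (J y) /\ sdiff Pt y (row_mx (J y) (J y *m y^T) *m B).
Proof.
have Ex (y : 'rV[R]_d) : exists J : 'M[R]_d, O' y ->
    pos_def J /\ sdiff Pt y (row_mx J (J *m y^T) *m B).
  have [Oy|nO] := pselect (O' y); last by exists 0.
  by have [J pJ sJ] := inverse_gauss_map_pos_def CB CK KC Oy; exists J.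
by have [J hJ] := choice Ex; exists J.
Qed.

(** The radii are chosen independently at each point, so continuity is obtained from the determinant
    of J + t H, whose entries are continuous as entries of strict derivatives. *)
Lemma jacobian_continuous t y : O' y -> {for y, continuous (jacobian ^~ t)}.
Proof.
move=> Oy; have [J hJ] := inverse_gauss_map_jacobian.
have oO := adapted_dual_open CB.
have /row_nbhsP[q q0 hq] : nbhs y O' by exact: open_nbhs_nbhs.
have cE (F : 'rV[R]_d -> V) (D : 'rV[R]_d -> 'M[R]_d) :
    (forall z, O' z -> sdiff F z (row_mx (D z) (D z *m z^T) *m B)) ->
    forall i j, {for y, continuous (fun z => D z i j)}.
  move=> sF i j; apply/row_continuousP => e e0.
  have sFB z : O' z -> sdiff (fun u => F u *m invmx B) z (row_mx (D z) (D z *m z^T)).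
    by move=> Oz; have := sdiff_mulmxr (invmx B) (sF z Oz); rewrite mulmxK.
  have [s s0 hs] := sdiff_close sFB Oy e0.
  exists (Num.min s q) => [|u]; first by rewrite lt_min s0.
  rewrite lt_min => /andP[us /hq Ou].
  by have := hs u Ou us i (lshift 1 j); rewrite !row_mxEl.
pose G y := \det (J y + t *: hessian omega y) * - omega y.
have GE z : O' z -> G z = jacobian z t.
  by move=> Oz; have [pJ sJ] := hJ z Oz; rewrite /G (det_principal_radius CB CK KC CY t Oz pJ sJ).
suff /row_continuousP cG : {for y, continuous G}.
  apply/row_continuousP => e /cG[s s0 hs].
  exists (Num.min s q) => [|u]; first by rewrite lt_min s0.
  by rewrite lt_min => /andP[/hs us /hq Ou]; rewrite -!GE.
apply: (@continuousM _ _ (fun y => \det (J y + t *: hessian omega y)) (fun y => - omega y)).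
  apply: det_continuous => i j.
  have -> : (fun z => (J z + t *: hessian omega z) i j) =
      (fun z => J z i j) \+ ((fun=> t) \* (fun z => hessian omega z i j)).
    by apply/funext => z; rewrite [LHS]mxE [X in _ + X]mxE.
  apply: continuousD; first by apply: (cE Pt) => // z /hJ[].
  apply: continuousM; first exact: cst_continuous.
  by apply: (cE N) => // z Oz; exact: (affine_sphere_sdiff CB CY).
by apply: continuousN; apply: sdiff1_continuous (cheng_yau_sdiff CB CY Oy).1.
Qed.

(** The jacobian is a polynomial in t with the densities as coefficients, so each density is a fixed
    linear combination of the continuous functions [jacobian ^~ t] for t = 1, ..., d + 1. *)
Lemma density_measurable (i : 'I_d.+1) :
  measurable_fun (O' : set (borel R d)) ((fun y => f i y) : borel R d -> measurableTypeR R).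
Proof.
have [c hc] := @vandermonde_inverse R d.
(* The reversal of indices comes from density i being the coefficient of t^(d - i). *)
pose G (y : borel R d) := 'C(d, i)%:R^-1 * \sum_k c (rev_ord i) k * jacobian y k.+1%:R.
apply: (@eq_measurable_fun _ _ (borel R d) (measurableTypeR R) O' G) => [y|].
  rewrite inE => Oy; rewrite /G.
  have C0 : 'C(d, i)%:R != 0 :> R by rewrite pnatr_eq0 -lt0n bin_gt0 -ltnS.
  apply: (mulfI C0); rewrite mulVKf//.
  have := hc (fun j => 'C(d, rev_ord j)%:R * f (rev_ord j) y) (rev_ord i).
  rewrite rev_ordK => ->; apply: eq_bigr => k _; congr (_ * _).
  rewrite jacobian_expand// (reindex_inj rev_ord_inj); apply: eq_bigr => j _.
  rewrite mulrAC; congr (_ * _ ^+ _ ).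
  by rewrite /= subSS subKn// -ltnS.
apply: measurable_funM; first exact: measurable_cst.
apply: measurable_sum => k; apply: measurable_funM; first exact: measurable_cst.
apply: measurable_continuous_open; first exact: adapted_dual_open CB.
by move=> y; exact: jacobian_continuous.
Qed.

Lemma density_measurableS (i : 'I_d.+1) (b : set (borel R d)) : b `<=` O' ->
  measurable_fun b ((fun y => f i y) : borel R d -> measurableTypeR R).
Proof.
move=> bO; apply: (measurable_funS _ bO (density_measurable i)).
by apply: borel_open; exact: adapted_dual_open CB.
Qed.

Lemma one_sided_nbhdE (e : R) (b : set 'rV[R]_d) : b `<=` O' ->
  one_sided_nbhd K B omega e b =
  steiner_map @` [set u | b (lsubmx u) /\ 0 < rsubmx u 0 0 < e].
Proof.
move=> bO; apply/seteqP; split => X.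
  move=> [y [P [t [by_ sP t0 ->]]]]; exists (row_mx y t%:M).
    by rewrite /= row_mxKl row_mxKr mxE eqxx mulr1n.
  rewrite /steiner_map row_mxKl row_mxKr mxE eqxx mulr1n.
  by rewrite -(inverse_gauss_map_unique CB CK KC (bO _ by_) sP).
move=> [u [bu u0] <-].
exists (lsubmx u), (Pt (lsubmx u)), (rsubmx u 0 0); split => //.
have Ou := bO _ bu; exact: (inverse_gauss_map_supporting CB CK KC Ou).
Qed.

Lemma lsubmx_continuous : continuous (fun u : V => lsubmx u : 'rV[R]_d).
Proof.
have -> : (fun u : V => lsubmx u : 'rV[R]_d) = (fun u => u *m col_mx 1%:M 0).
  by apply/funext => u; rewrite lsubmxE.
exact: mulmxr_continuous.
Qed.

Lemma steiner_domain_open : open steiner_domain.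
Proof.
apply: (@openI _ [set u : V | O' (lsubmx u)] [set u : V | 0 < rsubmx u 0 0]).
  apply: (@open_comp _ _ (fun u : V => lsubmx u)); last exact: adapted_dual_open CB.
  by move=> u _; exact: lsubmx_continuous.
have -> : [set u : V | 0 < rsubmx u 0 0] = (fun u : V => u 0 (rshift d 0)) @^-1` [set x | 0 < x].
  by apply/seteqP; split => u /=; rewrite mxE.
by apply: open_comp => [u _|]; [exact: coord_continuous|exact: open_gt].
Qed.

Lemma steiner_map_derivative : exists D : V -> 'M[R]_(d + 1),
  forall u, steiner_domain u -> sdiff steiner_map u (D u) /\
    \det (D u) = jacobian (lsubmx u) (rsubmx u 0 0).
Proof.
have [J hJ] := inverse_gauss_map_jacobian.
have Ex (u : V) : exists D : 'M[R]_(d + 1), steiner_domain u ->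
    sdiff steiner_map u D /\ \det D = jacobian (lsubmx u) (rsubmx u 0 0).
  have [[Ou u0]|nu] := pselect (steiner_domain u); last by exists 0.
  have [pJ sJ] := hJ _ Ou; have [D sD DE] := steiner_map_sdiff Ou sJ.
  by exists D => _; split => //; rewrite DE (det_principal_radius CB CK KC CY _ Ou pJ sJ).
by have [D hD] := choice Ex; exists D.
Qed.

Lemma measurable_lsubmx : measurable_fun setT
  ((fun u : V => lsubmx u : 'rV[R]_d) : borel R (d + 1) -> borel R d).
Proof.
have -> : (fun u : V => lsubmx u : 'rV[R]_d) = (fun u => u *m col_mx 1%:M 0).
  by apply/funext => u; rewrite lsubmxE.
by move=> _ A mA; rewrite setTI; exact: measurable_mulmxr.
Qed.

Lemma measurable_rsubmx : measurable_fun setT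
  ((fun u : V => rsubmx u 0 0) : borel R (d + 1) -> measurableTypeR R).
Proof.
have -> : (fun u : V => rsubmx u 0 0) = (fun u => u 0 (rshift d 0)).
  by apply/funext => u; rewrite mxE.
exact: measurable_coord.
Qed.

Lemma volume_one_sided_nbhd (e : R) (b : set (borel R d)) :
  0 < e -> measurable b -> b `<=` O' ->
  (lam (d + 1) (one_sided_nbhd K B omega e b) =
   \sum_(i < d.+1) ('C(d, i)%:R * (e ^+ (d - i).+1 / (d - i).+1%:R))%R%:E *
     \int[lam d]_(y in b) (f i y)%R%:E)%E.
Proof.
move=> e0 mb bO; rewrite one_sided_nbhdE//; set D := [set u | _].
have [DF hDF] := steiner_map_derivative.
have DE : D `<=` steiner_domain by move=> u [/bO Ou /andP[u0 _]].
pose I : set (measurableTypeR R) := `]0, e[%classic.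
have mI : measurable I by exact: measurable_itv.
have mD : measurable (D : set (borel R (d + 1))).
  have -> : D = ((fun u : borel R (d + 1) => (lsubmx (u : V) : borel R d)) @^-1` b) `&`
      ((fun u : borel R (d + 1) => (rsubmx (u : V) 0 0 : measurableTypeR R)) @^-1` I).
    by apply/seteqP; split => u; rewrite /I /= in_itv.
  apply: measurableI; rewrite -[X in measurable X]setTI.
    exact: measurable_lsubmx.
  exact: measurable_rsubmx.
have [|_ ->] := change_of_variables steiner_domain_open (fun u Eu => (hDF u Eu).1) _
    steiner_map_inj mD DE.
  move=> u [Ou u0]; rewrite unitmxE (hDF u (conj Ou u0)).2 unitfE.
  by rewrite gt_eqF// jacobian_gt0.
pose G (u : V) := \sum_(i < d.+1) 'C(d, i)%:R * rsubmx u 0 0 ^+ (d - i) * f i (lsubmx u).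
have DG u : D u -> `|\det (DF u)| = G u.
  move=> /DE[Ou u0]; rewrite (hDF u (conj Ou u0)).2 gtr0_norm ?jacobian_gt0//.
  exact: jacobian_expand.
have -> : (\int[lam (d + 1)]_(u in D) (`|\det (DF u)|)%:E =
    \int[lam (d + 1)]_(u in D) (G u)%:E)%E.
  by apply: eq_integral => u; rewrite inE => /DG ->.
have mf i := density_measurableS i bO.
have mG : measurable_fun (D : set (borel R (d + 1))) (fun u : borel R (d + 1) => (G u)%:E).
  apply/measurable_EFinP; apply: measurable_sum => i.
  apply: measurable_funM.
    apply: measurable_funM; first exact: measurable_cst.
    by apply: measurable_funX; apply: measurable_funTS; exact: measurable_rsubmx.
  apply: (@measurable_comp _ _ _ _ _ _ b (fun y : borel R d => f i y)
    _ (fun u : borel R (d + 1) => lsubmx (u : V))) => //.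
  - by move=> _ [u [bu _] <-].
  - exact: mf.
  - by apply: measurable_funTS; exact: measurable_lsubmx.
rewrite (lebesgue_row_fubini (b := b) (I := I))//; last 2 first.
- apply/seteqP; split => -[y t]; rewrite /D /I /row_snoc /= in_itv /= row_mxKl row_mxKr;
    by rewrite mxE eqxx mulr1n.
- by move=> u /DG <-; rewrite lee_fin.
pose ci (i : 'I_d.+1) : R := 'C(d, i)%:R * (e ^+ (d - i).+1 / (d - i).+1%:R).
have ci0 i : 0 <= ci i by rewrite mulr_ge0// divr_ge0// exprn_ge0// ltW.
transitivity (\int[lam d]_(y in b) \sum_(i < d.+1) ((ci i)%:E * (f i y)%R%:E))%E.
  apply: eq_integral => y; rewrite inE => /bO Oy.
  transitivity (\int[lebesgue_measure]_(t in I) \sum_(i < d.+1)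
      (('C(d, i)%:R * f i y)%R%:E * (t ^+ (d - i))%R%:E))%E.
    apply: eq_integral => t _; rewrite /G /row_snoc /= row_mxKl row_mxKr mxE eqxx mulr1n.
    rewrite -sumEFin; apply: eq_bigr => i _; rewrite -EFinM; congr EFin.
    by rewrite mulrAC.
  have mX n : measurable_fun I (fun t : measurableTypeR R => (t ^+ n)%R%:E).
    by apply/measurable_EFinP; exact: measurable_funX.
  rewrite ge0_integral_sum//=; last 2 first.
  - by move=> i; apply: emeasurable_funM => //; exact: measurable_cst.
  - move=> i t; rewrite /I /= in_itv /= => /andP[t0 _].
    by rewrite -EFinM lee_fin mulr_ge0// ?exprn_ge0 ?(ltW t0)// mulr_ge0// density_ge0.
  apply: eq_bigr => i _; rewrite ge0_integralZl_EFin//; last 2 first.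
  - by move=> t; rewrite /I /= in_itv /= => /andP[t0 _]; rewrite lee_fin exprn_ge0// ltW.
  - by rewrite mulr_ge0// density_ge0.
  rewrite integral_exprn// -!EFinM /ci; congr EFin; ring.
have mfE (i : 'I_d.+1) : measurable_fun b (fun y : borel R d => (f i y)%:E).
  by apply/measurable_EFinP; exact: mf.
rewrite ge0_integral_sum//=; last 2 first.
- by move=> i; apply: emeasurable_funM => //; exact: measurable_cst.
- by move=> i y /bO Oy; rewrite -EFinM lee_fin mulr_ge0// density_ge0.
apply: eq_bigr => i _; rewrite ge0_integralZl_EFin//.
  (* This goal comes from the measure structure of [lebesgue_row], which takes the measurability of
     the map as an argument. *)
  exact: measurable_row_of_tuple.
by move=> y /bO Oy; rewrite lee_fin density_ge0.
Qed.

(** All terms of the jacobian at t = 1 are nonnegative and the binomial coefficients are at least 1,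
    so this continuous function dominates every density. *)
Lemma density_bounded (A : set 'rV[R]_d) (i : 'I_d.+1) : compact A -> A `<=` O' ->
  exists2 M : R, 0 <= M & forall y, A y -> f i y <= M.
Proof.
move=> kA AO; have [A0|noA] := pselect (A !=set0); last first.
  by exists 0 => // y Ay; exfalso; apply: noA; exists y.
have cA : {within A, continuous (jacobian ^~ 1)}.
  by apply: continuous_in_subspaceT => y; rewrite inE => /AO; exact: jacobian_continuous.
have [y0] := EVT_max_rV A0 kA cA; rewrite inE => Ay0 hy0.
exists (jacobian y0 1) => [|y Ay]; first by rewrite ltW// jacobian_gt0//; exact: AO.
have Oy := AO y Ay; apply: (@le_trans _ _ (jacobian y 1)); last by apply: hy0; rewrite inE.
rewrite jacobian_expand// (bigD1 i)//= expr1n mulr1.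
apply: (@le_trans _ _ ('C(d, i)%:R * f i y)).
  by rewrite ler_peMl ?density_ge0// ler1n bin_gt0 -ltnS.
rewrite lerDl; apply: sumr_ge0 => j _.
by rewrite expr1n mulr1 mulr_ge0// density_ge0.
Qed.

Lemma density_integral_compact (A : set 'rV[R]_d) (i : 'I_d.+1) :
  compact A -> A `<=` O' -> (\int[lam d]_(y in A) (f i y)%:E < +oo)%E.
Proof.
move=> kA AO; have [M M0 hM] := density_bounded i kA AO.
have mA := borel_compact kA.
have mf : measurable_fun (A : set (borel R d)) (fun y : borel R d => (f i y)%:E).
  by apply/measurable_EFinP; exact: density_measurableS.
apply: (@le_lt_trans _ _ (\int[lam d]_(y in A) M%:E)%E).
  apply: ge0_le_integral => //.
  by move=> y /AO Oy; rewrite lee_fin density_ge0.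
rewrite integral_cst//.
have [N N0 hN] := bounded_setP (compact_bounded kA).
apply: lte_mul_pinfty => //.
apply: le_lt_trans (lebesgue_row_norm_ball (N + 1)); apply: le_measure.
- by rewrite inE.
- by rewrite inE; apply: borel_open; exact: open_norm_ball.
- by move=> y /hN yN; apply: le_lt_trans yN _; rewrite ltrDl.
Qed.

(** From (d + 1 - i) C(d + 1, i) = (d + 1) C(d, i). *)
Lemma binomial_coefficient (e : R) (i : 'I_d.+1) :
  'C(d, i)%:R * (e ^+ (d - i).+1 / (d - i).+1%:R) =
  d.+1%:R^-1 * (e ^+ (d.+1 - i) * 'C(d.+1, i)%:R).
Proof.
have id : (i <= d)%N by rewrite -ltnS.
rewrite -subSn//.
have s0 : (d.+1 - i)%:R != 0 :> R by rewrite pnatr_eq0 subn_eq0 -ltnNge.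
have d0 : d.+1%:R != 0 :> R by rewrite pnatr_eq0.
have := mul_bin_down d.+1 i => /= /(congr1 (fun m => m%:R : R)); rewrite !natrM => E.
apply: (mulfI d0); rewrite [RHS]mulVKf// [LHS]mulrA E.
transitivity (e ^+ (d.+1 - i) * 'C(d.+1, i)%:R * ((d.+1 - i)%:R / (d.+1 - i)%:R)).
  by ring.
by rewrite mulfV// mulr1.
Qed.

Lemma steiner_existence : exists S, steiner_measures Omega K B omega S /\
  forall (i : 'I_d.+1) (b : set (borel R d)), measurable b -> b `<=` O' ->
    S i b = (\int[lam d]_(y in b) (f i y)%:E)%E.
Proof.
have mO : measurable (O' : set (borel R d)).
  by apply: borel_open; exact: adapted_dual_open CB.
have Ex (i : 'I_d.+1) : exists nu : {measure set (borel R d) -> \bar R},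
    forall A, measurable A -> nu A = (\int[lam d]_(y in A `&` O') (f i y)%:E)%E.
  apply: density_measure => //.
    by apply/measurable_EFinP; exact: density_measurable.
  by move=> y Oy; rewrite lee_fin density_ge0.
have [S hS] := choice Ex; exists S.
have SE i (b : set (borel R d)) : measurable b -> b `<=` O' ->
    S i b = (\int[lam d]_(y in b) (f i y)%:E)%E.
  by move=> mb bO; rewrite hS//; congr integral; exact/setIidPl.
split => //; split=> [i|e b e0 mb bO].
  apply: radon_on_finite; first exact: adapted_dual_open CB.
  by move=> A kA AO; rewrite SE//; [exact: density_integral_compact|exact: borel_compact].
rewrite volume_one_sided_nbhd// ge0_sume_distrr => [|i _]; last first.
  by rewrite mule_ge0// lee_fin mulr_ge0// exprn_ge0// ltW.
by apply: eq_bigr => i _; rewrite binomial_coefficient SE// EFinM muleA.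
Qed.

Lemma steiner_unique S S' : steiner_measures Omega K B omega S ->
  steiner_measures Omega K B omega S' ->
  forall (i : 'I_d.+1) (b : set (borel R d)), measurable b -> b `<=` O' ->
    S i b = S' i b.
Proof.
move=> [rS eS] [rS' eS'] i b mb bO.
have [A [kA ndA AU]] := open_sigma_compact (adapted_dual_open CB).
have AO k : A k `<=` O' by rewrite -AU; exact: bigcup_sup.
suff h k : S i (b `&` A k) = S' i (b `&` A k).
  have c1 := measure_exhaustion (mu := S i) kA ndA AU mb bO.
  have c2 := measure_exhaustion (mu := S' i) kA ndA AU mb bO.
  rewrite -(cvg_lim _ c1)// -(cvg_lim _ c2)//; congr (lim (_ @ \oo)).
  by apply/funext.
have mA : measurable (A k : set (borel R d)) by exact: borel_compact.
set c := b `&` A k; have mc : measurable c by exact: measurableI.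
have cO : c `<=` O' by move=> y [/bO].
have fin (T : 'I_d.+1 -> {measure set (borel R d) -> \bar R}) :
    (forall i, radon_on O' (T i)) -> forall j, T j c \is a fin_num.
  move=> rT j; rewrite ge0_fin_numE//; apply: le_lt_trans ((rT j).1 (A k) (kA k) (AO k)).
  by apply: le_measure; rewrite ?inE// => y [].
(* All exponents d + 1 - i are at least 1: one factor e is taken out and the sum reversed, which
   leaves a polynomial of degree at most d for the Vandermonde nodes. Finiteness on the compact
   pieces allows real coefficients. *)
have poly (T : 'I_d.+1 -> {measure set (borel R d) -> \bar R}) (e : R) : 0 < e ->
    (forall i, radon_on O' (T i)) ->
    (d.+1%:R^-1%:E * \sum_(i < d.+1) (e ^+ (d.+1 - i) * 'C(d.+1, i)%:R)%R%:E * T i c)%E =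
    (e * \sum_(j < d.+1) ('C(d, rev_ord j)%:R / (d - rev_ord j).+1%:R *
      fine (T (rev_ord j) c)) * e ^+ j)%:E.
  move=> e0 rT; rewrite ge0_sume_distrr => [|j _]; last first.
    by rewrite mule_ge0// lee_fin mulr_ge0// exprn_ge0// ltW.
  rewrite mulr_sumr -sumEFin [RHS](reindex_inj rev_ord_inj); apply: eq_bigr => j _.
  rewrite rev_ordK muleA -EFinM -binomial_coefficient -[X in (_ * X)%E](fineK (fin T rT j)).
  rewrite -EFinM; congr EFin; rewrite exprS /= subSS.
  by ring.
pose x (T : 'I_d.+1 -> {measure set (borel R d) -> \bar R}) (j : 'I_d.+1) : R :=
  'C(d, rev_ord j)%:R / (d - rev_ord j).+1%:R * fine (T (rev_ord j) c).
have [v hv] := @vandermonde_inverse R d.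
have : x S (rev_ord i) = x S' (rev_ord i).
  rewrite (hv (x S)) (hv (x S')); apply: eq_bigr => l _; congr (_ * _).
  have l0 : 0 < l.+1%:R :> R by rewrite ltr0n.
  have := eS _ _ l0 mc cO; rewrite (eS' _ _ l0 mc cO) !poly// => -[].
  by move=> /(mulfI (lt0r_neq0 l0)) ->.
have q0 : 'C(d, i)%:R / (d - i).+1%:R != 0 :> R.
  by rewrite mulf_neq0 ?invr_neq0 ?pnatr_eq0// -lt0n bin_gt0 -ltnS.
rewrite /x rev_ordK => /(mulfI q0) xE.
by rewrite -(fineK (fin S rS i)) -(fineK (fin S' rS' i)) xE.
Qed.

End steiner.

Theorem theorem4p7 (R : realType) (d : nat) (d_ge2 : (2 <= d)%N)
    (C : set 'rV[R]_(d + 1)) (C_cone : proper_open_convex_cone C)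
    (B : 'M[R]_(d + 1)) (Omega : set 'rV[R]_d)
    (B_adapted : adapted_basis C B Omega)
    (omega : 'rV[R]_d -> R) (omega_CY : cheng_yau Omega omega)
    (K : set 'rV[R]_(d + 1)) (K_Cconvex : C_convex_domain C K)
    (K_C2plus : C2plus K) :
  [/\ (exists S, steiner_measures Omega K B omega S),
      (forall (i : 'I_d.+1) y, dual_domain Omega y ->
         0 < sigma C K B omega i y) &
      (forall S, steiner_measures Omega K B omega S ->
         forall (i : 'I_d.+1) (b : set (borel R d)),
           measurable b -> b `<=` dual_domain Omega ->
           S i b = (\int[lebesgue_row d]_(y in b)
             (sigma C K B omega i y * affine_sphere_density omega y)%:E)%E)].
Proof.
have [S [hS SE]] := steiner_existence B_adapted K_Cconvex K_C2plus omega_CY.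
split; first by exists S.
- exact: sigma_gt0 B_adapted K_Cconvex K_C2plus omega_CY.
- move=> S' hS' i b mb bO; rewrite -SE//.
  exact: (steiner_unique B_adapted hS' hS).
Qed.
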